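(* Let $n\ge2$, $\rho>0$ and $\Omega_\rho:=\{x\in\mathbb{R}^n:|x|<\rho\}$. Let $C>0$ and $\gamma>1$, and let $u\in H^1_{loc}(\Omega_\rho;\mathbb{C}^N)$ be such that $$|\mathcal{D}_nu(x)|\le\frac{C}{|x|^\gamma}\,|u(x)|\quad\text{in }\Omega_\rho\setminus\{0\}.$$ Then there exists $\tau_0>0$ such that, if $$\exp\left[\frac{\tau}{|x|^{2\gamma-2}}\right]u\in L^2(\Omega_\rho;\mathbb{C}^N)\quad\text{for all }\tau>\tau_0,$$ then $u$ vanishes in a neighborhood of $0$.
   Context: For $n\ge2$, $N:=2^{\lfloor\frac{n+1}{2}\rfloor}$, and $\alpha_1,\dots,\alpha_{n+1}\in\mathbb{C}^{N\times N}$ are fixed Hermitian matrices satisfying $\alpha_j\alpha_k+\alpha_k\alpha_j=2\delta_{j,k}\mathbb{I}_N$ for $1\le j,k\le n+1$ ($\delta_{j,k}$ the Kronecker delta, $\mathbb{I}_N$ the identity matrix). The massless Dirac operator $\mathcal{D}_n$ acts on functions $\psi:\mathbb{R}^n\to\mathbb{C}^N$ (or on open subsets) by $\mathcal{D}_n\psi:=-i\sum_{j=1}^n\alpha_j\partial_j\psi$. $|\cdot|$ denotes the Euclidean norm. For Sobolev functions, pointwise inequalities and vanishing are understood almost everywhere. *)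

(* Defs.v *)
From HB Require Import structures.
From mathcomp Require Import all_boot all_order all_algebra.
From mathcomp Require Import all_classical all_reals all_analysis.
From mathcomp Require Import complex.

Set Implicit Arguments.
Unset Strict Implicit.
Unset Printing Implicit Defensive.

Import Order.TTheory GRing.Theory Num.Theory.
Import numFieldNormedType.Exports.

Local Open Scope classical_set_scope.
Local Open Scope ring_scope.

Section measurable_rV.
Context {R : realType} {n : nat}.

Let coors (i : 'I_n) (x : 'rV[R]_n) : R := x 0 i.

Let rV_set0 : g_sigma_preimage coors set0.
Proof. exact: sigma_algebra0. Qed.

Let rV_setC A : g_sigma_preimage coors A -> g_sigma_preimage coors (~` A).
Proof. exact: sigma_algebraC. Qed.

Let rV_bigcup (F : (set 'rV[R]_n)^nat) :
  (forall i, g_sigma_preimage coors (F i)) ->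
  g_sigma_preimage coors (\bigcup_i (F i)).
Proof. exact: sigma_algebra_bigcup. Qed.

(* The product sigma-algebra, generated by the coordinates; it coincides with
   the Borel sigma-algebra of R^n. *)
HB.instance Definition _ := @isMeasurable.Build default_measure_display
  'rV[R]_n (g_sigma_preimage coors) rV_set0 rV_setC rV_bigcup.

Lemma measurable_rV_coord (i : 'I_n) :
  measurable_fun [set: 'rV[R]_n] (fun x : 'rV[R]_n => x 0 i).
Proof.
move=> _ Y mY; rewrite setTI; apply: sub_sigma_algebra => /=.
rewrite -bigcup_seq/=; exists i => /=; first by rewrite mem_index_enum.
by exists Y => //; rewrite setTI.
Qed.

Lemma measurable_fun_rV d (T : measurableType d) (f : T -> 'rV[R]_n) :
  (forall i, measurable_fun [set: T] (fun x => f x 0 i)) ->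
  measurable_fun [set: T] f.
Proof.
move=> mf.
have H : g_sigma_preimage (fun i => coors i \o f) `<=` measurable.
  apply: smallest_sub; first exact: sigma_algebra_measurable.
  move=> A; rewrite -bigcup_seq => -[i _ [B mB <-]].
  exact: mf.
move=> _ A mA; apply: H; rewrite g_sigma_preimage_comp.
by exists A.
Qed.

End measurable_rV.

Section lebesgue_rV.
Context {R : realType}.

Definition rV_cons n (p : R * 'rV[R]_n) : 'rV[R]_n.+1 := row_mx p.1%:M p.2.

Definition rV_uncons n (x : 'rV[R]_n.+1) : R * 'rV[R]_n :=
  (x 0 0, @rsubmx R 1 1 n x).

Lemma rV_consK n : cancel (@rV_cons n) (@rV_uncons n).
Proof.
move=> [t x]; rewrite /rV_cons /rV_uncons; congr pair; last exact: row_mxKr.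
by rewrite mxE; case: splitP => j; rewrite /= ?ord1 ?mxE.
Qed.

Lemma rV_cons0 n (p : R * 'rV[R]_n) : rV_cons p 0 0 = p.1.
Proof. by have := congr1 fst (rV_consK p). Qed.

Lemma rV_consS n (p : R * 'rV[R]_n) i : rV_cons p 0 (lift ord0 i) = p.2 0 i.
Proof.
rewrite /rV_cons mxE; case: splitP => j; first by rewrite ord1.
by rewrite /= add1n => -[/val_inj <-].
Qed.

Lemma measurable_rV_cons n : measurable_fun setT (@rV_cons n).
Proof.
apply: measurable_fun_rV => i; case: (unliftP ord0 i) => [j ->|->].
  rewrite (_ : (fun _ => _) = (fun x : 'rV[R]_n => x 0 j) \o snd).
    exact: measurableT_comp (measurable_rV_coord j) measurable_snd.
  by apply/funext => p; exact: rV_consS.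
by rewrite (_ : (fun _ => _) = fst)//; apply/funext => p; exact: rV_cons0.
Qed.

Lemma measurable_rV_uncons n : measurable_fun setT (@rV_uncons n).
Proof.
apply/measurable_fun_pairP; split.
  exact: measurable_rV_coord.
apply: measurable_fun_rV => i.
rewrite (_ : (fun _ => _) = fun x : 'rV[R]_n.+1 => x 0 (rshift 1 i)).
  exact: measurable_rV_coord.
by apply/funext => x; rewrite /rV_uncons /= mxE.
Qed.

Section step.
Context {n : nat} (mu : {sigma_finite_measure set 'rV[R]_n -> \bar R}).

Definition lebesgue_rV_step : set 'rV[R]_n.+1 -> \bar R :=
  pushforward (@lebesgue_measure R \x mu)%E (@rV_cons n).

Let step0 : lebesgue_rV_step set0 = 0%E.
Proof. by rewrite /lebesgue_rV_step /pushforward preimage_set0 measure0. Qed.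

Let step_ge0 A : (0 <= lebesgue_rV_step A)%E.
Proof. by rewrite /lebesgue_rV_step /pushforward measure_ge0. Qed.

Let step_sigma_additive : semi_sigma_additive lebesgue_rV_step.
Proof.
have mp (A : set 'rV[R]_n.+1) : measurable A -> measurable (@rV_cons n @^-1` A).
  by move=> mA; rewrite -[X in measurable X]setTI; exact: measurable_rV_cons.
move=> F mF tF mUF; rewrite /lebesgue_rV_step /pushforward preimage_bigcup.
apply: measure_semi_sigma_additive.
- by move=> k; exact: mp.
- apply/trivIsetP => /= i j _ _ ij; rewrite -preimage_setI.
  by move/trivIsetP : tF => /(_ _ _ _ _ ij) ->//; rewrite preimage_set0.
- by rewrite -preimage_bigcup; exact: mp.
Qed.

HB.instance Definition _ := isMeasure.Build _ _ _
  lebesgue_rV_step step0 step_ge0 step_sigma_additive.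

Let step_sigma_finite : sigma_finite setT lebesgue_rV_step.
Proof.
have /sigma_finiteP[F [TF ndF Foo]] := sigma_finiteT (@lebesgue_measure R).
have /sigma_finiteP[G [TG ndG Goo]] := sigma_finiteT mu.
exists (fun k => @rV_uncons n @^-1` (F k `*` G k)).
  rewrite -preimage_bigcup (_ : \bigcup_k (F k `*` G k) = setT) ?preimage_setT//.
  rewrite -setXTT TF TG predeqE => -[x y]; split.
    by move=> [k _ []/= ? ?]; split; exists k.
  move=> [/= [k _ Fkx] [l _ Gly]]; exists (maxn k l) => //; split.
  - by move: x Fkx; exact/subsetPset/ndF/leq_maxl.
  - by move: y Gly; exact/subsetPset/ndG/leq_maxr.
move=> k; have [mF Fk] := Foo k; have [mG Gk] := Goo k; split.
  rewrite -[X in measurable X]setTI; apply: measurable_rV_uncons => //.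
  exact: measurableX.
rewrite /lebesgue_rV_step /pushforward -comp_preimage.
rewrite (_ : _ \o _ = id) ?preimage_id; last first.
  by apply/funext => p; exact: rV_consK.
by rewrite product_measure1E// lte_mul_pinfty// ge0_fin_numE.
Qed.

HB.instance Definition _ := Measure_isSigmaFinite.Build _ _ _
  lebesgue_rV_step step_sigma_finite.

End step.

Fixpoint lebesgue_rV n : {sigma_finite_measure set 'rV[R]_n -> \bar R} :=
  if n is m.+1 then lebesgue_rV_step (lebesgue_rV m) else \d_(0 : 'rV[R]_0).

Lemma measurable_rV_box n (a b : 'rV[R]_n) :
  measurable [set x : 'rV[R]_n | forall i, a 0 i <= x 0 i <= b 0 i].
Proof.
rewrite (_ : [set _ | _] = \bigcap_(i in [set: 'I_n])
    ((fun x : 'rV[R]_n => x 0 i) @^-1` `[a 0 i, b 0 i]%classic)).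
  apply: fin_bigcap_measurable => // i _.
  rewrite -[X in measurable X]setTI.
  by apply: measurable_rV_coord => //; exact: measurable_itv.
by apply/seteqP; split=> x /= h i; have := h i; rewrite /= in_itv //=; apply.
Qed.

(* Lebesgue measure is the measure that gives boxes their elementary volume. *)
Lemma lebesgue_rV_box n (a b : 'rV[R]_n) : (forall i, a 0 i <= b 0 i) ->
  lebesgue_rV n [set x : 'rV[R]_n | forall i, a 0 i <= x 0 i <= b 0 i] =
  (\prod_(i < n) (b 0 i - a 0 i))%:E.
Proof.
elim: n a b => [|n IH] a b ab.
  by rewrite big_ord0 /= /dirac indicE mem_set// => -[].
pose a' : 'rV[R]_n := \row_i a 0 (lift ord0 i).
pose b' : 'rV[R]_n := \row_i b 0 (lift ord0 i).
rewrite /= /lebesgue_rV_step /pushforward.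
rewrite (_ : _ @^-1` _ = `[a 0 0, b 0 0]%classic `*`
    [set x : 'rV[R]_n | forall i, a' 0 i <= x 0 i <= b' 0 i]); last first.
  apply/seteqP; split=> -[t x] /=.
    move=> h; split; first by have := h 0; rewrite rV_cons0 in_itv.
    by move=> i; have := h (lift ord0 i); rewrite rV_consS !mxE.
  rewrite in_itv/= => -[ht hx] i.
  case: (unliftP ord0 i) => [j ->|->]; last by rewrite rV_cons0.
  by rewrite rV_consS; have := hx j; rewrite !mxE.
rewrite product_measure1E//=; last exact: measurable_rV_box.
rewrite IH; last by move=> i; rewrite !mxE.
rewrite lebesgue_measure_itv/= lte_fin big_ord_recl EFinM.
congr (_ * _%:E)%E; last by apply: eq_bigr => i _; rewrite !mxE.
case: ltP => // ba; rewrite (_ : b 0 0 = a 0 0) ?subrr//.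
by apply/eqP; rewrite eq_le ba ab.
Qed.

End lebesgue_rV.

Section euclidean_norms.
Context {R : realType}.

Definition enorm n (x : 'rV[R]_n) : R := Num.sqrt (\sum_(i < n) x 0 i ^+ 2).

Definition cnorm N (z : 'cV[R[i]]_N) : R :=
  Num.sqrt (\sum_(k < N) (complex.Re (z k 0) ^+ 2 + complex.Im (z k 0) ^+ 2)).

Definition eball n (r : R) : set 'rV[R]_n := [set x | enorm x < r].

End euclidean_norms.

Section sobolev.
Context {R : realType} {n N : nat}.
Implicit Types (D K Omega : set 'rV[R]_n) (f u v : 'rV[R]_n -> 'cV[R[i]]_N).

Definition cvmeasurable D f := forall k : 'I_N,
  measurable_fun D (fun x => complex.Re (f x k 0)) /\
  measurable_fun D (fun x => complex.Im (f x k 0)).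

Definition L2 D f := cvmeasurable D f /\
  (\int[lebesgue_rV n]_(x in D) (cnorm (f x) ^+ 2)%:E < +oo)%E.

Definition L2loc Omega f :=
  forall K, compact K -> K `<=` Omega -> L2 K f.

Definition partial (j : 'I_n) (phi : 'rV[R]_n -> R) : 'rV[R]_n -> R :=
  fun x => 'D_('e_j) phi x.

Definition smooth (phi : 'rV[R]_n -> R) := forall s : seq 'I_n,
  let psi := foldr partial phi s in
  continuous psi /\ forall j x, derivable psi x 'e_j.

Definition test_function Omega (phi : 'rV[R]_n -> R) :=
  let supp := closure [set x | phi x != 0] in
  [/\ smooth phi, compact supp & supp `<=` Omega].

Definition cintegral D (g : 'rV[R]_n -> R[i]) : R[i] :=
  Complex (\int[lebesgue_rV n]_(x in D) complex.Re (g x))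
          (\int[lebesgue_rV n]_(x in D) complex.Im (g x)).

(* Real test functions suffice: the identity is C-linear in phi. *)
Definition is_weak_partial Omega (j : 'I_n) u v :=
  forall phi, test_function Omega phi -> forall k : 'I_N,
    cintegral Omega (fun x => u x k 0 * (partial j phi x)%:C%C) =
    - cintegral Omega (fun x => v x k 0 * (phi x)%:C%C).

Definition H1loc Omega u := L2loc Omega u /\
  forall j, exists2 v, L2loc Omega v & is_weak_partial Omega j u v.

(* A representative of the weak derivative, which is unique up to equality
   almost everywhere in Omega; it is the zero function by default. *)
Definition weak_partial Omega (j : 'I_n) u : 'rV[R]_n -> 'cV[R[i]]_N :=
  xget (cst 0) [set v | L2loc Omega v /\ is_weak_partial Omega j u v].

End sobolev.

Section dirac.
Context {R : realType} {n N : nat}.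
Implicit Types (alpha : 'I_n.+1 -> 'M[R[i]]_N).

Definition dirac_matrices alpha :=
  (forall j, alpha j \is hermsymmx) /\
  (forall j k, alpha j *m alpha k + alpha k *m alpha j =
               (2 * (j == k)%:R)%:M).

(* Only the first n of the n + 1 matrices enter the massless operator. *)
Definition dirac_op alpha (Omega : set 'rV[R]_n) (u : 'rV[R]_n -> 'cV[R[i]]_N) :
    'rV[R]_n -> 'cV[R[i]]_N :=
  fun x => - 'i%C *: \sum_(j < n)
    alpha (widen_ord (leqnSn n) j) *m weak_partial Omega j u x.

End dirac.

Definition spinor_dim (n : nat) : nat := (2 ^ (n.+1)./2)%N.

(* Main.v *)
Require Import Defs.
From HB Require Import structures.
From mathcomp Require Import all_boot all_order all_algebra.
From mathcomp Require Import all_classical all_reals all_analysis.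
From mathcomp Require Import complex.
From mathcomp Require Import ring lra measurable_realfun.

Set Implicit Arguments.
Unset Strict Implicit.
Unset Printing Implicit Defensive.

Import Order.TTheory GRing.Theory Num.Theory.
Import numFieldNormedType.Exports.

Local Open Scope classical_set_scope.
Local Open Scope ring_scope.

(* Write [a = gamma - 1], [s = |x|^2] and [D = sum_j alpha_j d_j].  By the Clifford
   relations [(sum_k x_k alpha_k) D u = e + g], where [e = x . grad u] and
   [g = sum_(k,j) x_k (alpha_k alpha_j - alpha_j alpha_k) / 2 d_j u] contains only
   angular derivatives, and [|e + g|^2 = s |D u|^2 <= C^2 s^-a |u|^2].  For a radial
   weight [m = exp (2 phi)] with [psi = x . grad phi], polarization gives
   [|e + g|^2 >= 4 Re <e + c u, g - c u>] with [c = n / 2 + psi]; integrating against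
   [m], the terms containing [g] vanish and the remaining ones give
   [int m |e + g|^2 >= 2 int m (x . grad psi) |u|^2].  With
   [phi = tau s^-a - h s^-2a - 1 / (r^2 - s)] one lets [h] tend to [0], which the
   integrability of [exp (tau s^-a) u] for every [tau > 1] permits, and then [tau] to
   infinity: the term [4 a^2 tau s^-a] in [x . grad psi] beats [C^2 s^-a], and the
   errors due to the cutoff live at larger [s], where the weight is exponentially
   smaller.  Hence [u = 0] for [s <= r^2 / 4], with [tau0 = 1]. *)

(** * Smooth functions flat at a point *)

(** The matrices in [g] are antisymmetric in their two indices and skew for the real inner product,
    so [m <e, g>] is a combination of two by two minors of the gradient of [u]. In an integration by
    parts the second derivatives cancel, and what is left is [- q <u, g>] with [q = n m / 2 + s m'].
    The shift in the polarization is [c = q / m] because this is the value that cancels that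
    remainder. The obstacle is regularity: [u] is only in [H^1_loc], so nothing can be
    differentiated twice and every product of weak derivatives has to be regularized before
    integrating by parts. The cutoff sits in the weight and not in [u]: flat at [s = 0] and at
    [s = r^2], the weight keeps all identities free of boundary terms and of commutators with a
    cutoff function. The price is a term in [s^-2a] of the wrong sign, of size [h]. It is paid for
    by the integrability at [tau + 1], since [y^2 <= exp (2 y)] for [y = s^-a]. All bounds are kept
    affine in [h], so [h -> 0] takes no convergence theorem. As [tau] is sent to infinity, any
    positive threshold [tau0] would serve. *)

Section differentiation_classes.
Context {R : realType}.

Section directional.
Context {V : normedModType R}.

(** Along the line through [x] in direction [v] everything is a function of one real variable, where
    the usual chain rule applies. *)
Lemma is_derive_comp_dir (f : R -> R) (g : V -> R) (x v : V) (df dg : R) :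
  is_derive (g x) 1 f df -> is_derive x v g dg ->
  is_derive x v (f \o g) (df * dg).
Proof.
move=> [f_der <-] [g_der <-].
have gl_der : derivable (fun h : R => g (h *: v + x)) 0 1.
  by case: (derivable1P g x v) => + _; apply.
have x0 : (0 : R) *: v + x = x by rewrite scale0r add0r.
have fl_der : derivable f (g ((0 : R) *: v + x)) 1 :=
  eq_ind_r (fun y => derivable f (g y) 1) f_der x0.
have e (h : V -> R) : 'D_v h x = (fun t : R => h (t *: v + x))^`()%classic 0.
  have E : (fun k : R => k^-1 *: (h (k *: v + x) - h x)) =
      (fun k : R => k^-1 *: (h ((k + 0) *: v + x) - h (0 *: v + x))).
    by apply/funext => k; rewrite addr0 scale0r add0r.
  by rewrite /derive1 /derive E.
have comp_der : derivable (f \o g) x v.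
  apply/derivable1P/derivable1_diffP.
  apply: (@differentiable_comp _ _ _ _ (fun h : R => g (h *: v + x)) f).
    exact/derivable1_diffP.
  exact/derivable1_diffP.
apply: DeriveDef => //.
rewrite (e (f \o g)) (e g) (derive1_comp gl_der fl_der) x0.
by rewrite derive1E.
Qed.

Context {I : Type} (d : I -> V).

(** Derivatives are carried as witnesses along a fixed family [d] of directions. One induction on
    [k] then covers both functions on the line ([dir1]) and functions on [R^n] ([dirn]), and closure
    under products and composition follows from the pointwise rules. *)
Fixpoint Ck (k : nat) (f : V -> R) : Prop :=
  continuous f /\
  if k is k'.+1 then
    forall i, exists2 f', (forall x, is_derive x (d i) f (f' x)) & Ck k' f'
  else True.

Lemma Ck_continuous k f : Ck k f -> continuous f. Proof. by case: k => [|k] []. Qed.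

Lemma CkS k f : Ck k.+1 f -> Ck k f.
Proof.
elim: k f => [|k IH] f [cf h]; first by split.
by split=> // i; have [f' ff' /IH] := h i; exists f'.
Qed.

Lemma Ck_cst k c : Ck k (cst c).
Proof.
elim: k c => [|k IH] c; split=> //=; try exact: cst_continuous.
by move=> i; exists (cst 0) => // x; exact: is_derive_cst.
Qed.

Lemma CkD k f g : Ck k f -> Ck k g -> Ck k (fun x => f x + g x).
Proof.
elim: k f g => [|k IH] f g [cf hf] [cg hg]; split=> //=;
  try by move=> x; apply: cvgD; [exact: cf|exact: cg].
move=> i; have [f' ff' cf'] := hf i; have [g' gg' cg'] := hg i.
exists (fun x => f' x + g' x); last exact: IH.
by move=> x; exact: is_deriveD.
Qed.

Lemma CkM k f g : Ck k f -> Ck k g -> Ck k (fun x => f x * g x).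
Proof.
elim: k f g => [|k IH] f g Hf Hg; move: (Hf) (Hg) => [cf hf] [cg hg]; split=> //=;
  try by move=> x; apply: cvgM; [exact: cf|exact: cg].
move=> i; have [f' ff' cf'] := hf i; have [g' gg' cg'] := hg i.
exists (fun x => f x * g' x + g x * f' x); last first.
  by apply: CkD; apply: IH => //; exact: CkS.
by move=> x; exact: is_deriveM.
Qed.

Lemma CkZ k c f : Ck k f -> Ck k (fun x => c * f x).
Proof. by apply: CkM; exact: (Ck_cst k c). Qed.

Lemma Ck_sum k (J : Type) (s : seq J) (P : pred J) (F : J -> V -> R) :
  (forall j, Ck k (F j)) -> Ck k (fun x => \sum_(j <- s | P j) F j x).
Proof.
move=> h; elim: s => [|j s IH].
  rewrite (_ : (fun _ => _) = cst 0); first exact: Ck_cst.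
  by apply/funext => x; rewrite big_nil.
case Pj : (P j); last first.
  rewrite (_ : (fun _ => _) = fun x => \sum_(j <- s | P j) F j x) //.
  by apply/funext => x; rewrite big_cons Pj.
rewrite (_ : (fun _ => _) = fun x => F j x + \sum_(j <- s | P j) F j x).
  exact: CkD.
by apply/funext => x; rewrite big_cons Pj.
Qed.

Lemma Ck_prod k (J : Type) (s : seq J) (F : J -> V -> R) :
  (forall j, Ck k (F j)) -> Ck k (fun x => \prod_(j <- s) F j x).
Proof.
move=> h; elim: s => [|j s IH].
  rewrite (_ : (fun _ => _) = cst 1); first exact: Ck_cst.
  by apply/funext => x; rewrite big_nil.
rewrite (_ : (fun _ => _) = fun x => F j x * \prod_(j <- s) F j x).
  exact: CkM.
by apply/funext => x; rewrite big_cons.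
Qed.

Lemma Ck_affine k f (c : I -> R) : continuous f ->
  (forall i x, is_derive x (d i) f (c i)) -> Ck k f.
Proof.
case: k => [|k] cf fc; split=> // i; exists (cst (c i)) => //; exact: Ck_cst.
Qed.

End directional.

Definition dir1 : unit -> R := fun=> 1.

Lemma Ck_comp (V : normedModType R) (I : Type) (d : I -> V) k
    (f : R -> R) (g : V -> R) :
  Ck dir1 k f -> Ck d k g -> Ck d k (f \o g).
Proof.
elim: k f g => [|k IH] f g Hf Hg; move: (Hf) (Hg) => [cf hf] [cg hg]; split=> //=;
  try by move=> x; apply: continuous_comp; [exact: cg|exact: cf].
move=> i; have [g' gg' cg'] := hg i; have [f' ff' cf'] := hf tt.
exists (fun x => f' (g x) * g' x); last first.
  by apply: CkM => //; apply: IH => //; exact: CkS.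
by move=> x; exact: is_derive_comp_dir.
Qed.

End differentiation_classes.

Section smooth_functions.
Context {R : realType} {n : nat}.

Definition dirn : 'I_n -> 'rV[R]_n := fun j => 'e_j.

Lemma smooth_Ck (phi : 'rV[R]_n -> R) : (forall k, Ck dirn k phi) -> smooth phi.
Proof.
move=> h s; suff: forall k, Ck dirn k (foldr (@partial R n) phi s).
  move=> hk /=; split; first exact: (Ck_continuous (hk 0)).
  by move=> j x; have [_ /(_ j)[f' /(_ x)[]]] := hk 1.
elim: s => [|j s IH] k //=.
have [_ /(_ j)[f' ff' cf']] := IH k.+1.
by rewrite (_ : partial _ _ = f')//; apply/funext => x; have [_] := ff' x.
Qed.

Lemma coord_is_derive (i j : 'I_n) (x : 'rV[R]_n) :
  is_derive x ('e_j : 'rV[R]_n) (fun y : 'rV[R]_n => y 0 i) ((i == j)%:R).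
Proof.
have lim_eq : (fun h : R => h^-1 *: ((fun y : 'rV[R]_n => y 0 i) (h *: 'e_j + x) - x 0 i)) @ 0^'
    --> ((i == j)%:R : R).
  apply: cvg_near_cst; near=> h.
  rewrite !mxE /= addrK [_ *: _]mulrA mulVf ?mul1r//.
  by near: h; exact: nbhs_dnbhs_neq.
by apply: DeriveDef; [apply/cvg_ex; exists ((i == j)%:R)|exact/cvg_lim].
Unshelve. all: by end_near. Qed.

Lemma Ck_coord k i : Ck dirn k (fun x : 'rV[R]_n => x 0 i).
Proof.
apply: (@Ck_affine R _ _ dirn k _ (fun j => (i == j)%:R)).
  exact: coord_continuous.
by move=> j x; exact: coord_is_derive.
Qed.

End smooth_functions.

Section flat_functions.
Context {R : realType}.
Implicit Types a A B c s : R.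

(** For [s > 0], [flat a A B c s] is [s^-c exp (A s^-a - B s^-2a)], with powers written through
    [ln]. A further power of [s] only changes [c], so the family is closed under differentiation,
    and [B > 0] forces flatness at [0] whatever the sign of [A]. *)
Definition flat_phase a A B c s : R :=
  - c * ln s + A * expR (- a * ln s) - B * expR (- (2 * a) * ln s).

Definition flat a A B c s : R :=
  if 0 < s then expR (flat_phase a A B c s) else 0.

Lemma flat_ge0 a A B c s : 0 <= flat a A B c s.
Proof. by rewrite /flat; case: ifP => // _; exact: expR_ge0. Qed.

Lemma flat_le0 a A B c s : s <= 0 -> flat a A B c s = 0.
Proof. by rewrite /flat; case: ltP. Qed.

Lemma flatE a A B c s : 0 < s -> flat a A B c s = expR (flat_phase a A B c s).
Proof. by rewrite /flat => ->. Qed.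

Lemma flatD a A B c d s : 0 < s ->
  flat a A B (c + d) s = expR (- d * ln s) * flat a A B c s.
Proof.
move=> s0; rewrite !flatE// -expRD; congr expR.
by rewrite /flat_phase; ring.
Qed.

(* With [L = - ln s >= 0] and [y = exp (a L) >= a L], the phase
   [c L + A y - B y^2] is bounded above by completing two squares. *)
Lemma flat_bounded a A B c : 0 < a -> 0 < B ->
  exists2 M, 0 < M & forall s, s <= 1 -> flat a A B c s <= M.
Proof.
move=> a0 B0; exists (expR (A ^+ 2 / (2 * B) + c ^+ 2 / (2 * B * a ^+ 2))).
  exact: expR_gt0.
move=> s s1; case: (ltP 0 s) => s0; last by rewrite flat_le0// expR_ge0.
rewrite flatE// ler_expR /flat_phase.
have L0 : 0 <= - ln s by rewrite oppr_ge0 ln_le0.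
set L := - ln s in L0 *.
have -> : - (2 * a) * ln s = a * L + a * L by rewrite /L; ring.
have -> : - a * ln s = a * L by rewrite /L; ring.
have -> : - c * ln s = c * L by rewrite /L; ring.
rewrite expRD.
have : a * L <= expR (a * L) by apply: le_trans (expR_ge1Dx _); rewrite lerDr.
set y := expR (a * L) => ay.
have aL0 : 0 <= a * L by rewrite mulr_ge0// ltW.
have yy : (a * L) ^+ 2 <= y * y by rewrite expr2 ler_pM.
have -> : A ^+ 2 / (2 * B) + c ^+ 2 / (2 * B * a ^+ 2) =
   c * L + A * y - B * (y * y) + (B / 2) * (y * y - (a * L) ^+ 2)
   + (B / 2) * (y - A / B) ^+ 2 + (B / 2) * (a * L - c / (B * a)) ^+ 2.
  by field; rewrite !gt_eqF.
set Q := c * L + _ - _; rewrite -2![in leRHS]addrA lerDl.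
rewrite !addr_ge0//; do ?[by rewrite mulr_ge0// ?sqr_ge0// ltW// divr_gt0].
by rewrite mulr_ge0// ?subr_ge0// ltW// divr_gt0.
Qed.

Lemma flat_is_derive_pos a A B c s : 0 < s ->
  is_derive s 1 (flat a A B c)
    (- c * flat a A B (c + 1) s - a * A * flat a A B (c + a + 1) s
     + 2 * a * B * flat a A B (c + 2 * a + 1) s).
Proof.
move=> s0.
have lns := is_derive1_ln s0.
have E : \forall y \near s, expR (flat_phase a A B c y) = flat a A B c y.
  near=> y; rewrite flatE//; near: y.
  exact: lt_nbhsr.
apply: (near_eq_is_derive E).
have dexp k : is_derive s 1 (fun t => expR (k * ln t)) (expR (k * ln s) * (k * s^-1)).
  by apply: is_derive_eq.
have dph : is_derive s 1 (flat_phase a A B c)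
   (- c * s^-1 + A * (expR (- a * ln s) * (- a * s^-1))
     - B * (expR (- (2 * a) * ln s) * (- (2 * a) * s^-1))).
  apply: is_deriveB; apply: is_deriveZ.
apply: (is_derive_eq (is_derive_comp_dir (is_derive_expR _) dph)).
rewrite -(flatE _ _ _ _ s0) !flatD//.
have -> : s^-1 = expR (- 1 * ln s) by rewrite mulN1r expRN lnK.
by ring.
Unshelve. all: by end_near. Qed.

(** Only [s = 0] is delicate: for an increment [h > 0] the difference quotient is [h] times
    [flat a A B (c + 2) h], and [flat_bounded] controls the second factor. *)
Lemma flat_is_derive a A B c s : 0 < a -> 0 < B ->
  is_derive s 1 (flat a A B c)
    (- c * flat a A B (c + 1) s - a * A * flat a A B (c + a + 1) s
     + 2 * a * B * flat a A B (c + 2 * a + 1) s).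
Proof.
move=> a0 B0; have [s0|s0|->] := ltrgt0P s; first exact: flat_is_derive_pos.
  rewrite !flat_le0 ?ltW// !mulr0 subr0 addr0.
  apply: (@near_eq_is_derive _ _ _ (cst 0)).
  by near=> y; rewrite flat_le0// ltW//; near: y; exact: lt_nbhsl.
rewrite !flat_le0 ?lexx// !mulr0 subr0 addr0.
have [M M0 hM] := flat_bounded A (c + 2) a0 B0.
have lim0 : (fun h : R => h^-1 *: (flat a A B c (h *: 1 + 0) - flat a A B c 0))
    @ 0^' --> (0 : R).
  have g0 : (fun h : R => M * `|h|) @ 0^' --> (0 : R).
    rewrite -[X in _ --> X](mulr0 M) -[X in _ * X](normr0 R).
    apply: cvgMr; apply: cvg_norm; exact: cvg_within.
  apply/cvgr0Pnorm_lt => e e0; near=> h.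
  have hn0 : h != 0 by near: h; exact: nbhs_dnbhs_neq.
  apply: (@le_lt_trans _ _ (M * `|h|)); last first.
    near: h; move/cvgr0Pnorm_lt : g0 => /(_ _ e0).
    by apply: filterS => t; rewrite normrM normr_id (gtr0_norm M0).
  rewrite [flat a A B c 0]flat_le0// subr0 addr0 [h *: 1]mulr1.
  case: (ltP 0 h) => h0; last by rewrite flat_le0// scaler0 normr0 mulr_ge0// ltW.
  have -> : flat a A B c h = h ^+ 2 * flat a A B (c + 2) h.
    have -> : h ^+ 2 = expR (2 * ln h) by rewrite expRM_natl lnK.
    rewrite flatD// mulrA -expRD.
    by rewrite (_ : _ + _ = 0) ?expR0 ?mul1r//; ring.
  rewrite [_ *: _]mulrA expr2 mulrA mulVf// mul1r normrM mulrC ler_wpM2r//.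
  rewrite ger0_norm ?flat_ge0//; apply: hM.
  by rewrite ltW//; near: h; apply: cvg_within; exact: lt_nbhsl.
by apply: DeriveDef; [apply/cvg_ex; exists (0 : R)|exact/cvg_lim].
Unshelve. all: by end_near. Qed.

Lemma flat_continuous a A B c : 0 < a -> 0 < B -> continuous (flat a A B c).
Proof.
move=> a0 B0 s; apply/differentiable_continuous/derivable1_diffP.
by have [] := flat_is_derive A c s a0 B0.
Qed.

Lemma flat_Ck a A B c k : 0 < a -> 0 < B -> Ck dir1 k (flat a A B c).
Proof.
move=> a0 B0; elim: k c => [|k IH] c; split=> //; try exact: flat_continuous.
case; eexists; first by move=> x; exact: flat_is_derive.
by apply: CkD; [apply: CkD|]; [| rewrite (_ : (fun _ => _) = fun s => (- (a * A)) * flat a A B (c + a + 1) s)|]; first [exact: CkZ | by apply/funext => s; rewrite mulNr].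
Qed.

End flat_functions.

(** * Compactly supported product kernels *)

Section product_kernels.
Context {R : realType}.

Lemma is_derive_const_dir {V : normedModType R} (f : V -> R) (x v : V) :
  (forall h : R, f (h *: v + x) = f x) -> is_derive x v f 0.
Proof.
move=> fc.
have lim0 : (fun h : R => h^-1 *: (f (h *: v + x) - f x)) @ 0^' --> (0 : R).
  by apply: cvg_near_cst; apply: nearW => h; rewrite fc subrr scaler0.
by apply: DeriveDef; [apply/cvg_ex; exists (0 : R)|exact/cvg_lim].
Qed.

Definition bumps (e : R) : set (R -> R) :=
  [set r | (forall k, Ck dir1 k r) /\ (forall t, e < `|t| -> r t = 0)].

Lemma bumps_is_derive e r : bumps e r -> forall t : R, is_derive t 1 r (r^`()%classic t).
Proof.
by case=> /(_ 1)[_ /(_ tt)[r' rr' _]] _ t; rewrite derive1E; apply: derivableP; case: (rr' t).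
Qed.

Lemma bumps_derive e r : bumps e r -> bumps e r^`()%classic.
Proof.
move=> [Cr r0]; split=> [k|t et].
  have [_ /(_ tt)[r' rr' +]] := Cr k.+1.
  rewrite (_ : r' = r^`()%classic)//; apply/funext => t; rewrite derive1E.
  by have [_ ->] := rr' t.
rewrite derive1E (@near_eq_derive _ _ _ _ (cst 0)) ?derive_cst//.
near=> s; apply: r0; near: s.
have /cvgr_gt : (fun s : R => `|s|) @ t --> `|t| by apply: cvg_norm; exact: cvg_id.
by apply.
Unshelve. all: by end_near. Qed.

Lemma bumps_bounded e r : bumps e r -> exists2 M, 0 <= M & forall t, `|r t| <= M.
Proof.
move=> [Cr r0].
have [e0|e0] := ltP e 0.
  by exists 0 => // t; rewrite r0 ?normr0// (lt_le_trans e0).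
have cr : {within `[- e, e], continuous (fun t => `|r t|)}.
  apply: continuous_subspaceT => t; apply: cvg_norm.
  exact: (Ck_continuous (Cr 0%N)).
have [|c _ hc] := EVT_max _ cr; first by rewrite ge0_cp.
exists `|r c| => // t; have [te|et] := leP `|t| e; last by rewrite r0// normr0.
by apply: hc; rewrite in_itv/= -ler_norml.
Qed.

Context {n : nat}.
Implicit Types (r : 'I_n -> R -> R) (x y : 'rV[R]_n).

Definition pker r x y : R := \prod_(i < n) r i (x 0 i - y 0 i).

(** The product kernels depend on [x - y] and are stable under differentiation: this modification of
    the factors gives the [x_j]-derivative, and minus the [y_j]-derivative. The opposite signs are
    what lets a derivative pass from one variable to the other. *)
Definition upd r (j : 'I_n) : 'I_n -> R -> R :=
  fun i => if i == j then (r i)^`()%classic else r i.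

(** Symmetry of the second derivatives of the kernel, the source of the cancellation in
    [weak_null_lagrangian]. *)
Lemma updC r i j : upd (upd r i) j = upd (upd r j) i.
Proof.
apply/funext => l; rewrite /upd; have [->|//] := eqVneq l j.
by case: eqP.
Qed.

Lemma bumps_upd e r j : (forall i, bumps e (r i)) -> forall i, bumps e (upd r j i).
Proof. by move=> h i; rewrite /upd; case: eqP => // _; exact: bumps_derive. Qed.

Lemma pker_bounded e r : (forall i, bumps e (r i)) ->
  exists2 M, 0 <= M & forall x y, `|pker r x y| <= M.
Proof.
move=> h.
have /choice[M hM] i : exists M, 0 <= M /\ forall t, `|r i t| <= M.
  by have [M M0 hM] := bumps_bounded (h i); exists M.
exists (\prod_i M i); first by apply: prodr_ge0 => i _; case: (hM i).
move=> x y; rewrite normr_prod; apply: ler_prod => i _.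
by rewrite normr_ge0/=; case: (hM i).
Qed.

Lemma pker_support e r x y : (forall i, bumps e (r i)) -> pker r x y != 0 ->
  forall i, `|x 0 i - y 0 i| <= e.
Proof.
move=> h /eqP + i; apply: contra_notT; rewrite -ltNge => ei.
by rewrite /pker (bigD1 i)//= (h i).2// mul0r.
Qed.

Lemma pker_Ckl e r y k : (forall i, bumps e (r i)) -> Ck dirn k (pker r ^~ y).
Proof.
move=> h; rewrite /pker.
rewrite (_ : (fun _ => _) = fun x => \prod_(i <- index_enum 'I_n)
   (r i \o (fun x : 'rV[R]_n => x 0 i + cst (- y 0 i) x)) x)//.
apply: Ck_prod => i; apply: Ck_comp; first by case: (h i).
by apply: CkD; [exact: Ck_coord|exact: Ck_cst].
Qed.

Lemma pker_Ckr e r x k : (forall i, bumps e (r i)) -> Ck dirn k (pker r x).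
Proof.
move=> h; rewrite /pker.
rewrite (_ : (fun _ => _) = fun y => \prod_(i <- index_enum 'I_n)
   (r i \o (fun y : 'rV[R]_n => cst (x 0 i) y + (- 1) * y 0 i)) y); last first.
  by apply/funext => y; apply: eq_bigr => i _; rewrite /= mulN1r.
apply: Ck_prod => i; apply: Ck_comp; first by case: (h i).
by apply: CkD; [exact: Ck_cst|apply: CkZ; exact: Ck_coord].
Qed.

Lemma pker_is_derivel e r x y j : (forall i, bumps e (r i)) ->
  is_derive x ('e_j : 'rV[R]_n) (pker r ^~ y) (pker (upd r j) x y).
Proof.
move=> h; rewrite /pker.
rewrite (_ : (fun _ => _) = fun x => (r j \o (fun x : 'rV[R]_n => x 0 j - y 0 j)) x *
   \prod_(i < n | i != j) r i (x 0 i - y 0 i)); last first.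
  by apply/funext => z; rewrite (bigD1 j).
have d1 : is_derive x ('e_j : 'rV[R]_n) (fun x : 'rV[R]_n => x 0 j - y 0 j) 1.
  apply: (is_derive_eq (is_deriveB (coord_is_derive j j x) (is_derive_cst (y 0 j) x _))).
  by rewrite eqxx subr0.
have d2 := is_derive_comp_dir (bumps_is_derive (h j) _) d1.
have d3 : is_derive x ('e_j : 'rV[R]_n)
    (fun x : 'rV[R]_n => \prod_(i < n | i != j) r i (x 0 i - y 0 i)) 0.
  apply: is_derive_const_dir => t; apply: eq_bigr => i ij.
  by rewrite !mxE (negbTE ij) andbF mulr0 add0r.
apply: (is_derive_eq (is_deriveM d2 d3)).
rewrite scaler0 add0r mulr1 [RHS](bigD1 j)//= {1}/upd eqxx mulrC; congr (_ * _).
by apply: eq_bigr => i ij; rewrite /upd (negbTE ij).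
Qed.

Lemma pker_is_deriver e r x y j : (forall i, bumps e (r i)) ->
  is_derive y ('e_j : 'rV[R]_n) (pker r x) (- pker (upd r j) x y).
Proof.
move=> h; rewrite /pker.
rewrite (_ : (fun _ => _) = fun y => (r j \o (fun y : 'rV[R]_n => x 0 j - y 0 j)) y *
   \prod_(i < n | i != j) r i (x 0 i - y 0 i)); last first.
  by apply/funext => z; rewrite (bigD1 j).
have d1 : is_derive y ('e_j : 'rV[R]_n) (fun y : 'rV[R]_n => x 0 j - y 0 j) (-1).
  apply: (is_derive_eq (is_deriveB (is_derive_cst (x 0 j) y _) (coord_is_derive j j y))).
  by rewrite eqxx sub0r.
have d2 := is_derive_comp_dir (bumps_is_derive (h j) _) d1.
have d3 : is_derive y ('e_j : 'rV[R]_n)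
    (fun y : 'rV[R]_n => \prod_(i < n | i != j) r i (x 0 i - y 0 i)) 0.
  apply: is_derive_const_dir => t; apply: eq_bigr => i ij.
  by rewrite !mxE (negbTE ij) andbF mulr0 add0r.
apply: (is_derive_eq (is_deriveM d2 d3)).
rewrite scaler0 add0r mulrN1 scalerN; congr (- _).
rewrite [RHS](bigD1 j)//= {1}/upd eqxx mulrC; congr (_ * _).
by apply: eq_bigr => i ij; rewrite /upd (negbTE ij).
Qed.

End product_kernels.

(** * Squared norm, balls and test functions *)

Section test_functions.
Context {R : realType} {n : nat}.
Implicit Types (x : 'rV[R]_n) (r rho : R).

(** Radial weights are written as functions of the squared norm because it is a polynomial, hence
    smooth at the origin. *)
Definition sqn x : R := \sum_(i < n) x 0 i ^+ 2.

Lemma sqn_ge0 x : 0 <= sqn x.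
Proof. by apply: sumr_ge0 => i _; exact: sqr_ge0. Qed.

Lemma enorm_sqn x : enorm x ^+ 2 = sqn x.
Proof. by rewrite sqr_sqrtr// sqn_ge0. Qed.

Lemma coord_le_sqn x i : x 0 i ^+ 2 <= sqn x.
Proof.
rewrite /sqn (bigD1 i)//= lerDl; apply: sumr_ge0 => j _; exact: sqr_ge0.
Qed.

Lemma sqn_Ck k : Ck dirn k sqn.
Proof. by apply: Ck_sum => i; apply: CkM; exact: Ck_coord. Qed.

Lemma sqn_is_derive x j : is_derive x ('e_j : 'rV[R]_n) sqn (2 * x 0 j).
Proof.
rewrite /sqn (_ : (fun _ => _) = \sum_(i < n) (fun x : 'rV[R]_n => x 0 i ^+ 2)).
  apply: (is_derive_eq (is_derive_sum (fun i => is_deriveX 2 (coord_is_derive i j x)))).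
  rewrite (bigD1 j)//= eqxx big1 ?addr0.
    by rewrite expr1 [_ *: _]mulr1 mulr_natl.
  by move=> i /negbTE ->; rewrite scaler0.
by apply/funext => z; rewrite fct_sumE.
Qed.

Definition cball r : set 'rV[R]_n := [set x | sqn x <= r ^+ 2].

Lemma compact_cball r : 0 <= r -> compact (cball r).
Proof.
move=> r0; apply: bounded_closed_compact.
  exists r; split; first exact: num_real.
  move=> M rM x xr; have M0 : 0 <= M by rewrite (le_trans r0)// ltW.
  rewrite /Num.norm/= mx_normE; apply: (le_trans _ (ltW rM)).
  rewrite /=.
  apply: (big_ind (fun z : {nonneg R} => z%:num <= r)) => //.
    by move=> a b ar br; rewrite /Order.max; case: ifP.
  move=> i _ /=; rewrite -(@ler_pXn2r _ 2)// ?nnegrE// real_normK ?num_real// ord1.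
  exact: le_trans (coord_le_sqn _ _) xr.
rewrite (_ : cball r = sqn @^-1` [set t | t <= r ^+ 2])//.
apply: closed_comp; last exact: closed_le.
by move=> x _; exact: (Ck_continuous (sqn_Ck 0)).
Qed.

Lemma cball_eball r rho : 0 <= r -> r < rho -> cball r `<=` eball rho.
Proof.
move=> r0 rrho x; rewrite /cball /eball /= => xr.
apply: (@le_lt_trans _ _ r) => //.
by rewrite -(@ler_pXn2r _ 2)// ?nnegrE ?sqrtr_ge0// enorm_sqn.
Qed.

Lemma closed_cball r : 0 <= r -> closed (cball r).
Proof. by move=> r0; apply: compact_closed => //; exact: compact_cball. Qed.

Lemma test_function_cball rho r (phi : 'rV[R]_n -> R) : 0 <= r -> r < rho ->
  (forall k, Ck dirn k phi) -> (forall x, ~ cball r x -> phi x = 0) ->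
  test_function (eball rho) phi.
Proof.
move=> r0 rrho Cphi phi0.
have sub : closure [set x | phi x != 0] `<=` cball r.
  rewrite [X in _ `<=` X](closure_id _).1; last exact: closed_cball.
  apply: closure_subset => x /=; apply: contraPP => /phi0 ->.
  by rewrite eqxx.
split.
- exact: smooth_Ck.
- apply: (subclosed_compact _ (compact_cball r0)) => //; exact: closed_closure.
- exact: (subset_trans sub (cball_eball r0 rrho)).
Qed.

End test_functions.

(** * Integrable real functions *)

Section real_integrable.
Context {d : measure_display} {T : measurableType d} {R : realType}.
Variable mu : {measure set T -> \bar R}.
Implicit Types F G : T -> R.

Lemma measurable_EFinT F : measurable_fun setT F ->
  measurable_fun setT (fun x => (F x)%:E).
Proof. by move=> mF; exact/measurable_EFinP. Qed.

Lemma measurable_normEFinT F : measurable_fun setT F ->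
  measurable_fun setT (fun x => `|F x|%:E).
Proof. by move=> mF; apply/measurable_EFinP; exact: measurableT_comp. Qed.

Definition intg F := mu.-integrable setT (EFin \o F).

Lemma intg_measurable F : intg F -> measurable_fun setT F.
Proof. by move=> /measurable_int/measurable_EFinP. Qed.

Lemma intg_bound F G (M : R) : measurable_fun setT F ->
  (forall x, `|F x| <= M * `|G x|) -> intg G -> intg F.
Proof.
move=> mF FG iG.
apply: (@le_integrable _ _ _ mu _ measurableT _ (EFin \o (fun x => M * G x))).
- exact/measurable_EFinP.
- move=> x _ /=; rewrite lee_fin; apply: le_trans (FG x) _.
  by rewrite normrM ler_wpM2r// ler_norm.
- rewrite (_ : _ \o _ = fun x => (M%:E * (EFin \o G) x)%E); last first.
    by apply/funext => x /=; rewrite EFinM.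
  exact: integrableZl.
Qed.

Lemma intgD F G : intg F -> intg G -> intg (fun x => F x + G x).
Proof.
move=> iF iG; rewrite /intg (_ : _ \o _ = (EFin \o F) \+ (EFin \o G))%E//.
exact: integrableD.
Qed.

Lemma intgZ c F : intg F -> intg (fun x => c * F x).
Proof.
move=> iF; rewrite /intg (_ : _ \o _ = fun x => (c%:E * (EFin \o F) x)%E)//.
exact: integrableZl.
Qed.

End real_integrable.

(** * Doubling of variables *)

(* Products of two Sobolev functions are handled through the forms
   [iint F(x) H(y) q(x, y)], where [q] is a mollifier of [x - y]: in such a form
   each weak derivative is tested in its own variable and passes onto [q]. *)
Section bilinear_kernel_form.
Context {d : measure_display} {T : measurableType d} {R : realType}.
Variable mu : {sigma_finite_measure set T -> \bar R}.
Implicit Types (F G H : T -> R) (q : T -> T -> R).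
Local Notation intg := (intg mu).

Definition kform F H q : R :=
  \int[(mu \x mu)%E]_z (F z.1 * H z.2 * q z.1 z.2).

Definition bounded_kernel q :=
  measurable_fun setT (fun z : T * T => q z.1 z.2) /\
  exists2 M, 0 <= M & forall x y, `|q x y| <= M.

Lemma measurable_kernel1 q x : bounded_kernel q -> measurable_fun setT (q x).
Proof.
case=> mq _; rewrite (_ : q x = (fun z : T * T => q z.1 z.2) \o (pair x))//.
exact: measurableT_comp.
Qed.

Lemma measurable_kernel2 q y : bounded_kernel q -> measurable_fun setT (q ^~ y).
Proof.
case=> mq _; rewrite (_ : q ^~ y = (fun z : T * T => q z.1 z.2) \o (fun x => (x, y)))//.
exact: measurableT_comp.
Qed.

Lemma intg_kernel1 H q x : bounded_kernel q -> intg H ->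
  intg (fun y => H y * q x y).
Proof.
move=> bq iH; have [mq [M M0 qM]] := bq.
apply: (intg_bound (G := H) (M := M)) => //.
  by apply: measurable_funM; [exact: (intg_measurable iH)|exact: measurable_kernel1].
by move=> y; rewrite normrM mulrC ler_wpM2r.
Qed.

Lemma intg_kernel2 F q y : bounded_kernel q -> intg F ->
  intg (fun x => F x * q x y).
Proof.
move=> bq iF; have [mq [M M0 qM]] := bq.
apply: (intg_bound (G := F) (M := M)) => //.
  by apply: measurable_funM; [exact: (intg_measurable iF)|exact: measurable_kernel2].
by move=> x; rewrite normrM mulrC ler_wpM2r.
Qed.

Lemma measurable_fst_real F : measurable_fun setT F ->
  measurable_fun setT (fun z : T * T => F z.1).
Proof. by move=> mF; apply: (measurableT_comp mF). Qed.

Lemma measurable_snd_real F : measurable_fun setT F ->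
  measurable_fun setT (fun z : T * T => F z.2).
Proof. by move=> mF; apply: (measurableT_comp mF). Qed.

(** The integrand is dominated by [M |F(x)| |H(y)|], whose iterated integral is a product of two
    finite integrals. *)
Lemma integrable_kform F H q : intg F -> intg H -> bounded_kernel q ->
  (mu \x mu)%E.-integrable setT (EFin \o (fun z => F z.1 * H z.2 * q z.1 z.2)).
Proof.
move=> iF iH bq; have [mq [M M0 qM]] := bq.
have mF := intg_measurable iF; have mH := intg_measurable iH.
have mf : measurable_fun setT (fun z : T * T => F z.1 * H z.2 * q z.1 z.2).
  apply: measurable_funM => //; apply: measurable_funM.
    exact: measurable_fst_real.
  exact: measurable_snd_real.
apply/integrable12ltyP; first exact/measurable_EFinP.
apply: (@le_lt_trans _ _ (\int[mu]_x (`|F x|%:E * (M%:E * \int[mu]_y `|H y|%:E)))%E).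
  apply: ge0_le_integral => //.
  - by move=> x _; apply: integral_ge0 => y _; exact: abse_ge0.
  - apply: (@measurable_fun_fubini_tonelli_F _ _ _ _ _ mu
        (fun z => `|(F z.1 * H z.2 * q z.1 z.2)%:E|%E)).
      by apply: measurableT_comp => //; exact/measurable_EFinP.
    by move=> z; exact: abse_ge0.
  - apply: emeasurable_funM => //.
    by exact: measurable_normEFinT.
  - move=> x _; rewrite -ge0_integralZl//=; last first.
    + by exact: measurable_normEFinT.
    rewrite -ge0_integralZl//=; last 2 first.
    + apply: measurable_funeM; exact: measurable_normEFinT.
    + by move=> y _; rewrite mule_ge0.
    apply: ge0_le_integral => //=.
    + apply: measurable_normEFinT.
      apply: measurable_funM; last exact: measurable_kernel1.
      exact: measurable_funM.
    + by do 2!apply: measurable_funeM; exact: measurable_normEFinT.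
    + move=> y _; rewrite -!EFinM lee_fin !normrM -mulrA ler_wpM2l// mulrC.
      by rewrite ler_wpM2r.
have hF : (\int[mu]_y `|F y|%:E < +oo)%E by case/integrableP: iF.
have hH : (\int[mu]_y `|H y|%:E < +oo)%E by case/integrableP: iH.
rewrite ge0_integralZr//=; last 2 first.
- by exact: measurable_normEFinT.
- by rewrite mule_ge0// integral_ge0.
rewrite lte_mul_pinfty// ?integral_ge0//.
  by rewrite ge0_fin_numE// integral_ge0.
by rewrite lte_mul_pinfty.
Qed.

Lemma kform_left F H q : intg F -> intg H -> bounded_kernel q ->
  kform F H q = \int[mu]_x (F x * \int[mu]_y (H y * q x y)).
Proof.
move=> iF iH bq; rewrite /kform /Rintegral.
rewrite -(integral12_prod_meas1 (integrable_kform iF iH bq)); congr fine.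
apply: eq_integral => x _; rewrite /fubini_F/=.
have := intg_kernel1 x bq iH => iHq.
rewrite -/(Rintegral mu setT _) EFinM fineK; last exact: integrable_fin_num.
rewrite -integralZl//; apply: eq_integral => y _.
by rewrite -EFinM mulrA.
Qed.

Lemma kform_right F H q : intg F -> intg H -> bounded_kernel q ->
  kform F H q = \int[mu]_y (H y * \int[mu]_x (F x * q x y)).
Proof.
move=> iF iH bq; rewrite /kform /Rintegral.
rewrite -(integral21_prod_meas1 (integrable_kform iF iH bq)); congr fine.
apply: eq_integral => y _; rewrite /fubini_G/=.
have := intg_kernel2 y bq iF => iFq.
rewrite EFinM fineK; last exact: integrable_fin_num.
rewrite -integralZl//; apply: eq_integral => x _.
by rewrite -EFinM mulrA (mulrC (H y)).
Qed.

Lemma intg_marginal F H q : intg F -> intg H -> bounded_kernel q ->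
  intg (fun y => H y * \int[mu]_x (F x * q x y)).
Proof.
move=> iF iH bq; have [_ [M M0 qM]] := bq.
have E y : fubini_G mu (EFin \o (fun z => F z.1 * H z.2 * q z.1 z.2)) y =
    (H y * \int[mu]_x (F x * q x y))%:E.
  have iFq := intg_kernel2 y bq iF.
  rewrite /fubini_G /= EFinM fineK; last exact: integrable_fin_num.
  rewrite -integralZl//; apply: eq_integral => x _.
  by rewrite -EFinM mulrA (mulrC (H y)).
apply: (@intg_bound _ _ _ mu _ H (M * \int[mu]_x `|F x|)) => //.
  apply/measurable_EFinP; have := measurable_fubini_G (integrable_kform iF iH bq).
  by apply: eq_measurable_fun => y _; exact: E.
have iF' : intg (fun x => `|F x|).
  exact: (integrable_abse iF).
move=> y; rewrite normrM mulrC ler_wpM2r//.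
apply: le_trans (le_normr_Rintegral measurableT (intg_kernel2 y bq iF)) _.
rewrite -(RintegralZl _ measurableT iF'); apply: le_Rintegral => //.
- rewrite (_ : _ \o _ = abse \o (EFin \o (fun x => F x * q x y)))//.
  by apply: integrable_abse => //; exact: intg_kernel2.
- exact: (intgZ M iF').
- by move=> x _; rewrite normrM mulrC ler_wpM2r.
Qed.

Lemma kformDr F G H q : intg F -> intg G -> intg H -> bounded_kernel q ->
  kform F (fun x => G x + H x) q = kform F G q + kform F H q.
Proof.
move=> iF iG iH bq; rewrite /kform -RintegralD//; try exact: integrable_kform.
by apply: eq_Rintegral => z _; ring.
Qed.

(** Unit mass in each variable is the hypothesis of Schur's test; it gives bounds that do not depend
    on how concentrated the kernel is. *)
Definition stochastic_kernel q := [/\ bounded_kernel q, forall x y, 0 <= q x y,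
  forall x, (\int[mu]_y (q x y)%:E = 1)%E & forall y, (\int[mu]_x (q x y)%:E = 1)%E].

Lemma integrable_stoch1 G q : stochastic_kernel q -> intg G -> (forall x, 0 <= G x) ->
  (mu \x mu)%E.-integrable setT (EFin \o (fun z => G z.1 * q z.1 z.2)) /\
  \int[(mu \x mu)%E]_z (G z.1 * q z.1 z.2) = \int[mu]_x G x.
Proof.
move=> [bq q0 q1 _] iG G0; have [mq _] := bq.
have mG := intg_measurable iG.
have mf : measurable_fun setT (fun z : T * T => (G z.1 * q z.1 z.2)%:E).
  apply: (measurableT_comp (f := EFin)) => //; apply: measurable_funM => //.
  exact: measurable_fst_real.
have E : (\int[mu]_x \int[mu]_y (G x * q x y)%:E = \int[mu]_x (G x)%:E)%E.
  apply: eq_integral => x _; under eq_integral do rewrite EFinM.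
  rewrite ge0_integralZl//= ?q1 ?mule1//.
  - apply: measurable_EFinT; exact: measurable_kernel1.
  - by move=> y _; rewrite lee_fin.
  - by rewrite lee_fin.
split.
  apply/integrable12ltyP => //=.
  under eq_integral => x _.
    under eq_integral => y _ do rewrite ger0_norm ?mulr_ge0//.
    over.
  rewrite E; case/integrableP: iG => _; apply: le_lt_trans.
  apply: ge0_le_integral => //=.
  - by move=> x _; rewrite lee_fin.
  - exact: measurable_EFinT.
  - by exact: measurable_normEFinT.
  - by move=> x _; rewrite lee_fin ler_norm.
rewrite /Rintegral fubini_tonelli1//; last by move=> z; rewrite lee_fin mulr_ge0.
by rewrite /fubini_F E.
Qed.

Lemma integrable_stoch2 G q : stochastic_kernel q -> intg G -> (forall x, 0 <= G x) ->
  (mu \x mu)%E.-integrable setT (EFin \o (fun z => G z.2 * q z.1 z.2)) /\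
  \int[(mu \x mu)%E]_z (G z.2 * q z.1 z.2) = \int[mu]_x G x.
Proof.
move=> [bq q0 _ q1] iG G0; have [mq _] := bq.
have mG := intg_measurable iG.
have mf : measurable_fun setT (fun z : T * T => (G z.2 * q z.1 z.2)%:E).
  apply: (measurableT_comp (f := EFin)) => //; apply: measurable_funM => //.
  exact: measurable_snd_real.
have E : (\int[mu]_y \int[mu]_x (G y * q x y)%:E = \int[mu]_x (G x)%:E)%E.
  apply: eq_integral => y _; under eq_integral do rewrite EFinM.
  rewrite ge0_integralZl//= ?q1 ?mule1//.
  - apply: measurable_EFinT; exact: measurable_kernel2.
  - by move=> x _; rewrite lee_fin.
  - by rewrite lee_fin.
split.
  apply/integrable21ltyP => //=.
  under eq_integral => x _.
    under eq_integral => y _ do rewrite ger0_norm ?mulr_ge0//.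
    over.
  rewrite E; case/integrableP: iG => _; apply: le_lt_trans.
  apply: ge0_le_integral => //=.
  - by move=> x _; rewrite lee_fin.
  - exact: measurable_EFinT.
  - by exact: measurable_normEFinT.
  - by move=> x _; rewrite lee_fin ler_norm.
rewrite /Rintegral fubini_tonelli2//; last by move=> z; rewrite lee_fin mulr_ge0.
by rewrite /fubini_G E.
Qed.

(** Young's inequality [|f h| <= (l f^2 + h^2 / l) / 2] under the integral, followed by the unit
    marginals. The free parameter [l] allows a fixed [F] to be paired with a small [H]. *)
Lemma kform_schur F H q (l : R) : 0 < l -> stochastic_kernel q ->
  intg F -> intg H -> intg (fun x => F x ^+ 2) -> intg (fun x => H x ^+ 2) ->
  `|kform F H q| <= (l * \int[mu]_x F x ^+ 2 + l^-1 * \int[mu]_x H x ^+ 2) / 2.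
Proof.
move=> l0 sq iF iH iF2 iH2; have [bq q0 _ _] := sq.
have [i1 e1] := integrable_stoch1 sq iF2 (fun x => sqr_ge0 (F x)).
have [i2 e2] := integrable_stoch2 sq iH2 (fun x => sqr_ge0 (H x)).
have if12 := integrable_kform iF iH bq.
apply: (le_trans (le_normr_Rintegral measurableT if12)).
have i1' := intgZ (l / 2) i1; have i2' := intgZ (l^-1 / 2) i2.
rewrite -e1 -e2 mulrDl (mulrAC l) (mulrAC l^-1) -!RintegralZl// -RintegralD//.
apply: le_Rintegral => //.
- by rewrite (_ : _ \o _ = abse \o (EFin \o (fun z => F z.1 * H z.2 * q z.1 z.2)))//; exact: integrable_abse.
- exact: (intgD i1' i2').
- move=> z _; rewrite normrM (ger0_norm (q0 _ _)) normrM.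
  rewrite -[F z.1 ^+ 2]real_normK ?num_real// -[H z.2 ^+ 2]real_normK ?num_real//.
  set f := `|F z.1|; set h := `|H z.2|; rewrite [leRHS](_ : _ =
    f * h * q z.1 z.2 + l^-1 / 2 * (l * f - h) ^+ 2 * q z.1 z.2); last first.
    by field; rewrite gt_eqF.
  by rewrite lerDl mulr_ge0// mulr_ge0 ?sqr_ge0// mulr_ge0// invr_ge0 ltW.
Qed.

End bilinear_kernel_form.

(** * Lebesgue measure on [R^n] *)

Section lebesgue_measure_rV.
Context {R : realType}.
Local Notation leb := (@lebesgue_measure R).

Lemma continuous_measurable (f : R -> R) : continuous f -> measurable_fun setT f.
Proof. exact: continuous_measurable_fun. Qed.

Lemma ge0_integral_rV_cons n (f : 'rV[R]_n.+1 -> \bar R) :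
  measurable_fun setT f -> (forall x, 0 <= f x)%E ->
  (\int[lebesgue_rV n.+1]_x f x =
   \int[leb]_t \int[lebesgue_rV n]_x f (rV_cons (t, x)))%E.
Proof.
move=> mf f0.
have mcons := @measurable_rV_cons R n.
transitivity (\int[pushforward (leb \x lebesgue_rV n) (@rV_cons R n)]_x f x)%E.
  by apply: eq_measure_integral.
rewrite ge0_integral_pushforward// preimage_setT.
rewrite fubini_tonelli1//; last by move=> x; exact: f0.
exact: measurableT_comp.
Qed.

Lemma integral_rV_prod n (r : 'I_n -> R -> R) :
  (forall i, measurable_fun setT (r i)) -> (forall i t, 0 <= r i t) ->
  (forall i, \int[leb]_t (r i t)%:E = 1)%E ->
  (\int[lebesgue_rV n]_x (\prod_(i < n) r i (x 0 i))%:E = 1)%E.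
Proof.
elim: n r => [|n IH] r mr r0 r1.
  rewrite /= integral_dirac//=; last by under eq_fun do rewrite big_ord0; exact: measurable_cst.
  by rewrite diracT big_ord0 mule1.
have mf m (s : 'I_m -> R -> R) : (forall i, measurable_fun setT (s i)) ->
    measurable_fun setT (fun x : 'rV[R]_m => \prod_(i < m) s i (x 0 i)).
  move=> ms; apply: measurable_prod => i _.
  by apply: measurableT_comp => //; exact: measurable_rV_coord.
rewrite ge0_integral_rV_cons; last 2 first.
- by apply: measurable_EFinT; exact: mf.
- by move=> x; rewrite lee_fin prodr_ge0.
rewrite -[RHS](r1 ord0); apply: eq_integral => t _.
under eq_integral => x _.
  rewrite big_ord_recl rV_cons0 EFinM.
  under eq_bigr do rewrite rV_consS.
  over.
rewrite [LHS](_ : _ = (\int[lebesgue_rV n]_x ((r ord0 t)%:E *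
    (\prod_(i < n) r (lift ord0 i) (x 0 i))%:E))%E)//.
rewrite ge0_integralZl//=.
- by rewrite (IH (fun i => r (lift ord0 i))) ?mule1.
- by apply: measurable_EFinT; exact: (mf _ (fun i => r (lift ord0 i))).
- by move=> x _; rewrite lee_fin prodr_ge0.
- by rewrite lee_fin.
Qed.

Lemma integral_shift (k : R -> R) (a : R) : continuous k -> (forall t, 0 <= k t) ->
  (\int[leb]_t (k (t - a))%:E = \int[leb]_t (k t)%:E)%E.
Proof.
move=> ck k0.
have dF (x : R) : is_derive x 1 (fun t : R => t - a) 1.
  apply: (is_derive_eq (is_deriveB (is_derive_id x 1) (is_derive_cst a x 1))).
  by rewrite subr0.
have F' : (fun t : R => t - a)^`()%classic = cst 1.
  by apply/funext => x; rewrite derive1E; have [_ ->] := dF x.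
rewrite (@increasing_ge0_integration_by_substitutionT _ (fun t => t - a) k)//.
- by apply: eq_integral => t _; rewrite F' /= mulr1.
- by move=> x y xy; rewrite ltrD2r.
- by rewrite F'; exact: cst_continuous.
- by rewrite F'; exact: is_cvg_cst.
- by rewrite F'; exact: is_cvg_cst.
- exact: cvg_addrr_Ny.
- exact: cvg_addrr.
Qed.

Lemma measurable_sqn n : measurable_fun setT (@sqn R n).
Proof.
apply: measurable_sum => i; rewrite (_ : (fun _ => _) = (fun t : R => t ^+ 2) \o (fun x : 'rV[R]_n => x 0 i))//.
apply: measurableT_comp; last exact: measurable_rV_coord.
by apply: continuous_measurable; exact: exprn_continuous.
Qed.

Lemma measurable_cball n (r : R) : measurable (cball r : set 'rV[R]_n).
Proof.
rewrite (_ : cball r = setT `&` (@sqn R n) @^-1` [set` `]-oo, (r ^+ 2)]]).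
  exact: measurable_sqn.
by rewrite setTI; apply/seteqP; split=> x; rewrite /cball /= in_itv.
Qed.

Lemma cball_finite n (r : R) : 0 <= r -> (lebesgue_rV n (cball r) < +oo)%E.
Proof.
move=> r0; pose a : 'rV[R]_n := const_mx (- r); pose b : 'rV[R]_n := const_mx r.
apply: (@le_lt_trans _ _ (lebesgue_rV n [set x : 'rV[R]_n | forall i, a 0 i <= x 0 i <= b 0 i])).
  apply: le_measure; rewrite ?inE; [exact: measurable_cball|exact: measurable_rV_box|].
  move=> x xr i; rewrite !mxE -ler_norml -(@ler_pXn2r _ 2)// ?nnegrE//.
  rewrite real_normK ?num_real//; exact: le_trans (coord_le_sqn _ _) xr.
rewrite lebesgue_rV_box ?ltry// => i; rewrite !mxE; lra.
Qed.

Lemma lebesgue_rV_origin n : (0 < n)%N -> lebesgue_rV n [set (0 : 'rV[R]_n)] = 0%E.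
Proof.
case: n => // n _.
rewrite (_ : [set 0] = [set x : 'rV[R]_n.+1 | forall i, (0 : 'rV[R]_n.+1) 0 i <= x 0 i <= (0 : 'rV[R]_n.+1) 0 i]).
  by rewrite lebesgue_rV_box// big_ord_recl !mxE subr0 mul0r.
apply/seteqP; split=> [x /= -> i|x /= h]; first by rewrite lexx.
by apply/rowP => i; apply/eqP; rewrite eq_le andbC; exact: h.
Qed.

End lebesgue_measure_rV.

(** * Mollifiers *)

Section mollifier.
Context {R : realType}.
Local Notation leb := (@lebesgue_measure R).

(** This is [exp (- (e^2 - t^2)^-2)] for [|t| < e], so its smoothness comes from the flat
    functions. *)
Definition bump0 (e t : R) : R := flat 1 0 1 0 (e ^+ 2 - t ^+ 2).

Lemma bump0_bumps (e : R) : 0 < e -> bumps e (bump0 e).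
Proof.
move=> e0; split=> [k|t et].
  rewrite /bump0; apply: (@Ck_comp _ _ _ _ _ _ (fun t : R => e ^+ 2 - t ^+ 2)).
    exact: flat_Ck.
  have Cid : Ck dir1 k (fun t : R => t).
    by apply: (@Ck_affine _ _ _ _ _ _ (fun=> 1)) => // x; exact: cvg_id.
  rewrite (_ : (fun _ => _) = fun t : R => cst (e ^+ 2) t + (- 1) * (t * t)).
    by apply: CkD; [exact: Ck_cst|apply: CkZ; exact: CkM].
  by apply/funext => t; rewrite mulN1r expr2.
rewrite /bump0 flat_le0// subr_le0 -[t ^+ 2]real_normK ?num_real//.
by rewrite ler_pXn2r ?nnegrE// ltW.
Qed.

Lemma bump0_integral (e : R) : 0 < e ->
  exists2 Z : R, 0 < Z & (\int[leb]_t (bump0 e t)%:E = Z%:E)%E.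
Proof.
move=> e0; have be := bump0_bumps e0; have [M M0 hM] := bumps_bounded be.
have cb : continuous (bump0 e) by exact: (Ck_continuous (be.1 0%N)).
have mb := continuous_measurable cb.
have ib : intg leb (bump0 e).
  apply: (@intg_bound _ _ _ leb _ \1_(`[- e, e]%classic) M) => //.
    move=> t; have [te|et] := leP `|t| e.
      by rewrite indicE mem_set/= ?in_itv/= -?ler_norml// normr1 mulr1.
    by rewrite be.2// normr0 mulr_ge0.
  exact: integrable_indic_itv.
have fb : (\int[leb]_t (bump0 e t)%:E)%E \is a fin_num by exact: integrable_fin_num.
exists (fine (\int[leb]_t (bump0 e t)%:E)); last by rewrite fineK.
rewrite fine_gt0// -ge0_fin_numE ?fb ?andbT; last first.
  by apply: integral_ge0 => t _; rewrite lee_fin flat_ge0.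
(* The value of the bump at [|t| = e / 2], hence a lower bound on [[- e / 2, e / 2]]. *)
pose c := expR (- expR (- 2 * ln (3 / 4 * e ^+ 2))).
pose D : set R := `[- (e / 2), e / 2]%classic.
have mD : measurable D by exact: measurable_itv.
have h1 : (0 < \int[leb]_(t in D) (c%:E))%E.
  rewrite integral_cst//= /D lebesgue_measure_itv/= lte_fin ifT; last by lra.
  by rewrite -EFinD -EFinM lte_fin mulr_gt0 ?expR_gt0//; lra.
apply: (lt_le_trans h1).
have h2 : (\int[leb]_(t in D) (c%:E) <=
    \int[leb]_(t in D) ((bump0 e t)%:E))%E.
  apply: ge0_le_integral => //.
  - by move=> t _; rewrite lee_fin expR_ge0.
  - by apply: measurable_funTS; exact: measurable_EFinT.
  - move=> t; rewrite /D /= in_itv/= => tI; rewrite lee_fin /bump0.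
    have t2 : t ^+ 2 <= (e / 2) ^+ 2.
      rewrite -[t ^+ 2]real_normK ?num_real//.
      by rewrite ler_pXn2r ?nnegrE// ?ler_norml//; lra.
    have p0 : 0 < 3 / 4 * e ^+ 2 by rewrite mulr_gt0 ?exprn_gt0//; lra.
    have le : 3 / 4 * e ^+ 2 <= e ^+ 2 - t ^+ 2.
      move: t2; rewrite expr_div_n; lra.
    have s0 := lt_le_trans p0 le.
    rewrite flatE// ler_expR /flat_phase oppr0 !mul0r !add0r mulr1 mul1r.
    by rewrite lerN2 ler_expR !mulNr lerN2 ler_pM2l// ler_ln.
apply: (le_trans h2); apply: ge0_subset_integral => //.
- exact: measurable_EFinT.
- by move=> t _; rewrite lee_fin flat_ge0.
Qed.

Lemma bumps_scale e c (r : R -> R) : bumps e r -> bumps e (fun t => c * r t).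
Proof.
by move=> [Cr r0]; split=> [k|t et]; [exact: CkZ|rewrite r0// mulr0].
Qed.

(** Evenness turns [k (x - y)], as a function of [y], into a translate of [k]; thus both marginals
    of the product kernel have mass one. *)
Lemma bump_exists (e : R) : 0 < e -> exists k : R -> R,
  [/\ bumps e k, forall t, 0 <= k t, forall t, k (- t) = k t &
      (\int[leb]_t (k t)%:E = 1)%E].
Proof.
move=> e0; have [Z Z0 hZ] := bump0_integral e0.
have be := bump0_bumps e0.
exists (fun t => Z^-1 * bump0 e t); split.
- exact: bumps_scale.
- by move=> t; rewrite mulr_ge0 ?flat_ge0// invr_ge0 ltW.
- by move=> t; rewrite /bump0 sqrrN.
- under eq_integral do rewrite EFinM.
  rewrite ge0_integralZl//=.
  + by rewrite hZ -EFinM mulVf// gt_eqF.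
  + apply: measurable_EFinT; apply: continuous_measurable.
    exact: (Ck_continuous (be.1 0%N)).
  + by move=> t _; rewrite lee_fin flat_ge0.
  + by rewrite lee_fin invr_ge0 ltW.
Qed.

Context {n : nat}.

Lemma measurable_pker e (r : 'I_n -> R -> R) : (forall i, bumps e (r i)) ->
  measurable_fun setT (fun z : 'rV[R]_n * 'rV[R]_n => pker r z.1 z.2).
Proof.
move=> be; apply: measurable_prod => i _.
rewrite (_ : (fun _ => _) = r i \o (fun z : 'rV[R]_n * 'rV[R]_n => z.1 0 i - z.2 0 i))//.
apply: measurableT_comp.
  by apply: continuous_measurable; exact: (Ck_continuous ((be i).1 0%N)).
apply: measurable_funB.
  exact: (measurableT_comp (measurable_rV_coord i) measurable_fst).
exact: (measurableT_comp (measurable_rV_coord i) measurable_snd).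
Qed.

Lemma bounded_pker e (r : 'I_n -> R -> R) : (forall i, bumps e (r i)) ->
  bounded_kernel (pker r).
Proof. by move=> be; split; [exact: measurable_pker be|exact: pker_bounded be]. Qed.

Lemma mollifier_exists (e : R) : 0 < e -> exists r : 'I_n -> R -> R,
  (forall i, bumps e (r i)) /\ stochastic_kernel (lebesgue_rV n) (pker r).
Proof.
move=> e0; have [k [bk k0 kN k1]] := bump_exists e0.
have ck : continuous k by exact: (Ck_continuous (bk.1 0%N)).
exists (fun=> k); split=> //; split.
- exact: (@bounded_pker e).
- by move=> x y; apply: prodr_ge0 => i _.
- move=> x; rewrite /pker (@integral_rV_prod _ _ (fun i t => k (x 0 i - t)))// => i.
    apply: measurableT_comp; first exact: continuous_measurable.
    by apply: measurable_funB.
  under eq_integral do rewrite -kN opprB.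
  by rewrite (integral_shift (x 0 i)).
- move=> y; rewrite /pker (@integral_rV_prod _ _ (fun i t => k (t - y 0 i)))// => i.
    apply: measurableT_comp; first exact: continuous_measurable.
    by apply: measurable_funB.
  by rewrite (integral_shift (y 0 i)).
Qed.

End mollifier.

Import HBSimple HBNNSimple.

(** * Approximation in [L^2] by bounded uniformly continuous functions *)

Section square_integrable_approximation.
Context {R : realType} {n : nat}.
Local Notation T := 'rV[R]_n.
Local Notation mu := (lebesgue_rV n : {sigma_finite_measure set 'rV[R]_n -> \bar R}).
Variables (Q : set T) (mQ : measurable Q) (Q_fin : (mu Q < +oo)%E).
Implicit Types (F G H g : T -> R) (d e : R).

Definition sqnorm F : \bar R := (\int[mu]_(x in Q) (F x ^+ 2)%:E)%E.

Lemma measurable_sq F : measurable_fun setT F ->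
  measurable_fun Q (fun x => (F x ^+ 2)%:E).
Proof.
by move=> mF; apply: measurable_funTS; apply: measurable_EFinT; exact: measurable_funX.
Qed.

Lemma sqnormD F G : measurable_fun setT F -> measurable_fun setT G ->
  (sqnorm (fun x => F x + G x)%R <= 2%:E * sqnorm F + 2%:E * sqnorm G)%E.
Proof.
move=> mF mG; rewrite /sqnorm -!ge0_integralZl//; do ?[exact: measurable_sq];
  do ?[by move=> x _; rewrite lee_fin sqr_ge0].
rewrite -ge0_integralD//; last 4 first.
- by move=> x _; rewrite -EFinM lee_fin mulr_ge0// sqr_ge0.
- by apply: measurable_funeM; exact: measurable_sq.
- by move=> x _; rewrite -EFinM lee_fin mulr_ge0// sqr_ge0.
- by apply: measurable_funeM; exact: measurable_sq.
apply: ge0_le_integral => //.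
- by move=> x _; rewrite lee_fin sqr_ge0.
- by apply: measurable_sq; exact: measurable_funD.
- by apply: emeasurable_funD; apply: measurable_funeM; exact: measurable_sq.
move=> x _; rewrite -!EFinM -EFinD lee_fin -subr_ge0.
rewrite (_ : _ - _ = (F x - G x) ^+ 2) ?sqr_ge0//; ring.
Qed.

Lemma sqnormZ c F : measurable_fun setT F ->
  sqnorm (fun x => c * F x) = ((c ^+ 2)%:E * sqnorm F)%E.
Proof.
move=> mF; rewrite /sqnorm -ge0_integralZl//; last 3 first.
- exact: measurable_sq.
- by move=> x _; rewrite lee_fin sqr_ge0.
- by rewrite lee_fin sqr_ge0.
by apply: eq_integral => x _; rewrite exprMn EFinM.
Qed.

(** Closeness is measured coordinate by coordinate, the form in which the support of a product
    kernel is controlled. *)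
Definition regular g := [/\ measurable_fun setT g, exists M : R, forall x, `|g x| <= M &
  forall d : R, 0 < d -> exists2 e : R, 0 < e & forall x y : T,
    (forall i, `|x 0 i - y 0 i| <= e) -> `|g x - g y| <= d].

Lemma regular_cst (c : R) : regular (cst c).
Proof.
split=> [||d d0]; first exact: measurable_cst; first by exists (`|c|).
by exists 1 => // x y _; rewrite subrr normr0 ltW.
Qed.

Lemma regularD g h : regular g -> regular h -> regular (fun x => g x + h x).
Proof.
move=> [mg [M gM] cg] [mh [N hN] ch]; split; first exact: measurable_funD.
  by exists (M + N) => x; rewrite (le_trans (ler_normD _ _))// lerD.
move=> d d0; have d20 : 0 < d / 2 by rewrite divr_gt0.
have [e e0 he] := cg _ d20; have [e' e'0 he'] := ch _ d20.
exists (Num.min e e'); first by rewrite lt_min e0.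
move=> x y xy; rewrite opprD addrACA (splitr d) (le_trans (ler_normD _ _))// lerD//.
  by apply: he => i; have := xy i; rewrite le_min => /andP[].
by apply: he' => i; have := xy i; rewrite le_min => /andP[].
Qed.

Lemma regularM g h : regular g -> regular h -> regular (fun x => g x * h x).
Proof.
move=> [mg [M0 gM0] cg] [mh [N0 hN0] ch].
pose M := `|M0| + 1; pose N := `|N0| + 1.
have gM x : `|g x| <= M.
  by rewrite (le_trans (gM0 x))// (le_trans (ler_norm _))// lerDl.
have hN x : `|h x| <= N.
  by rewrite (le_trans (hN0 x))// (le_trans (ler_norm _))// lerDl.
have M_gt0 : 0 < M by rewrite ltr_wpDl.
have N_gt0 : 0 < N by rewrite ltr_wpDl.
split; first exact: measurable_funM.
  by exists (M * N) => x; rewrite normrM ler_pM.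
move=> d d0.
have dN : 0 < d / (2 * N) by rewrite divr_gt0// mulr_gt0.
have dM : 0 < d / (2 * M) by rewrite divr_gt0// mulr_gt0.
have [e e0 he] := cg (d / (2 * N)) dN.
have [e' e'0 he'] := ch (d / (2 * M)) dM.
exists (Num.min e e'); first by rewrite lt_min e0.
move=> x y xy.
have -> : g x * h x - g y * h y = (g x - g y) * h x + g y * (h x - h y) by ring.
have -> : d = d / (2 * N) * N + M * (d / (2 * M)).
  by field; rewrite !gt_eqF.
rewrite (le_trans (ler_normD _ _))// lerD// normrM ler_pM//.
  by apply: he => i; have := xy i; rewrite le_min => /andP[].
by apply: he' => i; have := xy i; rewrite le_min => /andP[].
Qed.

Lemma regular_prod (I : Type) (s : seq I) (g : I -> T -> R) :
  (forall i, regular (g i)) -> regular (fun x => \prod_(i <- s) g i x).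
Proof.
move=> h; elim: s => [|i s IH].
  rewrite (_ : (fun _ => _) = cst 1); first exact: regular_cst.
  by apply/funext => x; rewrite big_nil.
rewrite (_ : (fun _ => _) = fun x => g i x * \prod_(i <- s) g i x).
  exact: regularM.
by apply/funext => x; rewrite big_cons.
Qed.

Definition approximable F := measurable_fun setT F /\
  forall d : R, 0 < d -> exists2 g, regular g & (sqnorm (fun x => F x - g x)%R <= d%:E)%E.

Lemma approximable_closed F : measurable_fun setT F ->
  (forall d : R, 0 < d -> exists2 G, approximable G & (sqnorm (fun x => F x - G x)%R <= d%:E)%E) ->
  approximable F.
Proof.
move=> mF h; split=> // d d0.
(* A quarter, because [sqnormD] costs a factor two on each of the two terms. *)
have d40 : 0 < d / 4 by rewrite divr_gt0.
have [G [mG /(_ _ d40)[g rg Gg]] FG] := h _ d40.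
exists g => //; have [mg _ _] := rg.
rewrite (_ : (fun _ => _) = fun x => (F x - G x) + (G x - g x)); last first.
  by apply/funext => x; ring.
apply: le_trans (sqnormD _ _) _; [exact: measurable_funB|exact: measurable_funB|].
have -> : d%:E = (2%:E * (d / 4)%:E + 2%:E * (d / 4)%:E)%E.
  by rewrite -EFinM -EFinD; congr EFin; field.
by apply: leeD; apply: lee_wpmul2l => //; rewrite lee_fin.
Qed.

Lemma approximable_regular g : regular g -> approximable g.
Proof.
move=> rg; have [mg _ _] := rg; split=> // d d0; exists g => //.
rewrite /sqnorm; under eq_integral do rewrite subrr expr0n.
by rewrite integral0 lee_fin ltW.
Qed.

Lemma approximableD F G : approximable F -> approximable G ->
  approximable (fun x => F x + G x).
Proof.
move=> [mF hF] [mG hG]; split; first exact: measurable_funD.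
move=> d d0; have d40 : 0 < d / 4 by rewrite divr_gt0.
have [f rf Ff] := hF _ d40; have [g rg Gg] := hG _ d40.
have [mf _ _] := rf; have [mg _ _] := rg.
exists (fun x => f x + g x); first exact: regularD.
rewrite (_ : (fun _ => _) = fun x => (F x - f x) + (G x - g x)); last first.
  by apply/funext => x; ring.
apply: le_trans (sqnormD _ _) _; [exact: measurable_funB|exact: measurable_funB|].
have -> : d%:E = (2%:E * (d / 4)%:E + 2%:E * (d / 4)%:E)%E.
  by rewrite -EFinM -EFinD; congr EFin; field.
by apply: leeD; apply: lee_wpmul2l => //; rewrite lee_fin.
Qed.

Lemma approximableZ c F : approximable F -> approximable (fun x => c * F x).
Proof.
move=> [mF hF]; split; first exact: measurable_funM.
move=> d d0; have c0 : 0 < c ^+ 2 + 1 by rewrite ltr_wpDl// sqr_ge0.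
have [f rf Ff] := hF _ (divr_gt0 d0 c0).
have [mf _ _] := rf.
exists (fun x => c * f x).
  by apply: (regularM (g := cst c)) => //; exact: regular_cst.
rewrite (_ : (fun _ => _) = fun x => c * (F x - f x)); last first.
  by apply/funext => x; ring.
rewrite sqnormZ; last exact: measurable_funB.
apply: (@le_trans _ _ ((c ^+ 2)%:E * (d / (c ^+ 2 + 1))%:E)%E).
  by rewrite lee_wpmul2l// lee_fin sqr_ge0.
rewrite -EFinM lee_fin mulrA ler_pdivrMr// mulrC ler_wpM2l ?ltW//.
by rewrite ltrDl.
Qed.

Lemma approximable_sum (I : Type) (s : seq I) (F : I -> T -> R) :
  (forall i, approximable (F i)) -> approximable (fun x => \sum_(i <- s) F i x).
Proof.
move=> h; elim: s => [|i s IH].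
  rewrite (_ : (fun _ => _) = cst 0); first by apply/approximable_regular/regular_cst.
  by apply/funext => x; rewrite big_nil.
rewrite (_ : (fun _ => _) = fun x => F i x + \sum_(i <- s) F i x).
  exact: approximableD.
by apply/funext => x; rewrite big_cons.
Qed.

(** By dominated convergence the squared differences have integrals tending to [0], so some [F_ k]
    is already close enough. *)
Lemma approximable_lim (F_ : nat -> T -> R) F G : measurable_fun setT F ->
  (forall k, approximable (F_ k)) ->
  (forall x, Q x -> F_ k x @[k --> \oo] --> F x) ->
  mu.-integrable Q (EFin \o G) ->
  (forall k x, Q x -> (F x - F_ k x) ^+ 2 <= G x) -> approximable F.
Proof.
move=> mF aF F_F iG FG; apply: approximable_closed => // d d0.
have : (\int[mu]_(x in Q) ((F x - F_ k x) ^+ 2)%:E)%E @[k --> \oo] -->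
    (\int[mu]_(x in Q) (cst 0%E x))%E.
  apply: (@dominated_cvg _ _ _ mu Q mQ (fun k x => ((F x - F_ k x) ^+ 2)%:E) (cst 0%E) (EFin \o G)) => //.
  - by move=> k; apply: measurable_sq; apply: measurable_funB => //; exact: (aF k).1.
  - move=> x Qx; apply/fine_cvgP; split; first exact: nearW.
    rewrite /= (_ : _ \o _ = fun k => (F x - F_ k x) * (F x - F_ k x)); last first.
      by apply/funext => k; rewrite /= expr2.
    have h : F x - F_ k x @[k --> \oo] --> (0 : R).
      rewrite -(subrr (F x)); apply: cvgB; [exact: cvg_cst|exact: F_F].
    by rewrite -[X in _ --> X](mulr0 0); exact: cvgM.
  - by move=> k x Qx; rewrite gee0_abs ?lee_fin ?sqr_ge0//; exact: FG.
rewrite integral0 => /(_ _ (open_ereal_lt' (_ : 0 < d%:E)%E)).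
case; first by rewrite lte_fin.
by move=> k _ /(_ k (leqnn k)) /= /ltW ?; exists (F_ k).
Qed.

(** Lipschitz approximation of the indicator of the positive half-line; products of ramps
    approximate the indicator of a quadrant. *)
Definition ramp (k : nat) (t : R) : R := Num.min 1 (Num.max 0 (k%:R * t)).

Lemma ramp_ge0 k t : 0 <= ramp k t.
Proof. by rewrite /ramp le_min ler01/= le_max lexx. Qed.

Lemma ramp_le1 k t : ramp k t <= 1.
Proof. by rewrite /ramp ge_min lexx. Qed.

Lemma ramp_lip k s t : `|ramp k s - ramp k t| <= k%:R * `|s - t|.
Proof.
have k0 : 0 <= k%:R :> R by [].
have -> : k%:R * `|s - t| = `|k%:R * s - k%:R * t|.
  by rewrite -mulrBr normrM ger0_norm.
rewrite /ramp; move: (k%:R * s) (k%:R * t) => a b.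
pose clip (x : R) := Num.min 1 (Num.max 0 x).
rewrite -/(clip a) -/(clip b).
have h (x : R) : (0 <= x -> x <= 1 -> clip x = x) /\
   (x <= 0 -> clip x = 0) /\ (1 <= x -> clip x = 1).
  rewrite /clip; split; first by move=> x0 x1; rewrite max_r// min_r.
  split; first by move=> x0; rewrite max_l// min_r.
  by move=> x1; rewrite max_r ?min_l// (le_trans _ x1).
have [a1 [a2 a3]] := h a; have [b1 [b2 b3]] := h b.
have [a0|a0] := leP a 0; have [b0|b0] := leP b 0.
- by rewrite a2// b2// subrr normr0.
- rewrite a2//; have [b4|b4] := leP b 1.
    by rewrite (b1 (ltW b0) b4) !ler0_norm; lra.
  by rewrite (b3 (ltW b4)) !ler0_norm; lra.
- rewrite b2//; have [a4|a4] := leP a 1.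
    by rewrite (a1 (ltW a0) a4) !ger0_norm; lra.
  by rewrite (a3 (ltW a4)) !ger0_norm; lra.
- have [a4|a4] := leP a 1; have [b4|b4] := leP b 1.
  + by rewrite (a1 (ltW a0) a4) (b1 (ltW b0) b4).
  + by rewrite (a1 (ltW a0) a4) (b3 (ltW b4)) !ler0_norm; lra.
  + by rewrite (b1 (ltW b0) b4) (a3 (ltW a4)) !ger0_norm; lra.
  + by rewrite (a3 (ltW a4)) (b3 (ltW b4)) subrr normr0.
Qed.

Lemma ramp_cvg t : \forall k \near \oo, ramp k t = ((0 < t)%R)%:R.
Proof.
have [t0|t0] := ltP 0 t; last first.
  apply: nearW => k; rewrite /ramp max_l ?min_r//.
  by rewrite mulr_ge0_le0.
near=> k.
have kt : 1 <= k%:R * t.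
  rewrite -ler_pdivrMr// div1r; near: k; exact: nbhs_infty_ger.
by rewrite /ramp max_r ?min_l// (le_trans _ kt).
Unshelve. all: by end_near. Qed.

Lemma regular_ramp k (i : 'I_n) (a : R) : regular (fun x => ramp k (a - x 0 i)).
Proof.
have cr : continuous (ramp k).
  move=> t; apply/cvgrPdist_le => e e0; near=> s.
  apply: le_trans (ramp_lip _ _ _) _.
  have k1 : 0 < k%:R + 1 :> R by rewrite ltr_wpDl.
  apply: (@le_trans _ _ ((k%:R + 1) * `|t - s|)).
    by rewrite ler_wpM2r// lerDl.
  rewrite mulrC -ler_pdivlMr//; near: s.
  have := @cvg_id _ (nbhs t).
  by move/cvgrPdist_le; apply; rewrite divr_gt0.
split.
- rewrite (_ : (fun _ => _) = ramp k \o (fun x : T => a - x 0 i))//.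
  apply: measurableT_comp; first exact: continuous_measurable.
  by apply: measurable_funB => //; exact: measurable_rV_coord.
- by exists 1 => x; rewrite ger0_norm ?ramp_ge0// ramp_le1.
- move=> d d0; have k1 : 0 < k%:R + 1 :> R by rewrite ltr_wpDl.
  exists (d / (k%:R + 1)); first by rewrite divr_gt0.
  move=> x y /(_ i) xy; apply: le_trans (ramp_lip _ _ _) _.
  rewrite (_ : _ - _ = - (x 0 i - y 0 i)); last by ring.
  rewrite normrN; apply: (@le_trans _ _ (k%:R * (d / (k%:R + 1)))).
    by rewrite ler_wpM2l.
  by rewrite mulrA ler_pdivrMr// mulrC ler_wpM2l ?ltW// ltrDl.
Unshelve. all: by end_near. Qed.

Lemma integrable_cstQ (c : R) : mu.-integrable Q (EFin \o cst c).
Proof.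
apply: measurable_bounded_integrable => //.
by exists `|c|; split=> // M cM x _ /=; rewrite ltW.
Qed.

(** [P] selects the constrained coordinates: half-spaces are included and intersections stay in the
    family, which makes it a pi-system generating the product sigma-algebra. *)
Definition quadrant (P : pred 'I_n) (a : 'I_n -> R) : set T :=
  [set x | forall i, P i -> x 0 i < a i].

Lemma measurable_quadrant P a : measurable (quadrant P a).
Proof.
rewrite (_ : quadrant P a = \bigcap_(i in [set i | P i])
    ((fun x : T => x 0 i) @^-1` `]-oo, (a i)[%classic)).
  apply: fin_bigcap_measurable => // i _.
  by rewrite -[X in measurable X]setTI; apply: measurable_rV_coord.
apply/seteqP; split=> x h i; first by move=> Pi; rewrite /= in_itv/=; exact: h.
by move=> Pi; have := h i Pi; rewrite /= in_itv.
Qed.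

Lemma approximable_quadrant P a : approximable \1_(quadrant P a).
Proof.
pose F_ k (x : T) := \prod_(i <- index_enum 'I_n) (if P i then ramp k (a i - x 0 i) else 1).
apply: (@approximable_lim F_ _ (cst 1)).
- by apply: measurable_indic; exact: measurable_quadrant.
- move=> k; apply: approximable_regular; apply: regular_prod => i.
  by case: (P i); [exact: regular_ramp|exact: regular_cst].
- move=> x _; apply: cvg_near_cst.
  have : \forall k \near \oo, forall i, ramp k (a i - x 0 i) = ((0 < a i - x 0 i)%R)%:R.
    by apply: filter_forall => i; exact: ramp_cvg.
  apply: filterS => k hk; rewrite /F_ indicE.
  under eq_bigr do rewrite hk subr_gt0.
  have [xq|xq] := boolP (x \in _).
    rewrite big1// => i _; case: ifP => // Pi.
    by move: xq; rewrite inE => /(_ i Pi) ->.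
  have [ i ] : exists i, ~ (P i -> x 0 i < a i).
    by apply/existsNP => h; move: xq; rewrite mem_set.
  move=> /not_implyP[Pi /negP xa].
  by rewrite (bigD1 i)//= Pi (negbTE xa) mul0r.
- exact: integrable_cstQ.
- move=> k x _; rewrite -[_ ^+ 2]real_normK ?num_real// expr_le1//.
  have F0 : 0 <= F_ k x by apply: prodr_ge0 => i _; case: ifP => // _; exact: ramp_ge0.
  have F1 : F_ k x <= 1.
    apply: prodr_ile1 => i _; case: ifP => // _; last by rewrite ler01 lexx.
    by rewrite ramp_ge0 ramp_le1.
  by rewrite indicE ler_norml; case: (_ \in _); rewrite ?mulr1n ?mulr0n; apply/andP; split; lra.
Qed.

(** The measurable sets with approximable indicator form a lambda-system containing the pi-system of
    quadrants. *)
Lemma approximable_indic (E : set T) : measurable E -> approximable \1_E.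
Proof.
move=> mE; suff: [set A | measurable A /\ approximable \1_A] E by case.
pose G := [set A : set T | exists P a, A = quadrant P a].
have GI : setI_closed G.
  move=> _ _ [P [a ->]] [P' [a' ->]].
  exists (fun i => P i || P' i), (fun i => if P i then if P' i then Num.min (a i) (a' i) else a i else a' i).
  apply/seteqP; split=> x.
    move=> [h h'] i; have := h i; have := h' i.
    case: (P i); case: (P' i) => //= h1 h2 _.
    by rewrite lt_min h1// h2.
  move=> h; split=> i Pi; have := h i; rewrite Pi ?orbT/= => /(_ isT).
    by case: ifP => // _; rewrite lt_min => /andP[].
  by case: ifP => // _; rewrite lt_min => /andP[].
apply: (@lambda_system_subset _ G GI setT) => //.
- split=> //.
  + split; first exact: measurableT.
    by rewrite indicT; apply/approximable_regular/regular_cst.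
  + move=> A B BA [mA aA] [mB aB]; split; first exact: measurableD.
    rewrite (_ : \1_(A `\` B) = fun x => \1_A x + (- 1) * \1_B x).
      by apply: approximableD => //; exact: approximableZ.
    apply/funext => x; rewrite !indicE in_setD.
    have [xB|xB] := boolP (x \in B); last by rewrite andbT mulr0 addr0.
    by rewrite andbF mem_set ?mulr1 ?subrr//; apply: BA; rewrite inE in xB.
  + move=> A ndA hA; have mA k : measurable (A k) by case: (hA k).
    have mUA : measurable (\bigcup_k A k) by exact: bigcup_measurable.
    split => //.
    apply: (@approximable_lim (fun k => \1_(A k)) _ (cst 1)).
    * exact: measurable_indic.
    * by move=> k; case: (hA k).
    * move=> x _; apply: cvg_near_cst; rewrite indicE.
      have [[k _ xk]|xA] := pselect ((\bigcup_k A k) x); last first.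
        apply: nearW => k; rewrite memNset// indicE memNset// => xk.
        by apply: xA; exists k.
      exists k => // j /= kj; rewrite indicE !mem_set//; first by exists k.
      by move/subsetPset : (ndA _ _ kj); exact.
    * exact: integrable_cstQ.
    * move=> k x _; rewrite -[_ ^+ 2]real_normK ?num_real// expr_le1// !indicE.
      by case: (_ \in _); case: (_ \in _);
        rewrite ?subrr ?subr0 ?sub0r ?normrN ?normr0 ?normr1.
- by move=> _ [P [a ->]]; split; [exact: measurable_quadrant|exact: approximable_quadrant].
- move: E mE; apply: smallest_sub; first exact: smallest_sigma_algebra.
  move=> A; rewrite -bigcup_seq => -[i _].
  rewrite [X in preimage_set_system _ _ X](_ : _ = <<s RGenInftyO.G (R := R)>>); last first.
    exact: RGenInftyO.measurableE.
  rewrite -g_sigma_preimageE; apply: smallest_sub; first exact: smallest_sigma_algebra.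
  move=> _ [_ [t ->] <-]; apply: sub_sigma_algebra.
  exists (pred1 i), (fun=> t); rewrite setTI; apply/seteqP; split=> x.
    by rewrite /= in_itv/= => xt j /eqP ->.
  by rewrite /= in_itv/=; apply; exact: eqxx.
Qed.

(** Simple functions [F_k] increase to [F], and [(F - F_k)^2 <= F^2] provides the domination. *)
Lemma approximable_ge0 F : measurable_fun setT F -> (forall x, 0 <= F x) ->
  mu.-integrable Q (EFin \o (fun x => F x ^+ 2)) -> approximable F.
Proof.
move=> mF F0 iF.
have mEF := measurable_EFinT mF.
pose F_ (k : nat) : T -> R := nnsfun_approx measurableT mEF k.
have cF x : F_ k x @[k --> \oo] --> F x.
  have /fine_cvgP[_] := cvg_nnsfun_approx measurableT mEF (fun x _ => F0 x) (I : setT x).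
  exact.
have leF k x : F_ k x <= F x.
  have nd : nondecreasing_seq (fun k => F_ k x).
    by move=> i j ij; have /lefP := nd_nnsfun_approx measurableT mEF ij; apply.
  rewrite -(cvg_lim _ (cF x))//; apply: nondecreasing_cvgn_le => //.
  by apply/cvg_ex; exists (F x).
apply: (@approximable_lim F_ _ (fun x => F x ^+ 2)) => //.
- move=> k.
  pose S := finmap.enum_fset (fset_set (range (F_ k))).
  rewrite (_ : F_ k = fun x => \sum_(i <- index_enum 'I_(size S))
     S`_i * \1_(F_ k @^-1` [set S`_i]) x).
    apply: approximable_sum => i; apply: approximableZ.
    exact: approximable_indic.
  by apply/funext => x; rewrite /F_ fimfunEord.
- move=> k x _; rewrite ler_pXn2r ?nnegrE ?subr_ge0//.
  by rewrite gerBl.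
Qed.

Lemma approximable_L2 F : measurable_fun setT F ->
  mu.-integrable Q (EFin \o (fun x => F x ^+ 2)) -> approximable F.
Proof.
move=> mF iF.
have h (F' : T -> R) : measurable_fun setT F' -> (forall x, `|F' x| <= `|F x|) ->
    mu.-integrable Q (EFin \o (fun x => F' x ^+ 2)).
  move=> mF' FF; apply: le_integrable iF => //; first exact: measurable_sq.
  move=> x _ /=; rewrite lee_fin !ger0_norm ?sqr_ge0//.
  by rewrite -[F' x ^+ 2]real_normK ?num_real// -[F x ^+ 2]real_normK ?num_real// ler_pXn2r.
rewrite (_ : F = fun x => Num.max (F x) 0 + (- 1) * Num.max (- F x) 0); last first.
  apply/funext => x; have [Fx|Fx] := leP (F x) 0.
    by rewrite max_l ?oppr_ge0//; ring.
  by rewrite max_r ?oppr_le0 ?ltW//; ring.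
have mp : measurable_fun setT (fun x => Num.max (F x) 0) by exact: measurable_maxr.
have mn : measurable_fun setT (fun x => Num.max (- F x) 0).
  by apply: measurable_maxr => //; exact: measurableT_comp.
apply: approximableD; last apply: approximableZ.
  apply: approximable_ge0 => //; first by move=> x; rewrite le_max lexx orbT.
  apply: h => // x; rewrite ger0_norm ?le_max ?lexx ?orbT// ge_max normr_ge0.
  by rewrite ler_norm.
apply: approximable_ge0 => //; first by move=> x; rewrite le_max lexx orbT.
apply: h => // x; rewrite ger0_norm ?le_max ?lexx ?orbT// ge_max normr_ge0.
by rewrite -normrN ler_norm.
Qed.

End square_integrable_approximation.

(** * Convergence of the kernel forms *)

Section kernel_form_limit.
Context {R : realType} {n : nat}.
Local Notation T := 'rV[R]_n.
Local Notation mu := (lebesgue_rV n : {sigma_finite_measure set 'rV[R]_n -> \bar R}).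
Implicit Types (F G H : T -> R).

Lemma intgE_fine F : intg mu F -> (\int[mu]_x (F x)%:E = (\int[mu]_x F x)%:E)%E.
Proof. by move=> iF; rewrite /Rintegral fineK//; exact: integrable_fin_num. Qed.

Lemma intgB F G : intg mu F -> intg mu G -> intg mu (fun x => F x - G x).
Proof.
move=> iF iG; rewrite (_ : (fun _ => _) = fun x => F x + (- 1) * G x).
  by apply: intgD => //; exact: intgZ.
by apply/funext => x; rewrite mulN1r.
Qed.

Lemma normr_Rintegral_le F G : intg mu F -> intg mu G -> (forall x, `|F x| <= G x) ->
  `|\int[mu]_x F x| <= \int[mu]_x G x.
Proof.
move=> iF iG FG; apply: le_trans (le_normr_Rintegral measurableT iF) _.
apply: le_Rintegral => //.
rewrite (_ : _ \o _ = abse \o (EFin \o F))//; exact: integrable_abse.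
Qed.

Lemma intg_norm F : intg mu F -> intg mu (fun x => `|F x|).
Proof.
by move=> iF; rewrite /intg (_ : _ \o _ = abse \o (EFin \o F))//; exact: integrable_abse.
Qed.

Lemma intgM_sq F G : measurable_fun setT F -> measurable_fun setT G ->
  intg mu (fun x => F x ^+ 2) -> intg mu (fun x => G x ^+ 2) ->
  intg mu (fun x => F x * G x).
Proof.
move=> mF mG iF iG.
apply: (@intg_bound _ _ _ mu _ (fun x => F x ^+ 2 + G x ^+ 2) 1).
- exact: measurable_funM.
- move=> x; rewrite mul1r normrM [leRHS]ger0_norm ?addr_ge0 ?sqr_ge0//.
  rewrite -[F x ^+ 2]real_normK ?num_real// -[G x ^+ 2]real_normK ?num_real//.
  have := sqr_ge0 (`|F x| - `|G x|).
  have := mulr_ge0 (normr_ge0 (F x)) (normr_ge0 (G x)).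
  by rewrite sqrrB; lra.
- exact: intgD.
Qed.

Lemma intg_indicQ (Q : set T) (c : R) : measurable Q -> (mu Q < +oo)%E ->
  intg mu (fun x => c * \1_Q x).
Proof.
move=> mQ Qfin; apply: intgZ.
rewrite /intg (_ : EFin \o _ = (EFin \o cst 1) \_ Q).
  by have /integrable_mkcond := integrable_cstQ mQ Qfin 1; apply.
apply/funext => x; rewrite /patch /= indicE.
by case: (x \in Q).
Qed.

Lemma scaled_le (d A : R) : 0 < d -> 0 <= A -> d / (4 * (A + 1)) * A <= d / 4.
Proof.
move=> d0 A0; have A1 : 0 < A + 1 by rewrite ltr_wpDl.
rewrite [leRHS](_ : _ = d / (4 * (A + 1)) * (A + 1)); last by field; rewrite gt_eqF.
have h : 0 <= d / (4 * (A + 1)) by rewrite ltW// divr_gt0// mulr_gt0.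
by rewrite ler_wpM2l// lerDl.
Qed.

(** Write [H = D + G] with [D] small in [L^2] and [G] the restriction to [Q'] of a uniformly
    continuous function. [kform_schur] bounds the part with [D] uniformly in [q]. For [G], the
    factor [F] forces [x] into [Q], and a kernel of width at most [m] then only sees points [y] of
    [Q'], where the indicator in [G] is constant and uniform continuity applies. *)
Lemma kform_cvg (Q Q' : set T) (m d : R) F H :
  0 < m -> 0 < d -> measurable Q' -> (mu Q' < +oo)%E -> Q `<=` Q' ->
  (forall x y : T, Q x -> (forall i, `|x 0 i - y 0 i| <= m) -> Q' y) ->
  intg mu F -> intg mu (fun x => F x ^+ 2) -> (forall x, ~ Q x -> F x = 0) ->
  intg mu H -> intg mu (fun x => H x ^+ 2) -> (forall x, ~ Q' x -> H x = 0) ->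
  exists2 e : R, 0 < e & forall q, stochastic_kernel mu q ->
    (forall x y : T, q x y != 0 -> forall i, `|x 0 i - y 0 i| <= e) ->
    `|kform mu F H q - \int[mu]_x (F x * H x)| <= d.
Proof.
move=> m0 d0 mQ' Q'fin QQ' Qm iF iF2 FQ iH iH2 HQ'.
have mF := intg_measurable iF; have mH := intg_measurable iH.
pose A := \int[mu]_x F x ^+ 2; pose B := \int[mu]_x `|F x|.
have A0 : 0 <= A by apply: Rintegral_ge0 => x _; exact: sqr_ge0.
have B0 : 0 <= B by apply: Rintegral_ge0 => x _.
(* Makes the first Schur term [l * A] at most [d / 4]; the second one follows by taking [D] of
   squared norm at most [l * (d / 4)]. The [+ 1] keeps the quotient meaningful when [A = 0]. *)
pose l := d / (4 * (A + 1)).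
have l0 : 0 < l by rewrite divr_gt0// mulr_gt0// ltr_wpDl.
have lA : l * A <= d / 4.
  exact: scaled_le.
have [_ ] := @approximable_L2 R n Q' mQ' Q'fin H mH (integrableS measurableT mQ' (@subsetT _ _) iH2).
have ld : 0 < l * (d / 4) by rewrite mulr_gt0// divr_gt0.
move=> /(_ _ ld)[g rg Hg].
have [mg [M gM] cg] := rg.
pose D x := (H x - g x) * \1_Q' x; pose G x := g x * \1_Q' x.
have mI : measurable_fun setT (\1_Q' : T -> R) by exact: measurable_indic.
have HE x : H x = D x + G x.
  rewrite /D /G indicE; have [xQ|xQ] := boolP (x \in Q').
    by rewrite !mulr1 subrK.
  by rewrite HQ' ?mulr0 ?addr0// => h; move: xQ; rewrite mem_set.
have iG : intg mu G.
  apply: (@intg_bound _ _ _ mu _ (fun x => 1 * \1_Q' x) `|M|).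
  - exact: measurable_funM.
  - move=> x; rewrite /G mul1r normrM ler_wpM2r//.
    by rewrite (le_trans (gM x))// ler_norm.
  - exact: intg_indicQ.
have iG2 : intg mu (fun x => G x ^+ 2).
  apply: (@intg_bound _ _ _ mu _ G `|M|) => //.
    by apply: measurable_funX; exact: measurable_funM.
  move=> x; rewrite expr2 normrM ler_wpM2r// /G normrM.
  rewrite -[leRHS]mulr1 ler_pM// ?(le_trans (gM x)) ?ler_norm//.
  by rewrite indicE; case: (_ \in _); rewrite ?normr1 ?normr0.
have mD : measurable_fun setT D by apply: measurable_funM => //; exact: measurable_funB.
have DE : D = fun x => H x + (- 1) * G x.
  by apply/funext => x; rewrite HE; ring.
have iD : intg mu D by rewrite DE; apply: intgD => //; exact: intgZ.
have iD2 : intg mu (fun x => D x ^+ 2).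
  have iHG : intg mu (fun x => 2 * H x ^+ 2 + 2 * G x ^+ 2).
    by apply: intgD; exact: intgZ.
  apply: (@intg_bound _ _ _ mu _ (fun x => 2 * H x ^+ 2 + 2 * G x ^+ 2) 1) => //.
    exact: measurable_funX.
  move=> x; rewrite mul1r (ger0_norm (sqr_ge0 (D x))) ger0_norm; last first.
    by apply: addr_ge0; apply: mulr_ge0 => //; exact: sqr_ge0.
  rewrite DE.
  by have := sqr_ge0 (H x + G x); rewrite sqrrD sqrrD; lra.
have D2 : \int[mu]_x D x ^+ 2 <= l * (d / 4).
  rewrite -lee_fin -intgE_fine//; apply: le_trans Hg.
  rewrite /sqnorm [leRHS]integral_mkcond; apply: ge0_le_integral => //.
  - by move=> x _; rewrite lee_fin sqr_ge0.
  - by apply: measurable_EFinT; exact: measurable_funX.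
  - apply/(measurable_restrictT _ mQ'); apply: measurable_sq => //.
    exact: measurable_funB.
  - move=> x _; rewrite /patch /D indicE; case: (_ \in _); rewrite ?mulr1//.
    by rewrite mulr0 expr0n.
have bnd : (l * A + l^-1 * \int[mu]_x D x ^+ 2) / 2 <= d / 4.
  have : l^-1 * \int[mu]_x D x ^+ 2 <= d / 4 by rewrite ler_pdivrMl.
  by lra.
have [e1 e10 he1] := cg (d / (4 * (B + 1))) (divr_gt0 d0 (mulr_gt0 (ltr0Sn _ 3) (ltr_wpDl B0 ltr01))).
exists (Num.min m e1); first by rewrite lt_min m0.
move=> q sq qe; have [bq q0 q1 _] := sq.
rewrite (_ : kform mu F H q = kform mu F D q + kform mu F G q); last first.
  by rewrite -kformDr//; congr kform; apply/funext => x.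
have iFD : intg mu (fun x => F x * D x) by exact: intgM_sq.
have mG := intg_measurable iG.
have iFG : intg mu (fun x => F x * G x) by exact: intgM_sq.
rewrite (_ : \int[mu]_x (F x * H x) = \int[mu]_x (F x * D x) + \int[mu]_x (F x * G x)); last first.
  by rewrite -RintegralD//; apply: eq_Rintegral => x _; rewrite HE mulrDr.
have t1 : `|kform mu F D q| <= d / 4.
  exact: le_trans (kform_schur l0 sq iF iD iF2 iD2) bnd.
have t2 : `|\int[mu]_x (F x * D x)| <= d / 4.
  apply: le_trans bnd.
  have i1 := intgZ (l / 2) iF2; have i2 := intgZ (l^-1 / 2) iD2.
  rewrite mulrDl (mulrAC l) (mulrAC l^-1) /A -!RintegralZl// -RintegralD//.
  apply: normr_Rintegral_le => //; first exact: intgD.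
  move=> x; rewrite normrM.
  rewrite -[F x ^+ 2]real_normK ?num_real// -[D x ^+ 2]real_normK ?num_real//.
  set a := `|F x|; set b := `|D x|; rewrite [leRHS](_ : _ =
    a * b + l^-1 / 2 * (l * a - b) ^+ 2); last by field; rewrite gt_eqF.
  by rewrite lerDl mulr_ge0 ?sqr_ge0// mulr_ge0// invr_ge0 ltW.
have t3 : `|kform mu F G q - \int[mu]_x (F x * G x)| <= d / 4.
  have iGq x := intg_kernel1 x bq iG.
  have iq x : intg mu (q x).
    apply/integrableP; split.
      by apply: measurable_EFinT; exact: measurable_kernel1.
    under eq_integral do rewrite /= ger0_norm//.
    by rewrite q1 ltry.
  have iq1 x : \int[mu]_y q x y = 1 by rewrite /Rintegral q1.
  pose K x := \int[mu]_y (G y * q x y).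
  have iFK : intg mu (fun x => F x * K x).
    have := integrable_fubini_F (integrable_kform iF iG bq).
    apply: eq_integrable => // x _; rewrite /fubini_F /=.
    transitivity ((F x)%:E * \int[mu]_y (G y * q x y)%:E)%E.
      rewrite -(integralZl measurableT (iGq x)).
      apply: eq_integral => y _.
      exact: (congr1 EFin (esym (mulrA (F x) (G y) (q x y)))).
    by rewrite (intgE_fine (iGq x)) -EFinM.
  rewrite kform_left// -RintegralB//.
  pose eta := d / (4 * (B + 1)).
  apply: (@le_trans _ _ (\int[mu]_x (eta * `|F x|))); last first.
    rewrite RintegralZl//; last exact: intg_norm.
    exact: scaled_le.
  apply: normr_Rintegral_le; [exact: (intgB iFK iFG)|exact/intgZ/intg_norm|].
  move=> x; rewrite -mulrBr normrM mulrC.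
  have [Qx|nQx] := pselect (Q x); last by rewrite FQ// normr0 !mulr0.
  rewrite ler_wpM2r// /K /G indicE mem_set ?mulr1; last exact: QQ'.
  (* The unit mass of [q x] turns the constant [g x] into an average over [y], so that the two terms
     can be compared pointwise. *)
  have -> : \int[mu]_y (g y * \1_Q' y * q x y) - g x =
      \int[mu]_y ((G y * q x y) + (- g x) * q x y).
    rewrite (RintegralD measurableT (iGq x) (intgZ (- g x) (iq x))).
    by rewrite (RintegralZl (- g x) measurableT (iq x)) iq1 mulr1.
  rewrite -[leRHS]mulr1 -(iq1 x) -(RintegralZl _ measurableT (iq x)).
  apply: normr_Rintegral_le; [by apply: intgD => //; exact: intgZ|exact: intgZ|].
  move=> y; rewrite -mulrDl normrM (ger0_norm (q0 _ _)).
  have [->|qxy] := eqVneq (q x y) 0; first by rewrite !mulr0.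
  have xy := qe _ _ qxy.
  rewrite ler_wpM2r// /G indicE mem_set ?mulr1; last first.
    by apply: Qm Qx _ => i; have := xy i; rewrite le_min => /andP[].
  rewrite distrC; apply: he1 => i; have := xy i.
  by rewrite le_min => /andP[].
rewrite opprD addrACA.
apply: le_trans (ler_normD _ _) _.
have : `|kform mu F D q - \int[mu]_x (F x * D x)| <= d / 4 + d / 4.
  by rewrite (le_trans (ler_normB _ _))// lerD.
by move: t3; lra.
Qed.

End kernel_form_limit.

(** * Integration by parts for products of Sobolev functions *)

Section weak_derivative_identities.
Context {R : realType} {n : nat}.
Local Notation T := 'rV[R]_n.
Local Notation mu := (lebesgue_rV n : {sigma_finite_measure set 'rV[R]_n -> \bar R}).
Variable rho : R.
Implicit Types (f g b : T -> R) (F G : 'I_n -> T -> R) (r : R).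

(** Local integrability is phrased through truncations defined everywhere, so that kernel forms and
    weighted integrals run over all of [R^n]. *)
Definition cut r f : T -> R := fun x => f x * \1_(cball r) x.

Lemma cutE r f x : cball r x -> cut r f x = f x.
Proof. by move=> xr; rewrite /cut indicE mem_set// mulr1. Qed.

Lemma cut0 r f x : ~ cball r x -> cut r f x = 0.
Proof. by move=> xr; rewrite /cut indicE memNset// mulr0. Qed.

Definition L2loc_real f := forall r, 0 <= r -> r < rho ->
  measurable_fun setT (cut r f) /\ intg mu (fun x => cut r f x ^+ 2).

Lemma L2loc_real_intg f r : L2loc_real f -> 0 <= r -> r < rho -> intg mu (cut r f).
Proof.
move=> Lf r0 rr; have [mf i2] := Lf r r0 rr.
apply: (@intg_bound _ _ _ mu _ (fun x => 1 * \1_(cball r) x + cut r f x ^+ 2) 1) => //.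
  move=> x; rewrite mul1r [leRHS]ger0_norm; last first.
    by rewrite addr_ge0 ?sqr_ge0// mul1r indicE.
  have [xr|xr] := pselect (cball r x); last by rewrite cut0// normr0 addr_ge0 ?sqr_ge0// mul1r indicE.
  rewrite indicE mem_set// mul1r -[_ ^+ 2]real_normK ?num_real//.
  by have := sqr_ge0 (`|cut r f x| - 1); rewrite sqrrB /=; have := normr_ge0 (cut r f x); lra.
apply: intgD => //; apply: intg_indicQ; first exact: measurable_cball.
exact: cball_finite.
Qed.

Definition weakly_derivable f F := [/\ L2loc_real f, forall j, L2loc_real (F j) &
  forall j phi, test_function (eball rho) phi ->
    \int[mu]_(x in eball rho) (f x * partial j phi x) =
    - \int[mu]_(x in eball rho) (F j x * phi x)].

Definition weight r b := [/\ forall k, Ck dirn k b, forall x, ~ cball r x -> b x = 0 &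
  measurable_fun setT b].

Lemma weight_derive0 r b b' j x : 0 <= r -> (forall x, ~ cball r x -> b x = 0) ->
  is_derive x ('e_j : T) b (b' x) -> ~ cball r x -> b' x = 0.
Proof.
move=> r0 b0 [_ <-] xr; rewrite (@near_eq_derive _ _ _ _ (cst 0)) ?derive_cst//.
have : open (~` cball r : set T) by apply: closed_openC; exact: closed_cball.
by rewrite openE => /(_ _ xr); rewrite /interior; apply: filterS => y; exact: b0.
Qed.

Lemma weight_derive r b b' j : 0 <= r -> weight r b ->
  (forall x, is_derive x ('e_j : T) b (b' x)) -> measurable_fun setT b' -> weight r b'.
Proof.
move=> r0 [Cb b0 mb] db mb'; split=> //; last by move=> x; exact: weight_derive0 (db x).
move=> k; have [_ /(_ j)[f' ff' +]] := Cb k.+1.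
rewrite (_ : f' = b')//; apply/funext => x.
by have [_ <-] := ff' x; have [_ <-] := db x.
Qed.

Lemma weight_bounded r b : 0 <= r -> weight r b -> exists2 M, 0 <= M & forall x, `|b x| <= M.
Proof.
move=> r0 [Cb b0 _].
have cb : {within cball r, continuous (fun x => `|b x|)}.
  apply: continuous_subspaceT => t; apply: continuous_comp.
    exact: (Ck_continuous (Cb 0%N)).
  exact: norm_continuous.
have x0 : (cball r : set T) !=set0.
  exists (0 : T); rewrite /cball /= /sqn big1 ?sqr_ge0// => i _.
  by rewrite mxE expr0n.
have [c cr hc] := EVT_max_rV x0 (compact_cball r0) cb.
exists `|b c| => // x; have [xr|xr] := pselect (cball r x); last by rewrite b0// normr0.
by apply: hc; rewrite inE.
Qed.

Lemma weight_cut r b f : 0 <= r -> r < rho -> weight r b -> L2loc_real f ->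
  [/\ measurable_fun setT (fun x => b x * cut r f x),
      intg mu (fun x => b x * cut r f x) &
      intg mu (fun x => (b x * cut r f x) ^+ 2)].
Proof.
move=> r0 rr wb Lf; have [M M0 bM] := weight_bounded r0 wb.
have [_ _ mb] := wb; have [mf i2] := Lf r r0 rr; have i1 := L2loc_real_intg Lf r0 rr.
split; first exact: measurable_funM.
  apply: (intg_bound (M := M)) i1; first exact: measurable_funM.
  by move=> x; rewrite normrM ler_wpM2r.
apply: (intg_bound (M := M ^+ 2)) i2.
  by apply: measurable_funX; exact: measurable_funM.
by move=> x; rewrite exprMn normrM ler_wpM2r// normrX ler_pXn2r ?nnegrE.
Qed.

(** A smooth function supported in a closed ball inside the domain is a test function, and on that
    ball the truncation is invisible. *)
Lemma weakly_derivable_cut f F r (phi phi' : T -> R) j : weakly_derivable f F ->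
  0 <= r -> r < rho -> (forall k, Ck dirn k phi) -> (forall x, ~ cball r x -> phi x = 0) ->
  (forall x, is_derive x ('e_j : T) phi (phi' x)) ->
  \int[mu]_x (cut r f x * phi' x) = - \int[mu]_x (cut r (F j) x * phi x).
Proof.
move=> [_ _ wf] r0 rr Cphi phi0 dphi.
have tphi := test_function_cball r0 rr Cphi phi0.
have := wf j _ tphi.
have sub := @cball_eball R n _ _ r0 rr.
have E (h k : T -> R) : (forall x, ~ cball r x -> k x = 0) ->
    \int[mu]_(x in eball rho) (h x * k x) = \int[mu]_x (cut r h x * k x).
  move=> k0; rewrite Rintegral_mkcond; apply: eq_Rintegral => x _; rewrite /patch.
  have [xr|xr] := pselect (cball r x).
    by rewrite mem_set ?cutE//; exact: sub.
  by rewrite (k0 _ xr) !mulr0; case: ifP.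
have -> : (fun x => f x * partial j phi x) = (fun x => f x * phi' x).
  by apply/funext => x; congr (_ * _); have [_ <-] := dphi x.
rewrite (E f phi'); last by move=> x; exact: weight_derive0 (dphi x).
by rewrite (E (F j) phi).
Qed.

Section kernel_step.
Variables (e : R) (s : 'I_n -> R -> R).
Hypothesis se : forall i, bumps e (s i).

(** For [x] in the smaller ball, [pker s x] is a test function of [y]. The sign in the definition of
    the weak derivative cancels the one in the [y]-derivative of the kernel. *)
Lemma kform_weak_right (r1 r2 : R) (F0 : T -> R) g G l : weakly_derivable g G ->
  0 <= r2 -> r2 < rho ->
  (forall x y : T, cball r1 x -> (forall i, `|x 0 i - y 0 i| <= e) -> cball r2 y) ->
  intg mu F0 -> (forall x, ~ cball r1 x -> F0 x = 0) ->
  kform mu F0 (cut r2 (G l)) (pker s) = kform mu F0 (cut r2 g) (pker (upd s l)).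
Proof.
move=> wg r20 r2r marg iF F00; have [Lg LG _] := wg.
have bs := bounded_pker se; have bsl := bounded_pker (bumps_upd l se).
have iG := L2loc_real_intg (LG l) r20 r2r; have ig := L2loc_real_intg Lg r20 r2r.
rewrite (kform_left iF iG bs) (kform_left iF ig bsl).
apply: eq_Rintegral => x _.
have [xr|xr] := pselect (cball r1 x); last by rewrite F00// !mul0r.
congr (_ * _).
have := @weakly_derivable_cut g G r2 (pker s x) (fun y => - pker (upd s l) x y) l wg r20 r2r.
have -> : \int[mu]_y (cut r2 g y * - pker (upd s l) x y) =
   - \int[mu]_y (cut r2 g y * pker (upd s l) x y).
  rewrite -mulN1r -RintegralZl//; last exact: (intg_kernel1 x bsl (L2loc_real_intg Lg r20 r2r)).
  by apply: eq_Rintegral => y _; ring.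
have C1 k : Ck dirn k (pker s x) by exact: pker_Ckr se.
have C2 (y : T) : ~ cball r2 y -> pker s x y = 0.
  move=> yr; apply/eqP; apply: contra_notT yr => /(pker_support se).
  exact: marg.
have C3 (y : T) : is_derive y ('e_l : T) (pker s x) (- pker (upd s l) x y).
  exact: pker_is_deriver se.
by move=> /(_ C1 C2 C3) /oppr_inj ->.
Qed.

(** For fixed [y], the product of [b] and the kernel is a test function of [x]; Leibniz' rule gives
    one term from the weight and one from the kernel. *)
Lemma kform_weak_left (r : R) b b' f F (H : T -> R) j : weakly_derivable f F ->
  0 <= r -> r < rho -> weight r b -> (forall x, is_derive x ('e_j : T) b (b' x)) ->
  measurable_fun setT b' -> intg mu H ->
  kform mu (fun x => b x * cut r (F j) x) H (pker s) =
  - kform mu (fun x => b' x * cut r f x) H (pker s)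
  - kform mu (fun x => b x * cut r f x) H (pker (upd s j)).
Proof.
move=> wf r0 rr wb db mb' iH; have [Lf LF _] := wf.
have bs := bounded_pker se; have bsj := bounded_pker (bumps_upd j se).
have wb' := weight_derive r0 wb db mb'.
have [_ iFb _] := weight_cut r0 rr wb (LF j).
have [_ ifb _] := weight_cut r0 rr wb Lf.
have [_ ifb' _] := weight_cut r0 rr wb' Lf.
have [Cb b0 mb] := wb.
rewrite (kform_right iFb iH bs) (kform_right ifb' iH bs) (kform_right ifb iH bsj).
have im' := intg_marginal ifb' iH bs; have im := intg_marginal ifb iH bsj.
rewrite -opprD -(RintegralD measurableT im' im) -mulN1r.
rewrite -(RintegralZl _ measurableT (intgD im' im)).
apply: eq_Rintegral => y _; rewrite -mulrDr mulN1r -mulrN; congr (_ * _).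
have := @weakly_derivable_cut f F r (fun x => b x * pker s x y)
  (fun x => b x * pker (upd s j) x y + pker s x y * b' x) j wf r0 rr.
rewrite -(RintegralD measurableT (intg_kernel2 y bs ifb') (intg_kernel2 y bsj ifb)).
have C1 k : Ck dirn k (fun x => b x * pker s x y).
  by apply: CkM => //; exact: pker_Ckl se.
have C2 (x : T) : ~ cball r x -> b x * pker s x y = 0.
  by move=> xr; rewrite b0// mul0r.
have C3 (x : T) : is_derive x ('e_j : T) (fun x => b x * pker s x y)
    (b x * pker (upd s j) x y + pker s x y * b' x).
  exact: (is_derive_eq (is_deriveM (db x) (pker_is_derivel x y j se))).
move=> /(_ C1 C2 C3) h; apply: oppr_inj; rewrite opprK.
transitivity (- \int[mu]_x (cut r (F j) x * (b x * pker s x y))).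
  by congr (- _); apply: eq_Rintegral => x _; ring.
by rewrite -h; apply: eq_Rintegral => x _; ring.
Qed.

End kernel_step.


Lemma cball_margin (r1 r2 : R) : 0 <= r1 -> r1 < r2 ->
  exists2 m : R, 0 < m & forall x y : T, cball r1 x ->
    (forall i, `|x 0 i - y 0 i| <= m) -> cball r2 y.
Proof.
move=> r10 r12.
(* Moving a coordinate by at most [m <= 1] raises its square by at most [(2 r1 + 1) m], and there
   are [n] coordinates; the last [1] keeps [c] positive when [n = 0]. *)
pose c := n%:R * (2 * r1 + 1) + 1.
have c0 : 0 < c by rewrite ltr_wpDl// mulr_ge0//; lra.
have d0 : 0 < r2 ^+ 2 - r1 ^+ 2.
  by rewrite subr_sqr mulr_gt0//; lra.
pose m := Num.min 1 ((r2 ^+ 2 - r1 ^+ 2) / c).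
have m0 : 0 < m by rewrite lt_min ltr01 divr_gt0.
exists m => // x y xr xy; rewrite /cball /=.
have le i : y 0 i ^+ 2 <= x 0 i ^+ 2 + (2 * r1 + 1) * m.
  have xi : `|x 0 i| <= r1.
    rewrite -(@ler_pXn2r _ 2)// ?nnegrE// real_normK ?num_real//.
    exact: le_trans (coord_le_sqn _ _) xr.
  have m1 : m <= 1 by rewrite ge_min lexx.
  have yi : `|y 0 i| <= `|x 0 i| + m.
    rewrite -[y 0 i](subKr (x 0 i)) (le_trans (ler_normB _ _))// lerD2l.
    exact: xy.
  rewrite -[y 0 i ^+ 2]real_normK ?num_real// -[x 0 i ^+ 2]real_normK ?num_real//.
  apply: (@le_trans _ _ ((`|x 0 i| + m) ^+ 2)).
    by rewrite ler_pXn2r ?nnegrE// addr_ge0// ltW.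
  have a1 : `|x 0 i| * m <= r1 * m by rewrite ler_wpM2r// ltW.
  have a2 : m * m <= 1 * m by rewrite ler_wpM2r// ltW.
  by rewrite sqrrD; lra.
apply: (@le_trans _ _ (r1 ^+ 2 + n%:R * ((2 * r1 + 1) * m))).
  apply: (@le_trans _ _ (\sum_(i < n) (x 0 i ^+ 2 + (2 * r1 + 1) * m))).
    by apply: ler_sum => i _.
  rewrite big_split/=; apply: lerD; first exact: xr.
  by rewrite sumr_const card_ord [leRHS]mulr_natl.
rewrite mulrA -lerBrDl.
apply: (@le_trans _ _ (c * m)).
  by rewrite ler_wpM2r ?(ltW m0)// /c lerDl.
by rewrite mulrC -ler_pdivlMr// ge_min lexx orbT.
Qed.

(** The second function is truncated at a larger radius because [y] may leave the ball that contains
    [x]; in the limit both truncations disappear behind [b]. *)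
Lemma kform_weight_cvg (r1 r2 : R) b f g (d : R) : 0 <= r1 -> r1 < r2 -> r2 < rho ->
  0 < d -> weight r1 b -> L2loc_real f -> L2loc_real g ->
  exists2 e : R, 0 < e & forall q, stochastic_kernel mu q ->
    (forall x y : T, q x y != 0 -> forall i, `|x 0 i - y 0 i| <= e) ->
    `|kform mu (fun x => b x * cut r1 f x) (cut r2 g) q - \int[mu]_x (b x * (f x * g x))| <= d.
Proof.
move=> r10 r12 r2r d0 wb Lf Lg.
have r1r := lt_trans r12 r2r; have r20 := le_trans r10 (ltW r12).
have [m m0 marg] := cball_margin r10 r12.
have [mF iF iF2] := weight_cut r10 r1r wb Lf.
have [_ iH2] := Lg r2 r20 r2r; have iH := L2loc_real_intg Lg r20 r2r.
have sub : (cball r1 : set T) `<=` cball r2.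
  by move=> x xr; apply: (marg x x xr) => i; rewrite subrr normr0 ltW.
have F0 x : ~ cball r1 x -> b x * cut r1 f x = 0.
  by move=> xr; rewrite cut0// mulr0.
have H0 x : ~ cball r2 x -> cut r2 g x = 0 by exact: cut0.
have [e e0 he] := kform_cvg m0 d0 (measurable_cball r2) (cball_finite n r20) sub marg iF iF2 F0 iH iH2 H0.
exists e => // q sq qe; have := he q sq qe.
rewrite [X in `|_ - X| <= d -> _](_ : _ = \int[mu]_x (b x * (f x * g x)))//.
apply: eq_Rintegral => x _; have [xr|xr] := pselect (cball r1 x).
  by rewrite !cutE//; [ring|exact: sub].
by case: wb => _ b0 _; rewrite b0// !mul0r.
Qed.

Lemma eq0_of_small (x c : R) : (forall d : R, 0 < d -> `|x| <= c * d) -> x = 0.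
Proof.
move=> h; apply/eqP; rewrite -normr_le0; apply/ler_addgt0Pl => e e0.
rewrite addr0; have c1 : 0 < `|c| + 1 by rewrite ltr_wpDl.
apply: le_trans (h _ (divr_gt0 e0 c1)) _.
apply: (@le_trans _ _ ((`|c| + 1) * (e / (`|c| + 1)))).
  by rewrite ler_wpM2r ?divr_ge0 ?ltW// (le_lt_trans (ler_norm c))// ltrDl.
by rewrite mulrC divfK// gt_eqF.
Qed.

(** At the level of kernel forms, moving the derivative off [f] produces [- b' f g] and a term with
    differentiated kernel, and moving it off [g] produces that last term with the opposite sign.
    They cancel before the mollifier is removed. *)
Lemma weak_product_rule (r1 : R) b b' f F g G l : 0 <= r1 -> r1 < rho ->
  weakly_derivable f F -> weakly_derivable g G ->
  weight r1 b -> (forall x, is_derive x ('e_l : T) b (b' x)) -> measurable_fun setT b' ->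
  \int[mu]_x (b x * (F l x * g x)) + \int[mu]_x (b x * (f x * G l x)) =
  - \int[mu]_x (b' x * (f x * g x)).
Proof.
move=> r10 r1r wf wg wb db mb'.
have [Lf LF _] := wf; have [Lg LG _] := wg.
pose r2 := (r1 + rho) / 2.
have r12 : r1 < r2 by rewrite /r2; lra.
have r2r : r2 < rho by rewrite /r2; lra.
have r20 := le_trans r10 (ltW r12).
have wb' := weight_derive r10 wb db mb'.
(* The factor counts the three kernel forms, each within [d] of its limit. *)
apply/eqP; rewrite -addr_eq0; apply/eqP; apply: (@eq0_of_small _ 3) => d d0.
have [e1 e10 h1] := kform_weight_cvg r10 r12 r2r d0 wb (LF l) Lg.
have [e2 e20 h2] := kform_weight_cvg r10 r12 r2r d0 wb Lf (LG l).
have [e3 e30 h3] := kform_weight_cvg r10 r12 r2r d0 wb' Lf Lg.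
have [m m0 marg] := cball_margin r10 r12.
pose e := Num.min m (Num.min e1 (Num.min e2 e3)).
have e0 : 0 < e by rewrite !lt_min m0 e10 e20.
have [s [bs sq]] := mollifier_exists (n := n) e0.
have supp (x y : T) : pker s x y != 0 -> forall i, `|x 0 i - y 0 i| <= e.
  exact: pker_support bs.
have le (e' : R) : e <= e' -> forall x y : T, pker s x y != 0 -> forall i, `|x 0 i - y 0 i| <= e'.
  by move=> ee x y xy i; apply: le_trans ee; exact: supp.
have le1 : e <= e1 by rewrite !ge_min lexx !orbT.
have le2 : e <= e2 by rewrite !ge_min lexx !orbT.
have le3 : e <= e3 by rewrite !ge_min lexx !orbT.
move: (h1 _ sq (le _ le1)) (h2 _ sq (le _ le2)) (h3 _ sq (le _ le3)).
have ig := L2loc_real_intg Lg r20 r2r.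
rewrite (kform_weak_left bs wf r10 r1r wb db mb' ig).
have marge (x y : T) : cball r1 x -> (forall i, `|x 0 i - y 0 i| <= e) -> cball r2 y.
  by move=> xr xy; apply: (marg x y xr) => i; rewrite (le_trans (xy i))// ge_min lexx.
have [_ iF _] := weight_cut r10 r1r wb Lf.
have F0 x : ~ cball r1 x -> b x * cut r1 f x = 0.
  by move=> xr; rewrite cut0// mulr0.
rewrite (kform_weak_right bs _ wg r20 r2r marge iF F0).
set A := kform _ _ _ _; set B := kform _ _ _ _.
set I1 := Rintegral _ _ _; set I2 := Rintegral _ _ _; set I3 := Rintegral _ _ _.
rewrite !ler_norml => /andP[? ?] /andP[? ?] /andP[? ?].
by apply/andP; split; lra.
Qed.

(** Formally [f_i g_l - f_l g_i] is [d_i (f g_l) - d_l (f g_i)], the second derivatives of [g]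
    cancelling. Here these second derivatives fall on the kernel: both products lead to [b f g]
    against the kernel differentiated in [i] and in [l], and [updC] cancels them. *)
Lemma weak_null_lagrangian (r1 : R) b b1 b2 f F g G i l : 0 <= r1 -> r1 < rho ->
  weakly_derivable f F -> weakly_derivable g G -> weight r1 b ->
  (forall x, is_derive x ('e_i : T) b (b1 x)) -> measurable_fun setT b1 ->
  (forall x, is_derive x ('e_l : T) b (b2 x)) -> measurable_fun setT b2 ->
  \int[mu]_x (b x * (F i x * G l x)) - \int[mu]_x (b x * (F l x * G i x)) =
  \int[mu]_x (b2 x * (f x * G i x)) - \int[mu]_x (b1 x * (f x * G l x)).
Proof.
move=> r10 r1r wf wg wb db1 mb1 db2 mb2.
have [Lf LF _] := wf; have [Lg LG _] := wg.
pose r2 := (r1 + rho) / 2.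
have r12 : r1 < r2 by rewrite /r2; lra.
have r2r : r2 < rho by rewrite /r2; lra.
have r20 := le_trans r10 (ltW r12).
have wb1 := weight_derive r10 wb db1 mb1; have wb2 := weight_derive r10 wb db2 mb2.
apply/eqP; rewrite -subr_eq0; apply/eqP; apply: (@eq0_of_small _ 4) => d d0.
have [e1 e10 h1] := kform_weight_cvg r10 r12 r2r d0 wb (LF i) (LG l).
have [e2 e20 h2] := kform_weight_cvg r10 r12 r2r d0 wb (LF l) (LG i).
have [e3 e30 h3] := kform_weight_cvg r10 r12 r2r d0 wb1 Lf (LG l).
have [e4 e40 h4] := kform_weight_cvg r10 r12 r2r d0 wb2 Lf (LG i).
have [m m0 marg] := cball_margin r10 r12.
pose e := Num.min m (Num.min e1 (Num.min e2 (Num.min e3 e4))).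
have e0 : 0 < e by rewrite !lt_min m0 e10 e20 e30.
have [s [bs sq]] := mollifier_exists (n := n) e0.
have le (e' : R) : e <= e' -> forall x y : T, pker s x y != 0 -> forall i, `|x 0 i - y 0 i| <= e'.
  by move=> ee x y xy j; apply: le_trans ee; exact: pker_support bs xy j.
have le1 : e <= e1 by rewrite !ge_min lexx !orbT.
have le2 : e <= e2 by rewrite !ge_min lexx !orbT.
have le3 : e <= e3 by rewrite !ge_min lexx !orbT.
have le4 : e <= e4 by rewrite !ge_min lexx !orbT.
move: (h1 _ sq (le _ le1)) (h2 _ sq (le _ le2)) (h3 _ sq (le _ le3)) (h4 _ sq (le _ le4)).
have iGl := L2loc_real_intg (LG l) r20 r2r; have iGi := L2loc_real_intg (LG i) r20 r2r.
rewrite (kform_weak_left bs wf r10 r1r wb db1 mb1 iGl).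
rewrite (kform_weak_left bs wf r10 r1r wb db2 mb2 iGi).
have marge (x y : T) : cball r1 x -> (forall i, `|x 0 i - y 0 i| <= e) -> cball r2 y.
  by move=> xr xy; apply: (marg x y xr) => j; rewrite (le_trans (xy j))// ge_min lexx.
have [_ iF _] := weight_cut r10 r1r wb Lf.
have F0 x : ~ cball r1 x -> b x * cut r1 f x = 0.
  by move=> xr; rewrite cut0// mulr0.
rewrite (kform_weak_right (bumps_upd i bs) _ wg r20 r2r marge iF F0).
rewrite (kform_weak_right (bumps_upd l bs) _ wg r20 r2r marge iF F0) updC.
set A := kform _ _ _ (pker s); set B := kform _ _ _ (pker s); set D := kform _ _ _ _.
set I1 := Rintegral _ _ _; set I2 := Rintegral _ _ _; set I3 := Rintegral _ _ _; set I4 := Rintegral _ _ _.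
rewrite !ler_norml => /andP[? ?] /andP[? ?] /andP[? ?] /andP[? ?].
by apply/andP; split; lra.
Qed.

End weak_derivative_identities.

(** * Radial weights and weighted integrals *)

Section radial_weights.
Context {R : realType} {n : nat}.
Local Notation T := 'rV[R]_n.
Local Notation mu := (lebesgue_rV n : {sigma_finite_measure set 'rV[R]_n -> \bar R}).
Implicit Types (h dh : R -> R) (x : T) (r : R).

Definition smooth1 h := forall k, Ck dir1 k h.

Lemma smooth1_continuous h : smooth1 h -> continuous h.
Proof. by move=> Ch; exact: (Ck_continuous (Ch 0%N)). Qed.

Lemma smooth1_derive_continuous h dh : smooth1 h ->
  (forall s : R, is_derive s 1 h (dh s)) -> continuous dh.
Proof.
move=> Ch hdh; have [_ /(_ tt)[f' ff' [cf' _]]] := Ch 1.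
rewrite (_ : dh = f')//; apply/funext => s.
by have [_ <-] := ff' s; have [_ <-] := hdh s.
Qed.

Lemma measurable_radial h : continuous h -> measurable_fun setT (fun x => h (sqn x)).
Proof.
move=> ch; apply: (measurableT_comp (continuous_measurable ch)).
exact: measurable_sqn.
Qed.

Lemma radial_Ck h k : smooth1 h -> Ck dirn k (fun x => h (sqn x)).
Proof. by move=> Ch; apply: Ck_comp => //; exact: sqn_Ck. Qed.

Lemma radial_is_derive h dh x j : is_derive (sqn x) 1 h (dh (sqn x)) ->
  is_derive x ('e_j : T) (fun x => h (sqn x)) (dh (sqn x) * (2 * x 0 j)).
Proof. by move=> hdh; exact: is_derive_comp_dir hdh (sqn_is_derive x j). Qed.

(** [radial1] and [radial2] are the coefficients that appear when [q <e, u>] and [m <e, g>] are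
    expanded in coordinates; the primed versions are their partial derivatives in direction [i]. *)
Definition radial1 h (j : 'I_n) x := h (sqn x) * x 0 j.
Definition radial1' h dh (j i : 'I_n) x :=
  h (sqn x) * (j == i)%:R + x 0 j * (dh (sqn x) * (2 * x 0 i)).

Definition radial2 h (l k : 'I_n) x := radial1 h l x * x 0 k.
Definition radial2' h dh (l k i : 'I_n) x :=
  radial1 h l x * (k == i)%:R + x 0 k * radial1' h dh l i x.

Variable r : R.
Hypothesis r_ge0 : 0 <= r.
Variables h dh : R -> R.
Hypothesis Ch : smooth1 h.
Hypothesis hdh : forall s : R, is_derive s 1 h (dh s).
Hypothesis h0 : forall s : R, r ^+ 2 < s -> h s = 0.

Lemma notin_cball x : ~ cball r x -> r ^+ 2 < sqn x.
Proof. by rewrite /cball /= => /negP; rewrite -ltNge. Qed.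

Lemma radial1_weight j : weight r (radial1 h j).
Proof.
split.
- by move=> k; apply: CkM; [exact: radial_Ck|exact: Ck_coord].
- by move=> x /notin_cball xr; rewrite /radial1 h0// mul0r.
- apply: measurable_funM; last exact: measurable_rV_coord.
  by apply: measurable_radial; exact: smooth1_continuous.
Qed.

Lemma radial1_is_derive j i x :
  is_derive x ('e_i : T) (radial1 h j) (radial1' h dh j i x).
Proof.
exact: (is_derive_eq (is_deriveM (radial_is_derive i (hdh (sqn x))) (coord_is_derive j i x))).
Qed.

Lemma measurable_radial1' j i : measurable_fun setT (radial1' h dh j i).
Proof.
have mh := measurable_radial (smooth1_continuous Ch).
have mh' := measurable_radial (smooth1_derive_continuous Ch hdh).
have mc k := @measurable_rV_coord R n k.
by apply: measurable_funD; do ?apply: measurable_funM.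
Qed.

Lemma radial2_weight l k : weight r (radial2 h l k).
Proof.
have [C z m] := radial1_weight l; split.
- by move=> k'; apply: CkM; [exact: C|exact: Ck_coord].
- by move=> x xr; rewrite /radial2 z// mul0r.
- by apply: measurable_funM => //; exact: measurable_rV_coord.
Qed.

Lemma radial2_is_derive l k i x :
  is_derive x ('e_i : T) (radial2 h l k) (radial2' h dh l k i x).
Proof.
exact: (is_derive_eq (is_deriveM (radial1_is_derive l i x) (coord_is_derive k i x))).
Qed.

Lemma measurable_radial2' l k i : measurable_fun setT (radial2' h dh l k i).
Proof.
have [_ _ m] := radial1_weight l; have m' := measurable_radial1' l i.
have mc k' := @measurable_rV_coord R n k'.
by apply: measurable_funD; apply: measurable_funM.
Qed.

End radial_weights.

Section weighted_integrability.
Context {R : realType} {n : nat}.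
Local Notation T := 'rV[R]_n.
Local Notation mu := (lebesgue_rV n : {sigma_finite_measure set 'rV[R]_n -> \bar R}).

(** What integrability alone requires of a weight; indicators of subsets of the ball qualify as
    well. *)
Definition bweight (r : R) (b : T -> R) := [/\ measurable_fun setT b,
  forall x, ~ cball r x -> b x = 0 & exists2 M : R, 0 <= M & forall x, `|b x| <= M].

Lemma weight_bweight (r : R) b : 0 <= r -> weight r b -> bweight r b.
Proof. by move=> r0 wb; have [_ b0 mb] := wb; split=> //; exact: weight_bounded wb. Qed.

Lemma radial_bweight (r : R) (h : R -> R) : 0 <= r -> continuous h ->
  (forall s, r ^+ 2 < s -> h s = 0) -> bweight r (fun x : T => h (sqn x)).
Proof.
move=> r0 ch h0; split; first exact: measurable_radial.
  by move=> x /notin_cball xr; rewrite h0.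
have ch' : {within `[0, r ^+ 2], continuous (fun s => `|h s|)}.
  apply: continuous_subspaceT => s; apply: continuous_comp; first exact: ch.
  exact: norm_continuous.
have [|c _ hc] := EVT_max _ ch'; first by rewrite sqr_ge0.
exists `|h c| => // x; have [sr|rs] := leP (sqn x) (r ^+ 2); last by rewrite h0 ?normr0.
by apply: hc; rewrite in_itv/= sqn_ge0.
Qed.

Variables (rho r : R).
Hypotheses (r_ge0 : 0 <= r) (r_rho : r < rho).

Lemma intg_bweight (b f g : T -> R) : bweight r b -> L2loc_real rho f -> L2loc_real rho g ->
  intg mu (fun x => b x * (f x * g x)).
Proof.
move=> [mb b0 [M M0 bM]] Lf Lg.
have [mf f2] := Lf r r_ge0 r_rho; have [mg g2] := Lg r r_ge0 r_rho.
rewrite (_ : (fun _ => _) = fun x => b x * (cut r f x * cut r g x)); last first.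
  apply/funext => x; have [xr|xr] := pselect (cball r x); first by rewrite !cutE.
  by rewrite b0// !mul0r.
apply: (@intg_bound _ _ _ mu _ (fun x => cut r f x * cut r g x) M).
- by apply: measurable_funM => //; exact: measurable_funM.
- by move=> x; rewrite normrM ler_wpM2r.
- exact: intgM_sq.
Qed.

Lemma intg_sum (I : Type) (s : seq I) (f : I -> T -> R) :
  (forall i, intg mu (f i)) -> intg mu (fun x => \sum_(i <- s) f i x).
Proof.
move=> fi; elim: s => [|i s IH].
  rewrite (_ : (fun _ => _) = cst 0); first exact: integrable0.
  by apply/funext => x; rewrite big_nil.
rewrite (_ : (fun _ => _) = fun x => f i x + \sum_(i <- s) f i x); first exact: intgD.
by apply/funext => x; rewrite big_cons.
Qed.

Lemma Rintegral_sum (I : Type) (s : seq I) (f : I -> T -> R) :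
  (forall i, intg mu (f i)) ->
  \int[mu]_x (\sum_(i <- s) f i x) = \sum_(i <- s) \int[mu]_x f i x.
Proof.
move=> fi; elim: s => [|i s IH].
  rewrite big_nil (_ : (fun _ => _) = cst 0); first by rewrite Rintegral_cst// mul0r.
  by apply/funext => x; rewrite big_nil.
rewrite big_cons -IH -(RintegralD measurableT (fi i) (intg_sum s fi)).
by apply: eq_Rintegral => x _; rewrite big_cons.
Qed.

End weighted_integrability.

(** * Spinors as real vectors *)

Section real_coordinates.
Context {R : realType} {N : nat}.
Implicit Types (y z : 'cV[R[i]]_N) (M : 'M[R[i]]_N) (p q : 'I_N * bool) (c : R).

(** Weak derivatives and integration by parts are scalar statements, so a spinor is handled as [2 N]
    real functions. *)
Definition ri z p : R := if p.2 then complex.Im (z p.1 0) else complex.Re (z p.1 0).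

(** The real part of the Hermitian inner product. *)
Definition rdot y z : R := \sum_p ri y p * ri z p.

(** The matrix of [M] as a real linear map in the coordinates [ri]; it is symmetric when [M] is
    Hermitian. *)
Definition rmx M p q : R :=
  let m := M p.1 q.1 in
  match p.2, q.2 with
  | false, true => - complex.Im m
  | true, false => complex.Im m
  | _, _ => complex.Re m
  end.

Lemma ReD (a b : R[i]) : complex.Re (a + b) = complex.Re a + complex.Re b.
Proof. by case: a b => ? ? [? ?]. Qed.

Lemma ImD (a b : R[i]) : complex.Im (a + b) = complex.Im a + complex.Im b.
Proof. by case: a b => ? ? [? ?]. Qed.

Lemma ReM (a b : R[i]) :
  complex.Re (a * b) = complex.Re a * complex.Re b - complex.Im a * complex.Im b.
Proof. by case: a b => ? ? [? ?]. Qed.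

Lemma ImM (a b : R[i]) :
  complex.Im (a * b) = complex.Re a * complex.Im b + complex.Im a * complex.Re b.
Proof. by case: a b => ? ? [? ?]. Qed.

Lemma Re_sum (I : Type) (s : seq I) (F : I -> R[i]) :
  complex.Re (\sum_(i <- s) F i) = \sum_(i <- s) complex.Re (F i).
Proof. by apply: (big_morph _ ReD). Qed.

Lemma Im_sum (I : Type) (s : seq I) (F : I -> R[i]) :
  complex.Im (\sum_(i <- s) F i) = \sum_(i <- s) complex.Im (F i).
Proof. by apply: (big_morph _ ImD). Qed.

Lemma big_pair_bool (F : 'I_N * bool -> R) :
  \sum_p F p = \sum_k (F (k, true) + F (k, false)).
Proof.
transitivity (\sum_(k < N) \sum_(b : bool) F (k, b)).
  by rewrite pair_big; apply: eq_bigr => -[].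
by apply: eq_bigr => k _; rewrite big_bool.
Qed.

Lemma ri_mulmx M z p : ri (M *m z) p = \sum_q rmx M p q * ri z q.
Proof.
rewrite big_pair_bool; case: p => k [] /=; rewrite /ri /= mxE.
  by rewrite Im_sum; apply: eq_bigr => l _; rewrite ImM /rmx.
by rewrite Re_sum; apply: eq_bigr => l _; rewrite ReM /rmx /= mulNr addrC.
Qed.

Lemma riD y z p : ri (y + z) p = ri y p + ri z p.
Proof. by rewrite /ri mxE; case: ifP => _; [exact: ImD|exact: ReD]. Qed.

Lemma riZ c z p : ri (c%:C%C *: z) p = c * ri z p.
Proof.
by rewrite /ri mxE ReM ImM /= !mul0r subr0 addr0; case: ifP.
Qed.

Lemma riN z p : ri (- z) p = - ri z p.
Proof. by rewrite /ri mxE; case: (z _ _) => ? ? /=; case: ifP. Qed.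

Lemma ri0 p : ri 0 p = 0.
Proof. by rewrite /ri mxE; case: ifP. Qed.

Lemma rdotC y z : rdot y z = rdot z y.
Proof. by apply: eq_bigr => p _; rewrite mulrC. Qed.

Lemma rdotDr y z w : rdot y (z + w) = rdot y z + rdot y w.
Proof. by rewrite /rdot -big_split; apply: eq_bigr => p _; rewrite riD mulrDr. Qed.

Lemma rdotDl y z w : rdot (z + w) y = rdot z y + rdot w y.
Proof. by rewrite rdotC rdotDr !(rdotC y). Qed.

Lemma rdotZr c y z : rdot y (c%:C%C *: z) = c * rdot y z.
Proof.
by rewrite /rdot mulr_sumr; apply: eq_bigr => p _; rewrite riZ mulrCA.
Qed.

Lemma rdotZl c y z : rdot (c%:C%C *: y) z = c * rdot y z.
Proof. by rewrite rdotC rdotZr rdotC. Qed.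

Lemma rdotNr y z : rdot y (- z) = - rdot y z.
Proof. by rewrite /rdot -sumrN; apply: eq_bigr => p _; rewrite riN mulrN. Qed.

Lemma rdotNl y z : rdot (- y) z = - rdot y z.
Proof. by rewrite rdotC rdotNr rdotC. Qed.

Lemma rdot0r y : rdot y 0 = 0.
Proof. by apply: big1 => p _; rewrite ri0 mulr0. Qed.

Lemma rdot_sumr (I : Type) (s : seq I) y (F : I -> 'cV[R[i]]_N) :
  rdot y (\sum_(i <- s) F i) = \sum_(i <- s) rdot y (F i).
Proof. by apply: (big_morph _ (rdotDr y) (rdot0r y)). Qed.

Lemma rdot_suml (I : Type) (s : seq I) y (F : I -> 'cV[R[i]]_N) :
  rdot (\sum_(i <- s) F i) y = \sum_(i <- s) rdot (F i) y.
Proof. by rewrite rdotC rdot_sumr; apply: eq_bigr => i _; rewrite rdotC. Qed.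

Lemma rdot_ge0 y : 0 <= rdot y y.
Proof. by apply: sumr_ge0 => p _; rewrite -expr2 sqr_ge0. Qed.

Lemma rdotE y z : rdot y z = \sum_k (complex.Re (y k 0) * complex.Re (z k 0) +
                                  complex.Im (y k 0) * complex.Im (z k 0)).
Proof. by rewrite /rdot big_pair_bool; apply: eq_bigr => k _; rewrite /ri/= addrC. Qed.

Lemma cnorm_rdot z : cnorm z ^+ 2 = rdot z z.
Proof.
have E : \sum_(k < N) (complex.Re (z k 0) ^+ 2 + complex.Im (z k 0) ^+ 2) = rdot z z.
  by rewrite rdotE; apply: eq_bigr => k _; rewrite -!expr2.
by rewrite /cnorm E sqr_sqrtr// rdot_ge0.
Qed.

Lemma rdot_mulmx y M z : rdot y (M *m z) = \sum_p \sum_q rmx M p q * (ri y p * ri z q).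
Proof.
apply: eq_bigr => p _; rewrite ri_mulmx mulr_sumr; apply: eq_bigr => q _.
by rewrite mulrCA.
Qed.

Lemma rdot_herm y M z : M \is hermsymmx -> rdot y (M *m z) = rdot (M *m y) z.
Proof.
move=> /is_hermitianmxP; rewrite expr0 scale1r => ME.
have sym p q : rmx M p q = rmx M q p.
  rewrite /rmx ME !mxE.
  have -> : M q.1 p.1 = (M p.1 q.1)^*%C by rewrite {1}ME !mxE.
  by case: p q => k [] [l []] /=; case: (M k l) => a b /=; rewrite ?opprK.
rewrite rdot_mulmx rdotC rdot_mulmx exchange_big/=.
by apply: eq_bigr => p _; apply: eq_bigr => q _; rewrite sym (mulrC (ri y _)).
Qed.

(* [|y + z|^2 >= 4 <y, z>] because [|y - z|^2 >= 0]. *)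
Lemma rdot_polarization y z : 4 * rdot y z <= rdot (y + z) (y + z).
Proof.
have := rdot_ge0 (y - z).
rewrite !rdotDl !rdotDr !rdotNl !rdotNr (rdotC z y); lra.
Qed.

End real_coordinates.

(** * Clifford relations and the radial-angular splitting *)

Section clifford_algebra.
Context {R : realType} {n N : nat}.
Variable a : 'I_n -> 'M[R[i]]_N.
Hypothesis a_herm : forall j, a j \is hermsymmx.
Hypothesis a_anti : forall j k, a j *m a k + a k *m a j = (2 * (j == k)%:R)%:M.
Implicit Types (x : 'rV[R]_n) (y z U : 'cV[R[i]]_N) (V : 'I_n -> 'cV[R[i]]_N).

(* By the anticommutation relations, [(a_k a_j - a_j a_k) / 2]. *)
Definition spin (k j : 'I_n) : 'M[R[i]]_N := a k *m a j - ((k == j)%:R)%:M.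

Lemma spin_antisym k j : spin j k = - spin k j.
Proof.
have := a_anti k j; rewrite /spin (eq_sym j k) => /(canRL (addKr _)) ->.
by rewrite opprB mulr_natl mulr2n raddfD/= -addrA addrK addrC.
Qed.

Lemma rdot_delta (b : bool) y z : rdot y (((b%:R)%:M : 'M[R[i]]_N) *m z) = b%:R * rdot y z.
Proof.
rewrite mul_scalar_mx; case: b; first by rewrite scale1r mul1r.
by rewrite scale0r rdot0r mul0r.
Qed.

Lemma rdot_deltal (b : bool) y z : rdot (((b%:R)%:M : 'M[R[i]]_N) *m y) z = b%:R * rdot y z.
Proof. by rewrite rdotC rdot_delta rdotC. Qed.

(** Moving the two Hermitian factors to the other side reverses their order, which gives [spin j k],
    and this is [- spin k j]. *)
Lemma spin_skew k j y z : rdot y (spin k j *m z) = - rdot (spin k j *m y) z.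
Proof.
rewrite -[in RHS](opprK (spin k j)) -spin_antisym mulNmx rdotNl opprK /spin.
rewrite !mulmxBl rdotDr rdotDl rdotNr rdotNl.
rewrite -!mulmxA (rdot_herm y (a j *m z) (a_herm k)) (rdot_herm _ z (a_herm j)).
by rewrite rdot_delta rdot_deltal (eq_sym j).
Qed.

Definition euler x V : 'cV[R[i]]_N := \sum_j (x 0 j)%:C%C *: V j.
Definition angular x V : 'cV[R[i]]_N := \sum_k \sum_j (x 0 k)%:C%C *: (spin k j *m V j).
Definition clif x z : 'cV[R[i]]_N := \sum_k (x 0 k)%:C%C *: (a k *m z).

(** [a_k a_j] is the sum of its symmetric part, the Kronecker delta, and its antisymmetric part
    [spin k j]; the delta contracts to [euler]. *)
Lemma euler_angular x V : euler x V + angular x V = clif x (\sum_j a j *m V j).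
Proof.
rewrite /euler /angular /clif -big_split/=; apply: eq_bigr => k _.
rewrite mulmx_sumr scaler_sumr.
have -> : \sum_j (x 0 k)%:C%C *: (a k *m (a j *m V j)) =
    \sum_j ((x 0 k)%:C%C *: (((k == j)%:R)%:M *m V j) + (x 0 k)%:C%C *: (spin k j *m V j)).
  apply: eq_bigr => j _; rewrite -scalerDr -mulmxDl mulmxA; congr (_ *: (_ *m _)).
  by rewrite /spin addrC subrK.
rewrite big_split/=; congr (_ + _).
rewrite (bigD1 k)//= eqxx mul1mx big1 ?addr0// => j /negbTE jk.
by rewrite eq_sym jk (_ : _%:M = 0) ?mul0mx ?scaler0//; exact: raddf0.
Qed.

Lemma clif_norm x z : rdot (clif x z) (clif x z) = (\sum_i x 0 i ^+ 2) * rdot z z.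
Proof.
pose B k l := rdot (a k *m z) (a l *m z).
have BE k l : B k l + B l k = 2 * ((k == l)%:R * rdot z z).
  rewrite /B -(rdot_herm z (a l *m z) (a_herm k)) -(rdot_herm z (a k *m z) (a_herm l)).
  rewrite -rdotDr !mulmxA -mulmxDl a_anti mulr_natl mulr2n raddfD/= mulmxDl rdotDr.
  by rewrite rdot_delta; ring.
have S : rdot (clif x z) (clif x z) = \sum_k \sum_l x 0 k * x 0 l * B k l.
  rewrite /clif rdot_suml; apply: eq_bigr => k _; rewrite rdot_sumr.
  by apply: eq_bigr => l _; rewrite rdotZl rdotZr mulrA.
(* Doubling allows the double sum to be added to its transpose, so that the anticommutator acts on
   each pair of indices. *)
have : 2 * rdot (clif x z) (clif x z) = 2 * ((\sum_i x 0 i ^+ 2) * rdot z z).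
  rewrite mulr_natl mulr2n {1}S {1}exchange_big S -big_split/= mulr_suml mulr_sumr.
  apply: eq_bigr => k _; rewrite -big_split/=.
  rewrite (eq_bigr (fun l => x 0 k * x 0 l * (2 * ((k == l)%:R * rdot z z)))).
    rewrite (bigD1 k)//= eqxx big1 ?addr0 ?mulr1n; first by ring.
    by move=> l lk; rewrite eq_sym (negbTE lk) mulr0n; ring.
  by move=> l _; rewrite -BE; ring.
by move/mulfI; apply.
Qed.

End clifford_algebra.

(** With [m] and [dm] the values at [|x|^2] of a radial weight and of its derivative, [d l k i] is
    the [i]-th derivative of [m(|x|^2) x_l x_k]; in the application [W k j l] is
    [<u, spin k j V_l>]. Antisymmetry kills every contraction of [W] with [x_k x_j] or with a delta
    in [k, j], so a single sum survives. *)
Lemma radial_divergence {R : realType} {n : nat} (x : 'I_n -> R) (m dm : R)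
    (W : 'I_n -> 'I_n -> 'I_n -> R) : (forall k j l, W j k l = - W k j l) ->
  let d l k i := m * x l * (k == i)%:R + x k * (m * (l == i)%:R + x l * (dm * (2 * x i))) in
  \sum_l \sum_k \sum_j (d l k j * W k j l - d l k l * W k j j) =
  - (2 * (\sum_i x i ^+ 2) * dm + n%:R * m) * \sum_k \sum_j x k * W k j j.
Proof.
move=> Wa d.
have W0 k l : W k k l = 0 by have := Wa k k l; lra.
have anti l : \sum_k \sum_j x k * x j * W k j l = 0.
  have : \sum_k \sum_j x k * x j * W k j l = - \sum_k \sum_j x k * x j * W k j l.
    rewrite {1}exchange_big/= -sumrN; apply: eq_bigr => k _; rewrite -sumrN.
    by apply: eq_bigr => j _; rewrite Wa; ring.
  by lra.
have first : \sum_l \sum_k \sum_j d l k j * W k j l = m * \sum_k \sum_j x k * W k j j.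
  transitivity (\sum_l (\sum_k x k * (m * W k l l) + 2 * dm * x l * \sum_k \sum_j x k * x j * W k j l)).
    apply: eq_bigr => l _; rewrite mulr_sumr -big_split/=; apply: eq_bigr => k _.
    rewrite mulr_sumr (eq_bigr (fun j => (x k * m * (l == j)%:R * W k j l) +
       (m * x l * (k == j)%:R * W k j l + 2 * dm * x l * (x k * x j * W k j l)))); last first.
      by move=> j _; rewrite /d; ring.
    rewrite big_split/= big_split/= addrA; congr (_ + _).
    rewrite [X in _ + X]big1 ?addr0; last first.
      by move=> j _; have [->|_] := eqVneq k j; rewrite ?W0 ?mulr0n; ring.
    rewrite (bigD1 l)//= eqxx big1 ?addr0 ?mulr1n; first by ring.
    by move=> j jl; rewrite eq_sym (negbTE jl) mulr0n; ring.
  under eq_bigr do rewrite anti mulr0 addr0.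
  rewrite exchange_big/= mulr_sumr; apply: eq_bigr => k _; rewrite mulr_sumr.
  by apply: eq_bigr => j _; ring.
have dsum k : \sum_l d l k l = (m + n%:R * m + 2 * (\sum_i x i ^+ 2) * dm) * x k.
  rewrite (eq_bigr (fun l => m * x l * (k == l)%:R + (m * x k + 2 * dm * x k * x l ^+ 2))); last first.
    by move=> l _; rewrite /d eqxx mulr1n; ring.
  have t1 : \sum_l m * x l * (k == l)%:R = m * x k.
    rewrite (bigD1 k)//= eqxx big1 ?addr0 ?mulr1n; first by ring.
    by move=> l lk; rewrite eq_sym (negbTE lk) mulr0n; ring.
  have t2 : \sum_(l < n) m * x k = n%:R * (m * x k).
    by rewrite sumr_const card_ord -[LHS]mulr_natl.
  have t3 : \sum_l 2 * dm * x k * x l ^+ 2 = 2 * dm * x k * \sum_l x l ^+ 2.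
    by rewrite mulr_sumr.
  by rewrite !big_split/= t1 t2 t3; ring.
have second : \sum_l \sum_k \sum_j d l k l * W k j j =
    (m + n%:R * m + 2 * (\sum_i x i ^+ 2) * dm) * \sum_k \sum_j x k * W k j j.
  rewrite exchange_big/= mulr_sumr; apply: eq_bigr => k _.
  rewrite exchange_big/= mulr_sumr; apply: eq_bigr => j _.
  by rewrite -mulr_suml dsum; ring.
transitivity (\sum_l \sum_k \sum_j d l k j * W k j l - \sum_l \sum_k \sum_j d l k l * W k j j).
  rewrite -sumrB; apply: eq_bigr => l _; rewrite -sumrB; apply: eq_bigr => k _.
  by rewrite -sumrB.
by rewrite first second; ring.
Qed.

Lemma triple_sum_lin {R : realType} {n : nat} (A B : 'I_n -> 'I_n -> 'I_n -> R) (c : R) :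
  \sum_l \sum_k \sum_j (A l k j + c * B l k j) =
  \sum_l \sum_k \sum_j A l k j + c * \sum_l \sum_k \sum_j B l k j.
Proof.
rewrite mulr_sumr -big_split/=; apply: eq_bigr => l _.
rewrite mulr_sumr -big_split/=; apply: eq_bigr => k _.
by rewrite mulr_sumr -big_split/=.
Qed.

(** * The Carleman inequality *)

Section carleman_identity.
Context {R : realType} {n N : nat}.
Local Notation T := 'rV[R]_n.
Local Notation mu := (lebesgue_rV n : {sigma_finite_measure set 'rV[R]_n -> \bar R}).
Local Notation spinor := 'cV[R[i]]_N.
Variables (rho r : R).
Hypotheses (r_ge0 : 0 <= r) (r_rho : r < rho).
Implicit Types (Y Z : T -> spinor) (b : T -> R).

Definition L2v Y := forall p, L2loc_real rho (fun x => ri (Y x) p).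

Lemma int_rdot_mulmx b Y Z (M : 'M[R[i]]_N) : bweight r b -> L2v Y -> L2v Z ->
  intg mu (fun x => b x * rdot (Y x) (M *m Z x)) /\
  \int[mu]_x (b x * rdot (Y x) (M *m Z x)) =
  \sum_p \sum_q rmx M p q * \int[mu]_x (b x * (ri (Y x) p * ri (Z x) q)).
Proof.
move=> wb LY LZ.
have E x : b x * rdot (Y x) (M *m Z x) =
    \sum_p \sum_q rmx M p q * (b x * (ri (Y x) p * ri (Z x) q)).
  rewrite rdot_mulmx mulr_sumr; apply: eq_bigr => p _; rewrite mulr_sumr.
  by apply: eq_bigr => q _; rewrite mulrCA.
have i0 p q : intg mu (fun x => b x * (ri (Y x) p * ri (Z x) q)).
  exact: (intg_bweight r_ge0 r_rho).
have i1 p q := intgZ (rmx M p q) (i0 p q).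
have i2 p : intg mu (fun x => \sum_q rmx M p q * (b x * (ri (Y x) p * ri (Z x) q))).
  exact: intg_sum.
have -> : (fun x => b x * rdot (Y x) (M *m Z x)) = fun x =>
    \sum_p \sum_q rmx M p q * (b x * (ri (Y x) p * ri (Z x) q)).
  by apply/funext.
split; first exact: intg_sum.
rewrite Rintegral_sum//; apply: eq_bigr => p _; rewrite Rintegral_sum//.
by apply: eq_bigr => q _; rewrite -(RintegralZl _ measurableT (i0 p q)).
Qed.

Lemma int_rdot b Y Z : bweight r b -> L2v Y -> L2v Z ->
  intg mu (fun x => b x * rdot (Y x) (Z x)) /\
  \int[mu]_x (b x * rdot (Y x) (Z x)) =
  \sum_p \int[mu]_x (b x * (ri (Y x) p * ri (Z x) p)).
Proof.
move=> wb LY LZ.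
have i0 p : intg mu (fun x => b x * (ri (Y x) p * ri (Z x) p)).
  exact: (intg_bweight r_ge0 r_rho).
have -> : (fun x => b x * rdot (Y x) (Z x)) = fun x =>
    \sum_p b x * (ri (Y x) p * ri (Z x) p).
  by apply/funext => x; rewrite /rdot mulr_sumr.
by split; [exact: intg_sum|rewrite Rintegral_sum].
Qed.

Variables (U : T -> spinor) (V : 'I_n -> T -> spinor).
Hypothesis UV : forall p, weakly_derivable rho (fun x => ri (U x) p) (fun j x => ri (V j x) p).

Lemma L2v_U : L2v U. Proof. by move=> p; case: (UV p). Qed.
Lemma L2v_V j : L2v (V j). Proof. by move=> p; case: (UV p). Qed.

Lemma rdot_null_lagrangian b b1 b2 i l (M : 'M[R[i]]_N) : weight r b ->
  (forall x, is_derive x ('e_i : T) b (b1 x)) -> measurable_fun setT b1 ->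
  (forall x, is_derive x ('e_l : T) b (b2 x)) -> measurable_fun setT b2 ->
  \int[mu]_x (b x * rdot (V i x) (M *m V l x)) - \int[mu]_x (b x * rdot (V l x) (M *m V i x)) =
  \int[mu]_x (b2 x * rdot (U x) (M *m V i x)) - \int[mu]_x (b1 x * rdot (U x) (M *m V l x)).
Proof.
move=> wb db1 mb1 db2 mb2.
have LU := L2v_U; have LV := L2v_V.
have bb := weight_bweight r_ge0 wb.
have bb1 := weight_bweight r_ge0 (weight_derive r_ge0 wb db1 mb1).
have bb2 := weight_bweight r_ge0 (weight_derive r_ge0 wb db2 mb2).
rewrite (int_rdot_mulmx M bb (LV i) (LV l)).2 (int_rdot_mulmx M bb (LV l) (LV i)).2.
rewrite (int_rdot_mulmx M bb2 LU (LV i)).2 (int_rdot_mulmx M bb1 LU (LV l)).2.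
rewrite -!sumrB; apply: eq_bigr => p _; rewrite -!sumrB; apply: eq_bigr => q _.
rewrite -!mulrBr; congr (_ * _).
exact: (weak_null_lagrangian r_ge0 r_rho (UV p) (UV q) wb db1 mb1 db2 mb2).
Qed.

Lemma rdot_product_rule b db j : weight r b ->
  (forall x, is_derive x ('e_j : T) b (db x)) -> measurable_fun setT db ->
  2 * \int[mu]_x (b x * rdot (V j x) (U x)) = - \int[mu]_x (db x * rdot (U x) (U x)).
Proof.
move=> wb hdb mdb; have LU := L2v_U; have LV := L2v_V.
have bb := weight_bweight r_ge0 wb.
have bb' := weight_bweight r_ge0 (weight_derive r_ge0 wb hdb mdb).
rewrite (int_rdot bb (LV j) LU).2 (int_rdot bb' LU LU).2 mulr_sumr -sumrN.
apply: eq_bigr => p _.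
rewrite -(weak_product_rule r_ge0 r_rho (UV p) (UV p) wb hdb mdb) mulr_natl mulr2n.
by congr (_ + _); apply: eq_Rintegral => x _; rewrite (mulrC (ri (V j x) p)).
Qed.

Variable a : 'I_n -> 'M[R[i]]_N.
Hypothesis a_herm : forall j, a j \is hermsymmx.
Hypothesis a_anti : forall j k, a j *m a k + a k *m a j = (2 * (j == k)%:R)%:M.

Variables m dm q dq pm : R -> R.
Hypotheses (Cm : smooth1 m) (hdm : forall s : R, is_derive s 1 m (dm s)).
Hypotheses (Cq : smooth1 q) (hdq : forall s : R, is_derive s 1 q (dq s)).
Hypothesis pm_cont : continuous pm.
Hypotheses (m_supp : forall s, r ^+ 2 < s -> m s = 0) (q_supp : forall s, r ^+ 2 < s -> q s = 0)
  (pm_supp : forall s, r ^+ 2 < s -> pm s = 0).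
Hypothesis m_ge0 : forall s, 0 <= m s.
Hypothesis q_def : forall s, s * dm s = q s - n%:R / 2 * m s.

(** The divergence of the field [q(|x|^2) x] is [kap + pm]. Where [m] does not vanish, with
    [c = q / m] as in the overview, [kap] is [2 c^2 m], which leaves [m] times [x . grad psi] for
    [pm]. The hypotheses avoid the quotient because [m] has zeros. *)
Definition kap (s : R) := n%:R * q s + 2 * s * dq s - pm s.

Hypothesis m_kap : forall s, m s * kap s = 2 * q s ^+ 2.
Hypothesis m_eq0 : forall s, m s = 0 -> q s = 0 /\ kap s = 0.

Let e x := euler x (fun j => V j x).
Let g x := angular a x (fun j => V j x).

Lemma dq_supp s : r ^+ 2 < s -> dq s = 0.
Proof.
move=> rs; have [_ <-] := hdq s; rewrite (@near_eq_derive _ _ _ _ (cst 0)) ?derive_cst//.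
by near=> t; apply: q_supp; near: t; exact: lt_nbhsr.
Unshelve. all: by end_near. Qed.

Lemma bweight_kap : bweight r (fun x : T => kap (sqn x)).
Proof.
apply: (radial_bweight (h := kap)) => //; last first.
  by move=> s rs; rewrite /kap q_supp// dq_supp// pm_supp// !mulr0 addr0 subr0.
have cq := smooth1_continuous Cq; have cdq := smooth1_derive_continuous Cq hdq.
move=> s; apply: cvgB; last exact: pm_cont.
apply: cvgD; first by apply: cvgMr; exact: cq.
apply: cvgM; last exact: cdq.
by apply: cvgMr; exact: cvg_id.
Qed.

Lemma bweight_pm : bweight r (fun x : T => pm (sqn x)).
Proof. exact: (radial_bweight (h := pm)). Qed.

(** Term by term this is [rdot_null_lagrangian] in directions [l] and [j] with weight [m x_l x_k]
    and matrix [spin k j]. Skewness makes its two quadratic terms opposite, so their difference is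
    twice one of them; this is the origin of the factor [2^-1] in [t]. By [radial_divergence] the
    first-order terms sum to [q <u, g>]. *)
Lemma int_null_form :
  intg mu (fun x => m (sqn x) * rdot (e x) (g x) + q (sqn x) * rdot (U x) (g x)) /\
  \int[mu]_x (m (sqn x) * rdot (e x) (g x) + q (sqn x) * rdot (U x) (g x)) = 0.
Proof.
have LU := L2v_U; have LV := L2v_V.
pose b l k (x : T) := radial2 m l k x.
pose db l k i (x : T) := radial2' m dm l k i x.
have wb l k : weight r (b l k) by exact: (radial2_weight Cm m_supp).
have hdb l k i x : is_derive x ('e_i : T) (b l k) (db l k i x) by exact: (radial2_is_derive hdm).
have mdb l k i : measurable_fun setT (db l k i) by exact: (measurable_radial2' Cm hdm m_supp).
have bb l k := weight_bweight r_ge0 (wb l k).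
have bdb l k i := weight_bweight r_ge0 (weight_derive r_ge0 (wb l k) (hdb l k i) (mdb l k i)).
pose t l k j (x : T) := b l k x * rdot (V l x) (spin a k j *m V j x) +
  2^-1 * (db l k l x * rdot (U x) (spin a k j *m V j x) + (- 1) * (db l k j x * rdot (U x) (spin a k j *m V l x))).
have i1 l k j := (int_rdot_mulmx (spin a k j) (bb l k) (LV l) (LV j)).1.
have i2 l k j := (int_rdot_mulmx (spin a k j) (bdb l k l) LU (LV j)).1.
have i3 l k j := (int_rdot_mulmx (spin a k j) (bdb l k j) LU (LV l)).1.
have i23 l k j := intgD (i2 l k j) (intgZ (- 1) (i3 l k j)).
have it l k j : intg mu (t l k j) by apply: intgD; [exact: i1|apply: intgZ; exact: i23].
have t0 l k j : \int[mu]_x t l k j x = 0.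
  rewrite /t (RintegralD measurableT (i1 l k j) (intgZ _ (i23 l k j))).
  rewrite (RintegralZl _ measurableT (i23 l k j)).
  rewrite (RintegralD measurableT (i2 l k j) (intgZ _ (i3 l k j))).
  rewrite (RintegralZl _ measurableT (i3 l k j)).
  have := rdot_null_lagrangian (spin a k j) (wb l k) (hdb l k l) (mdb l k l) (hdb l k j) (mdb l k j).
  have -> : \int[mu]_x (b l k x * rdot (V j x) (spin a k j *m V l x)) =
     - \int[mu]_x (b l k x * rdot (V l x) (spin a k j *m V j x)).
    rewrite -mulN1r -(RintegralZl _ measurableT (i1 l k j)); apply: eq_Rintegral => x _.
    by rewrite (spin_skew a_herm a_anti) rdotC; ring.
  set I1 := Rintegral _ _ _; set I2 := Rintegral _ _ _; set I3 := Rintegral _ _ _; lra.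
have E x : m (sqn x) * rdot (e x) (g x) + q (sqn x) * rdot (U x) (g x) =
    \sum_l \sum_k \sum_j t l k j x.
  pose W k j l := rdot (U x) (spin a k j *m V l x).
  have Wa k j l : W j k l = - W k j l by rewrite /W (spin_antisym a_anti) mulNmx rdotNr.
  have gE : rdot (U x) (g x) = \sum_k \sum_j x 0 k * W k j j.
    rewrite /g /angular rdot_sumr; apply: eq_bigr => k _; rewrite rdot_sumr.
    by apply: eq_bigr => j _; rewrite rdotZr.
  have egE : m (sqn x) * rdot (e x) (g x) =
      \sum_l \sum_k \sum_j b l k x * rdot (V l x) (spin a k j *m V j x).
    rewrite /e /euler rdot_suml mulr_sumr; apply: eq_bigr => l _.
    rewrite rdotZl /g /angular rdot_sumr mulrA mulr_sumr; apply: eq_bigr => k _.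
    rewrite rdot_sumr mulr_sumr; apply: eq_bigr => j _.
    by rewrite rdotZr /b /radial2 /radial1; ring.
  have := radial_divergence (fun i => x 0 i) (m (sqn x)) (dm (sqn x)) Wa.
  rewrite -gE -/(sqn x) => /= D.
  have qE : q (sqn x) = 2^-1 * (2 * sqn x * dm (sqn x) + n%:R * m (sqn x)).
    by rewrite -mulrA q_def; field.
  transitivity (\sum_l \sum_k \sum_j (b l k x * rdot (V l x) (spin a k j *m V j x) +
     (- 2^-1) * (db l k j x * W k j l - db l k l x * W k j j))); last first.
    apply: eq_bigr => l _; apply: eq_bigr => k _; apply: eq_bigr => j _.
    by rewrite /t /W; ring.
  rewrite triple_sum_lin -egE; congr (_ + _).
  rewrite [X in _ = _ * X](_ : _ = - (2 * sqn x * dm (sqn x) + n%:R * m (sqn x)) * rdot (U x) (g x)).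
    by rewrite qE; ring.
  exact: D.
have -> : (fun x => m (sqn x) * rdot (e x) (g x) + q (sqn x) * rdot (U x) (g x)) =
   fun x => \sum_l \sum_k \sum_j t l k j x by apply/funext.
split; first by do 3!apply: intg_sum => ?; exact: it.
rewrite Rintegral_sum; last by move=> l; do 2!apply: intg_sum => ?; exact: it.
apply: big1 => l _; rewrite Rintegral_sum; last by move=> k; apply: intg_sum => ?; exact: it.
apply: big1 => k _; rewrite Rintegral_sum; last by move=> j; exact: it.
by apply: big1 => j _; exact: t0.
Qed.

(** The product rule for [|u|^2] against the vector field [q(|x|^2) x]. *)
Lemma int_euler_form :
  intg mu (fun x => q (sqn x) * rdot (e x) (U x)) /\
  2 * \int[mu]_x (q (sqn x) * rdot (e x) (U x)) =
  - \int[mu]_x ((kap (sqn x) + pm (sqn x)) * rdot (U x) (U x)).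
Proof.
have LU := L2v_U; have LV := L2v_V.
have wb j : weight r (radial1 q j : T -> R) by exact: (radial1_weight Cq q_supp).
have hdb j i x : is_derive x ('e_i : T) (radial1 q j) (radial1' q dq j i x) by exact: (radial1_is_derive hdq).
have mdb j i : measurable_fun setT (radial1' q dq j i : T -> R) by exact: (measurable_radial1' Cq hdq).
have bb j := weight_bweight r_ge0 (wb j).
have bdb j := weight_bweight r_ge0 (weight_derive r_ge0 (wb j) (hdb j j) (mdb j j)).
have i1 j := (int_rdot (bb j) (LV j) LU).1.
have i2 j := (int_rdot (bdb j) LU LU).1.
have E x : q (sqn x) * rdot (e x) (U x) = \sum_j radial1 q j x * rdot (V j x) (U x).
  rewrite /e /euler rdot_suml mulr_sumr; apply: eq_bigr => j _.
  by rewrite rdotZl /radial1 mulrA.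
have E2 x : (kap (sqn x) + pm (sqn x)) * rdot (U x) (U x) =
    \sum_j radial1' q dq j j x * rdot (U x) (U x).
  rewrite -mulr_suml; congr (_ * _); rewrite /kap subrK /radial1'.
  rewrite (eq_bigr (fun j => q (sqn x) + 2 * dq (sqn x) * (x 0 j ^+ 2))).
    rewrite big_split/= sumr_const card_ord -mulr_sumr -/(sqn x) -[_ *+ n]mulr_natl; ring.
  by move=> j _; rewrite eqxx mulr1n; ring.
have -> : (fun x => q (sqn x) * rdot (e x) (U x)) = fun x => \sum_j radial1 q j x * rdot (V j x) (U x).
  exact/funext.
split; first exact: intg_sum.
under [in RHS]eq_Rintegral do rewrite E2.
rewrite !Rintegral_sum// mulr_sumr -sumrN; apply: eq_bigr => j _.
exact: rdot_product_rule.
Qed.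

(** Since [|e + g|^2] is [s |sum_j a_j V_j|^2], the integrand is a finite sum of weighted products
    of square integrable functions. *)
Lemma int_full_form : intg mu (fun x => m (sqn x) * rdot (e x + g x) (e x + g x)).
Proof.
have LV := L2v_V.
have bm : bweight r (fun x : T => m (sqn x) * sqn x).
  apply: (radial_bweight (h := fun s => m s * s)) => //.
    move=> s; apply: cvgM; last exact: cvg_id.
    exact: (smooth1_continuous Cm).
  by move=> s rs; rewrite m_supp// mul0r.
rewrite (_ : (fun _ => _) = fun x => \sum_k \sum_j (m (sqn x) * sqn x) * rdot (V k x) ((a k *m a j) *m V j x)).
  apply: intg_sum => k; apply: intg_sum => j.
  exact: (int_rdot_mulmx (a k *m a j) bm (LV k) (LV j)).1.
apply/funext => x; rewrite /e /g euler_angular (clif_norm a_herm a_anti) mulrA -/(sqn x).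
rewrite rdot_suml mulr_sumr; apply: eq_bigr => k _; rewrite rdot_sumr mulr_sumr.
by apply: eq_bigr => j _; rewrite -mulmxA (rdot_herm (V k x) _ (a_herm k)).
Qed.

(** After polarization the null form integrates to zero, [- 4 q <e, u>] contributes
    [2 (kap + pm) |u|^2], and the term in [c^2] takes away [2 kap |u|^2]: only [pm] remains. *)
Lemma carleman_form :
  2 * \int[mu]_x (pm (sqn x) * rdot (U x) (U x)) <=
  \int[mu]_x (m (sqn x) * rdot (e x + g x) (e x + g x)).
Proof.
have LU := L2v_U.
have [i2 e2] := int_null_form; have [i3 e3] := int_euler_form.
have i1 := int_full_form.
have i4 := (int_rdot bweight_kap LU LU).1.
have i5 := (int_rdot bweight_pm LU LU).1.
have e3' : 2 * \int[mu]_x (q (sqn x) * rdot (e x) (U x)) =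
    - (\int[mu]_x (kap (sqn x) * rdot (U x) (U x)) + \int[mu]_x (pm (sqn x) * rdot (U x) (U x))).
  rewrite e3 -(RintegralD measurableT i4 i5); congr (- _).
  by apply: eq_Rintegral => x _; rewrite mulrDl.
have pt x : 4 * (m (sqn x) * rdot (e x) (g x) + q (sqn x) * rdot (U x) (g x)) +
    ((- 4) * (q (sqn x) * rdot (e x) (U x)) + (- 2) * (kap (sqn x) * rdot (U x) (U x))) <=
    m (sqn x) * rdot (e x + g x) (e x + g x).
  have := m_ge0 (sqn x); rewrite le_eqVlt => /orP[/eqP m0|m0].
    (* At a zero of [m] every term vanishes, so no quotient by [m] is formed there. *)
    have [-> ->] := m_eq0 (esym m0); rewrite -m0; lra.
  have kE : kap (sqn x) = 2 * q (sqn x) ^+ 2 / m (sqn x).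
    by rewrite -m_kap mulrC mulKf// gt_eqF.
  pose c := q (sqn x) / m (sqn x).
  have qE : q (sqn x) = c * m (sqn x) by rewrite /c divfK// gt_eqF.
  (* With [c = q / m] the terms containing [g] sum to the null form [m <e, g> + q <U, g>]. *)
  have := rdot_polarization (e x + c%:C%C *: U x) (g x - c%:C%C *: U x).
  rewrite addrACA subrr addr0 => h.
  have := ler_wpM2l (ltW m0) h; apply: le_trans; rewrite le_eqVlt; apply/orP; left; apply/eqP.
  rewrite !rdotDl !rdotDr !rdotNr !rdotZl !rdotZr kE qE; field.
  by rewrite gt_eqF.
have := le_Rintegral measurableT (intgD (intgZ 4 i2) (intgD (intgZ (- 4) i3) (intgZ (- 2) i4))) i1 (fun x _ => pt x).
rewrite (RintegralD measurableT (intgZ 4 i2) (intgD (intgZ (- 4) i3) (intgZ (- 2) i4))).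
rewrite (RintegralD measurableT (intgZ (- 4) i3) (intgZ (- 2) i4)).
rewrite (RintegralZl _ measurableT i2) (RintegralZl _ measurableT i3) (RintegralZl _ measurableT i4).
rewrite e2; move: e3'.
set I1 := Rintegral _ _ _; set I2 := Rintegral _ _ _; set I3 := Rintegral _ _ _; set I4 := Rintegral _ _ _; lra.
Qed.

End carleman_identity.

(* With [phi s = tau s^-a - h s^-2a - 1 / (r^2 - s)] and [nu] the dimension,
   [wm = exp (2 phi)], [wq = (nu / 2) wm + s wm'] and
   [wp = 2 s psi' wm] for [psi = 2 s phi'], all extended by [0] outside [0 < s < r^2].
   The [h]-term makes them smooth at [0]; it is removed at the end. *)
Section carleman_weight.
Context {R : realType}.
Variables (nu a tau h r : R).
Hypotheses (a_gt0 : 0 < a) (h_gt0 : 0 < h).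
Implicit Types c s t : R.

(** On [0 < s < r^2], [inner c] is [s^-c exp (2 tau s^-a - 2 h s^-2a)] and [outer c] is
    [(r^2 - s)^-c exp (- 2 / (r^2 - s))]. The parameter [1 / 2] of [outer] makes the exponent [-2a]
    of [flat] equal to [-1]. *)
Definition inner c s : R := flat a (2 * tau) (2 * h) c s.
Definition outer c s : R := flat (1 / 2) 0 2 c (r ^+ 2 - s).

Lemma inner_ge0 c s : 0 <= inner c s. Proof. exact: flat_ge0. Qed.
Lemma outer_ge0 c s : 0 <= outer c s. Proof. exact: flat_ge0. Qed.
Lemma inner_le0 c s : s <= 0 -> inner c s = 0. Proof. exact: flat_le0. Qed.
Lemma outer_le0 c s : r ^+ 2 <= s -> outer c s = 0.
Proof. by move=> rs; rewrite /outer flat_le0// subr_le0. Qed.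

(** Valid for every real [s], since both sides vanish for [s <= 0]; it absorbs the negative power of
    [s] created by each differentiation. *)
Lemma flatS a' A B c s : s * flat a' A B (c + 1) s = flat a' A B c s.
Proof.
have [s0|s0] := leP s 0; first by rewrite !flat_le0// mulr0.
by rewrite flatD// mulN1r expRN lnK// mulrA mulfV ?mul1r// gt_eqF.
Qed.

Definition inner' c s : R :=
  - c * inner (c + 1) s - a * (2 * tau) * inner (c + a + 1) s
  + 2 * a * (2 * h) * inner (c + 2 * a + 1) s.

Definition outer' c s : R := c * outer (c + 1) s - 2 * outer (c + 2) s.

Lemma inner_is_derive c s : is_derive s 1 (inner c) (inner' c s).
Proof. by apply: flat_is_derive => //; rewrite mulr_gt0. Qed.

Lemma outer_is_derive c s : is_derive s 1 (outer c) (outer' c s).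
Proof.
have half : 0 < 1 / 2 :> R by lra.
have two : 0 < 2 :> R by lra.
have d0 : is_derive s (1 : R) (fun s : R => r ^+ 2 - s) (-1).
  apply: (is_derive_eq (is_deriveB (is_derive_cst (r ^+ 2) s 1) (is_derive_id s 1))).
  by rewrite sub0r.
have d1 := flat_is_derive 0 c (r ^+ 2 - s) half two.
have d2 := @is_derive_comp_dir _ _ (flat (1 / 2) 0 2 c) (fun s : R => r ^+ 2 - s) s 1 _ _ d1 d0.
rewrite (_ : outer c = flat (1 / 2) 0 2 c \o (fun s : R => r ^+ 2 - s))//.
apply: (is_derive_eq d2).
rewrite /outer' /outer (_ : c + 2 * (1 / 2) + 1 = c + 2); last by field.
by field.
Qed.

Lemma smooth1M (f g : R -> R) : smooth1 f -> smooth1 g -> smooth1 (fun s => f s * g s).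
Proof. by move=> Cf Cg k; exact: CkM. Qed.

Lemma smooth1D (f g : R -> R) : smooth1 f -> smooth1 g -> smooth1 (fun s => f s + g s).
Proof. by move=> Cf Cg k; exact: CkD. Qed.

Lemma smooth1Z c (f : R -> R) : smooth1 f -> smooth1 (fun s => c * f s).
Proof. by move=> Cf k; exact: CkZ. Qed.

Lemma smooth1_id : smooth1 (fun s : R => s).
Proof. by move=> k; apply: (@Ck_affine _ _ _ _ _ _ (fun=> 1)) => // x; exact: cvg_id. Qed.

Lemma inner_smooth c : smooth1 (inner c).
Proof. by move=> k; apply: flat_Ck => //; rewrite mulr_gt0. Qed.

Lemma outer_smooth c : smooth1 (outer c).
Proof.
move=> k; apply: (@Ck_comp _ _ _ _ _ _ (fun s : R => r ^+ 2 - s)).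
  by apply: flat_Ck; lra.
rewrite (_ : (fun _ => _) = fun s : R => cst (r ^+ 2) s + (- 1) * s).
  by apply: CkD; [exact: Ck_cst|apply: CkZ; exact: smooth1_id].
by apply/funext => t; rewrite mulN1r.
Qed.

Definition wm s : R := inner 0 s * outer 0 s.
Definition wm' s : R := inner' 0 s * outer 0 s + inner 0 s * outer' 0 s.

Definition wq s : R := nu / 2 * wm s +
  ((- (2 * a * tau) * inner a s + 4 * a * h * inner (2 * a) s) * outer 0 s
   + (- 2) * (s * (inner 0 s * outer 2 s))).

Definition wq' s : R := nu / 2 * wm' s +
  (((- (2 * a * tau) * inner' a s + 4 * a * h * inner' (2 * a) s) * outer 0 s
    + (- (2 * a * tau) * inner a s + 4 * a * h * inner (2 * a) s) * outer' 0 s)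
   + (- 2) * (inner 0 s * outer 2 s + s * (inner' 0 s * outer 2 s + inner 0 s * outer' 2 s))).

Definition wp s : R := (4 * a ^+ 2 * tau * inner a s - 16 * a ^+ 2 * h * inner (2 * a) s) * outer 0 s
  - 4 * s * (inner 0 s * outer 2 s) - 8 * s ^+ 2 * (inner 0 s * outer 3 s).

Lemma wm_smooth : smooth1 wm.
Proof. by apply: smooth1M; [exact: inner_smooth|exact: outer_smooth]. Qed.

Lemma wq_smooth : smooth1 wq.
Proof.
have Ci := inner_smooth; have Co := outer_smooth; have Cid := smooth1_id.
apply: smooth1D; first by apply: smooth1Z; exact: wm_smooth.
apply: smooth1D; last by apply: smooth1Z; apply: smooth1M => //; exact: smooth1M.
by apply: smooth1M => //; apply: smooth1D; exact: smooth1Z.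
Qed.

Lemma wp_smooth : smooth1 wp.
Proof.
have Ci := inner_smooth; have Co := outer_smooth; have Cid := smooth1_id.
rewrite (_ : wp = fun s => (((4 * a ^+ 2 * tau) * inner a s + (- (16 * a ^+ 2 * h)) * inner (2 * a) s) * outer 0 s
  + (- 4) * (s * (inner 0 s * outer 2 s))) + (- 8) * ((s * s) * (inner 0 s * outer 3 s))).
  apply: smooth1D; last by apply: smooth1Z; apply: smooth1M; exact: smooth1M.
  apply: smooth1D; last by apply: smooth1Z; apply: smooth1M => //; exact: smooth1M.
  by apply: smooth1M => //; apply: smooth1D; exact: smooth1Z.
by apply/funext => s; rewrite /wp; ring.
Qed.

Lemma is_deriveM1 (f g : R -> R) (s df dg : R) : is_derive s 1 f df -> is_derive s 1 g dg ->
  is_derive s 1 (fun t => f t * g t) (df * g s + f s * dg).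
Proof.
move=> hf hg; apply: (is_derive_eq (is_deriveM hf hg)).
by rewrite addrC; congr (_ + _); exact: mulrC.
Qed.

Lemma is_deriveD1 (f g : R -> R) (s df dg : R) : is_derive s 1 f df -> is_derive s 1 g dg ->
  is_derive s 1 (fun t => f t + g t) (df + dg).
Proof. by move=> hf hg; exact: is_deriveD. Qed.

Lemma is_deriveZ1 (f : R -> R) (c s df : R) : is_derive s 1 f df ->
  is_derive s 1 (fun t => c * f t) (c * df).
Proof. by move=> hf; exact: is_deriveZ. Qed.

Lemma wm_is_derive s : is_derive s 1 wm (wm' s).
Proof. by apply: is_deriveM1; [exact: inner_is_derive|exact: outer_is_derive]. Qed.

Lemma wq_is_derive s : is_derive s 1 wq (wq' s).
Proof.
have di := inner_is_derive; have dout := outer_is_derive.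
apply: is_deriveD1; first by apply: is_deriveZ1; exact: wm_is_derive.
apply: is_deriveD1.
  apply: is_deriveM1 => //; apply: is_deriveD1; exact: is_deriveZ1.
apply: is_deriveZ1.
have := is_deriveM1 (is_derive_id s 1) (is_deriveM1 (di 0 s) (dout 2 s)).
by rewrite mul1r.
Qed.

Lemma wm_supp s : r ^+ 2 < s -> wm s = 0.
Proof. by move=> /ltW rs; rewrite /wm outer_le0// mulr0. Qed.

Lemma wq_out s : s <= 0 \/ r ^+ 2 <= s -> wq s = 0.
Proof.
by case=> hs; rewrite /wq /wm ?(inner_le0 _ hs) ?(outer_le0 _ hs) !(mulr0, mul0r, addr0).
Qed.

Lemma wq'_out s : s <= 0 \/ r ^+ 2 <= s -> wq' s = 0.
Proof.
by case=> hs; rewrite /wq' /wm' /inner' /outer' ?(inner_le0 _ hs) ?(outer_le0 _ hs)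
  !(mulr0, mul0r, addr0, subr0).
Qed.

Lemma wp_out s : s <= 0 \/ r ^+ 2 <= s -> wp s = 0.
Proof.
by case=> hs; rewrite /wp ?(inner_le0 _ hs) ?(outer_le0 _ hs) !(mulr0, mul0r, addr0, subr0).
Qed.

Lemma wq_supp s : r ^+ 2 < s -> wq s = 0.
Proof. by move=> /ltW rs; apply: wq_out; right. Qed.

Lemma wp_supp s : r ^+ 2 < s -> wp s = 0.
Proof. by move=> /ltW rs; apply: wp_out; right. Qed.

Lemma wm_ge0 s : 0 <= wm s.
Proof. exact: (mulr_ge0 (inner_ge0 _ _) (outer_ge0 _ _)). Qed.

Lemma inner'S c s : s * inner' c s = - c * inner c s - a * (2 * tau) * inner (c + a) s
  + 2 * a * (2 * h) * inner (c + 2 * a) s.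
Proof.
rewrite /inner' /inner -[in RHS](flatS a (2 * tau) (2 * h) c s).
rewrite -[in RHS](flatS a (2 * tau) (2 * h) (c + a) s).
by rewrite -[in RHS](flatS a (2 * tau) (2 * h) (c + 2 * a) s); ring.
Qed.

Lemma wq_def s : s * wm' s = wq s - nu / 2 * wm s.
Proof.
rewrite /wm' mulrDr mulrA inner'S /wq /outer' !add0r !mul0r sub0r oppr0 !mul0r add0r.
by ring.
Qed.

Definition wkap s : R := nu * wq s + 2 * s * wq' s - wp s.

(** In [y = s^-a] and [z = 1 / (r^2 - s)] all ratios of weights are monomials, and identities
    between weights become polynomial identities. *)
Lemma inner_outer_powers s : 0 < s -> s < r ^+ 2 -> exists y z p b, [/\ 0 < p, 0 < b, z * (r ^+ 2 - s) = 1 /\ y = expR (- a * ln s),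
  [/\ inner 0 s = p, inner a s = y * p, inner (2 * a) s = y ^+ 2 * p,
      inner (a + 2 * a) s = y ^+ 3 * p & inner (2 * a + 2 * a) s = y ^+ 4 * p] &
  [/\ outer 0 s = b, outer 2 s = z ^+ 2 * b, outer 3 s = z ^+ 3 * b & outer 4 s = z ^+ 4 * b]].
Proof.
move=> s0 sr; have t0 : 0 < r ^+ 2 - s by rewrite subr_gt0.
exists (expR (- a * ln s)), (r ^+ 2 - s)^-1, (inner 0 s), (outer 0 s).
have zE k : expR (- (k%:R) * ln (r ^+ 2 - s)) = (r ^+ 2 - s)^-1 ^+ k.
  by rewrite mulNr expRN expRM_natl lnK// exprVn.
have yE k : expR (- (k%:R * a) * ln s) = expR (- a * ln s) ^+ k.
  by rewrite -expRM_natl; congr expR; ring.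
have iE k : inner (k%:R * a) s = expR (- a * ln s) ^+ k * inner 0 s.
  by rewrite -yE /inner -flatD// add0r.
have oE k : outer k%:R s = (r ^+ 2 - s)^-1 ^+ k * outer 0 s.
  by rewrite -zE /outer -flatD// add0r.
have i1 := iE 1; have i2 := iE 2; have i3 := iE 3; have i4 := iE 4.
have o2 := oE 2; have o3 := oE 3; have o4 := oE 4.
split.
- by rewrite /inner flatE// expR_gt0.
- by rewrite /outer flatE// expR_gt0.
- by split=> //; rewrite mulVf// gt_eqF.
- split.
  + by [].
  + by rewrite -{1}[a]mul1r; exact: i1.
  + exact: i2.
  + by rewrite -i3; congr (inner _ s); ring.
  + by rewrite -i4; congr (inner _ s); ring.
- split; [by []|exact: o2|exact: o3|exact: o4].
Qed.

(** This identity determines [wp]: where [wm] is positive, [2 s psi' wm] equals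
    [nu wq + 2 s wq' - 2 wq^2 / wm]. The derivative occurs only as [s wq'], so [inner'S] removes
    every division by [s]. *)
Lemma wm_wkap s : wm s * wkap s = 2 * wq s ^+ 2.
Proof.
have [s0|s0] := leP s 0.
  by rewrite /wm inner_le0// !mul0r wq_out; [rewrite expr0n mulr0|left].
have [sr|rs] := ltP s (r ^+ 2); last first.
  by rewrite /wm outer_le0// mulr0 mul0r wq_out; [rewrite expr0n mulr0|right].
have [y [z [p [b [p0 b0 _ [ i0 i1 i2 i3 i4] [ o0 o2 o3 o4]]]]]] := inner_outer_powers s0 sr.
have := inner'S 0 s; have := inner'S a s; have := inner'S (2 * a) s.
rewrite !add0r (_ : a + a = 2 * a); last by ring.
rewrite (_ : 2 * a + a = a + 2 * a); last by ring.
rewrite i0 i1 i2 i3 i4 => J2 J1 J0.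
have e2 : outer (0 + 2) s = z ^+ 2 * b by rewrite add0r.
have e4 : outer (2 + 2) s = z ^+ 4 * b by rewrite (_ : 2 + 2 = 4)//; ring.
have e3 : outer (2 + 1) s = z ^+ 3 * b by rewrite (_ : 2 + 1 = 3)//; ring.
have S : s * wq' s = nu / 2 * (s * inner' 0 s * b + s * (p * (- 2 * (z ^+ 2 * b)))) +
  (((- (2 * a * tau) * (s * inner' a s) + 4 * a * h * (s * inner' (2 * a) s)) * b
    + s * ((- (2 * a * tau) * (y * p) + 4 * a * h * (y ^+ 2 * p)) * (- 2 * (z ^+ 2 * b))))
   + (- 2) * (s * (p * (z ^+ 2 * b)) + s * (s * inner' 0 s * (z ^+ 2 * b) +
       s * (p * (2 * (z ^+ 3 * b) - 2 * (z ^+ 4 * b)))))).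
  by rewrite /wq' /wm' /outer' e2 e3 e4 i0 i1 i2 o0 o2; ring.
rewrite /wkap -mulrA S J0 J1 J2 /wm /wq /wp /wm i0 i1 i2 o0 o2 o3.
by field.
Qed.

Lemma wm_eq0 s : wm s = 0 -> wq s = 0 /\ wkap s = 0.
Proof.
have out : s <= 0 \/ r ^+ 2 <= s -> wq s = 0 /\ wkap s = 0.
  by move=> hs; rewrite /wkap wq_out// wq'_out// wp_out// !mulr0 addr0 subr0.
have [s0|s0] := leP s 0; first by move=> _; apply: out; left.
have [sr|rs] := ltP s (r ^+ 2); last by move=> _; apply: out; right.
have [y [z [p [b [p0 b0 _ [ i0 _ _ _ _] [ o0 _ _ _]]]]]] := inner_outer_powers s0 sr.
by rewrite /wm i0 o0 => /eqP; rewrite mulf_eq0 !gt_eqF.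
Qed.

End carleman_weight.

(** * Lower bounds for the weights *)

Section weight_estimates.
Context {R : realType}.
Variables (a r : R).
Hypotheses (a_gt0 : 0 < a) (r_gt0 : 0 < r) (r_le1 : r <= 1).
Implicit Types tau h s : R.

(** For [s > 0] this is [s^-a wm], the common form of the main gain in [wp] and of the potential
    term [C^2 s^-a wm]. *)
Definition wA tau h s : R := inner a tau h a s * outer r 0 s.

(** Bounds [4 s z^2 + 8 s^2 z^3], with [z = 1 / (r^2 - s)], for [0 < s <= r^2 / 2]: there
    [z <= 2 / r^2] and [s <= 1]. *)
Let K : R := 4 * (2 / r ^+ 2) ^+ 2 + 8 * (2 / r ^+ 2) ^+ 3.

Lemma outer0_le1 s : outer r 0 s <= 1.
Proof.
rewrite /outer /flat; case: ifP => // t0.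
rewrite -[leRHS]expR0 ler_expR /flat_phase mul0r oppr0 !mul0r !add0r oppr_le0.
by rewrite mulr_ge0// expR_ge0.
Qed.

Lemma wA_ge0 tau h s : 0 <= wA tau h s.
Proof. exact: (mulr_ge0 (inner_ge0 _ _ _ _ _) (outer_ge0 _ _ _)). Qed.

Lemma outer_bounded : exists2 M, 0 <= M &
  forall s, 0 < s -> outer r 2 s <= M /\ outer r 3 s <= M.
Proof.
have half : 0 < 1 / 2 :> R by lra.
have two : 0 < 2 :> R by lra.
have [M2 M20 h2] := flat_bounded 0 2 half two.
have [M3 M30 h3] := flat_bounded 0 3 half two.
exists (M2 + M3); first by rewrite addr_ge0// ltW.
move=> s s0; have s1 : r ^+ 2 - s <= 1.
  by have : r ^+ 2 <= 1 by [rewrite exprn_ile1// ltW]; lra.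
by split; [apply: le_trans (h2 _ s1) _; rewrite lerDl ltW
          |apply: le_trans (h3 _ s1) _; rewrite lerDr ltW].
Qed.

Lemma negpow_le s t : 0 < s -> s <= t -> expR (- a * ln t) <= expR (- a * ln s).
Proof.
move=> s0 st; rewrite ler_expR !mulNr lerN2 ler_wpM2l// ?(ltW a_gt0)// ler_ln//.
by rewrite posrE (lt_le_trans s0).
Qed.

Lemma negpow_ge1 s : 0 < s -> s <= 1 -> 1 <= expR (- a * ln s).
Proof. by move=> s0 s1; have := negpow_le s0 s1; rewrite ln1 mulr0 expR0. Qed.

Lemma r2_gt0 : 0 < r ^+ 2. Proof. by rewrite exprn_gt0. Qed.
Lemma r2_le1 : r ^+ 2 <= 1. Proof. by rewrite exprn_ile1// ltW. Qed.

Lemma inner0_le tau h s : 0 < h -> 0 < s ->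
  inner a tau h 0 s <= expR (2 * tau * expR (- a * ln s)).
Proof.
move=> h0 s0; rewrite /inner flatE// ler_expR /flat_phase oppr0 mul0r add0r gerBl.
by rewrite mulr_ge0 ?expR_ge0// ltW// mulr_gt0.
Qed.

Lemma flat0E tau s : 0 < s -> flat a (2 * tau) 0 0 s = expR (2 * tau * expR (- a * ln s)).
Proof. by move=> s0; rewrite flatE// /flat_phase oppr0 !mul0r add0r subr0. Qed.

(** The [h]-term carries [y^2] with [y = s^-a], and [y^2 <= exp (2 y)] absorbs it by raising [tau]
    to [tau + 1]. The cutoff terms are at most [K wA] for [s <= r^2 / 2], because [y >= 1]; for
    larger [s] the powers of [z] are absorbed in [M], with [12 = 4 + 8], and the exponential is at
    most its value at [r^2 / 2]. *)
Lemma wp_lower (M : R) : 0 <= M -> (forall s, 0 < s -> outer r 2 s <= M) -> (forall s, 0 < s -> outer r 3 s <= M) ->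
  forall tau h s, 0 <= tau -> 0 < h ->
  (4 * a ^+ 2 * tau - K) * wA tau h s <=
  wp a tau h r s + 16 * a ^+ 2 * h * flat a (2 * (tau + 1)) 0 0 s
    + 12 * M * expR (2 * tau * expR (- a * ln (r ^+ 2 / 2))).
Proof.
move=> M0 M2 M3 tau h s tau0 h0.
have X0 : 0 <= 16 * a ^+ 2 * h * flat a (2 * (tau + 1)) 0 0 s.
  by rewrite mulr_ge0 ?flat_ge0// mulr_ge0 ?(ltW h0)// mulr_ge0// sqr_ge0.
have Y0 : 0 <= 12 * M * expR (2 * tau * expR (- a * ln (r ^+ 2 / 2))).
  by rewrite mulr_ge0 ?expR_ge0// mulr_ge0.
have out : s <= 0 \/ r ^+ 2 <= s -> wA tau h s = 0.
  by case=> hs; [rewrite /wA inner_le0// mul0r|rewrite /wA outer_le0// mulr0].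
have [s0|s0] := leP s 0.
  by rewrite out ?wp_out; [rewrite mulr0 add0r addr_ge0|left|left].
have [sr|rs] := ltP s (r ^+ 2); last first.
  by rewrite out ?wp_out; [rewrite mulr0 add0r addr_ge0|right|right].
have s1 : s <= 1 by rewrite (le_trans (ltW sr))// r2_le1.
have [y [z [p [b [p0 b0 [zt yE] [ i0 i1 i2 _ _] [ o0 o2 o3 _]]]]]] := @inner_outer_powers _ a tau h r s s0 sr.
have y1 : 1 <= y by rewrite yE negpow_ge1.
have b1 : b <= 1 by rewrite -o0 outer0_le1.
have pe : p <= expR (2 * tau * y) by rewrite -i0 yE inner0_le.
have t0 : 0 < r ^+ 2 - s by rewrite subr_gt0.
have z0 : 0 < z by rewrite -(pmulr_lgt0 z t0) zt ltr01.
have y0 : 0 < y := lt_le_trans ltr01 y1.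
rewrite /wA /wp i0 i1 i2 o0 o2 o3.
have H1 : y ^+ 2 * p * b <= flat a (2 * (tau + 1)) 0 0 s.
  rewrite flat0E// -yE -[leRHS]mulr1; apply: ler_pM => //; [|exact: ltW|].
    by rewrite mulr_ge0 ?(ltW p0)// sqr_ge0.
  rewrite (_ : 2 * (tau + 1) * y = 2 * y + 2 * tau * y); last by ring.
  rewrite expRD; apply: ler_pM => //; [exact: sqr_ge0|exact: ltW|].
  rewrite expRM_natl lerXn2r ?nnegrE ?expR_ge0 ?(ltW y0)//.
  by apply: le_trans (expR_ge1Dx y); rewrite lerDr.
have q0 : 0 < p * b by rewrite mulr_gt0.
have ypb : 0 < y * p * b by rewrite !mulr_gt0.
have H2 : 4 * s * (p * (z ^+ 2 * b)) + 8 * s ^+ 2 * (p * (z ^+ 3 * b)) <=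
   K * (y * p * b) + 12 * M * expR (2 * tau * expR (- a * ln (r ^+ 2 / 2))).
  have s21 : s ^+ 2 <= 1 by rewrite exprn_ile1// ltW.
  have [sh|hs] := leP s (r ^+ 2 / 2).
    have zZ : z <= 2 / r ^+ 2.
      have zr : z * r ^+ 2 <= z * (2 * (r ^+ 2 - s)) by rewrite ler_wpM2l ?(ltW z0)//; lra.
      by rewrite ler_pdivlMr ?r2_gt0// (le_trans zr)// mulrCA zt mulr1.
    have zk k : z ^+ k <= (2 / r ^+ 2) ^+ k.
      by rewrite lerXn2r ?nnegrE ?(ltW z0)// (le_trans (ltW z0)).
    have g1 : s * z ^+ 2 <= y * (2 / r ^+ 2) ^+ 2.
      by apply: ler_pM => //; [exact: ltW|rewrite exprn_ge0// ltW|exact: (le_trans s1)].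
    have g2 : s ^+ 2 * z ^+ 3 <= y * (2 / r ^+ 2) ^+ 3.
      by apply: ler_pM => //; [exact: sqr_ge0|rewrite exprn_ge0// ltW|exact: (le_trans s21)].
    have := ler_wpM2r (ltW q0) g1; have := ler_wpM2r (ltW q0) g2.
    rewrite (_ : s ^+ 2 * z ^+ 3 * (p * b) = s ^+ 2 * (p * (z ^+ 3 * b))); last by ring.
    rewrite (_ : s * z ^+ 2 * (p * b) = s * (p * (z ^+ 2 * b))); last by ring.
    move=> k2 k1; rewrite ler_wpDr//.
    by rewrite /K; lra.
  have pE : p <= expR (2 * tau * expR (- a * ln (r ^+ 2 / 2))).
    apply: (le_trans pe); rewrite ler_expR ler_wpM2l//; first by rewrite mulr_ge0.
    by rewrite yE negpow_le// ?(ltW hs)// divr_gt0// r2_gt0.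
  have K0 : 0 <= K * (y * p * b).
    apply: mulr_ge0; last exact: ltW.
    by have Z0 : 0 <= 2 / r ^+ 2 by [rewrite divr_ge0// ltW// r2_gt0];
      rewrite /K addr_ge0// mulr_ge0// exprn_ge0.
  have n2 : z ^+ 2 * b <= M by rewrite -o2 M2.
  have n3 : z ^+ 3 * b <= M by rewrite -o3 M3.
  have zb k : 0 <= z ^+ k * b by rewrite mulr_ge0 ?(ltW b0)// exprn_ge0// ltW.
  have l2 := ler_pM (ltW p0) (zb 2) pE n2; have l3 := ler_pM (ltW p0) (zb 3) pE n3.
  have m2 := ler_pM (ltW s0) (mulr_ge0 (ltW p0) (zb 2)) s1 l2.
  have m3 := ler_pM (sqr_ge0 s) (mulr_ge0 (ltW p0) (zb 3)) s21 l3.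
  by move: m2 m3; rewrite !mul1r => m2 m3; lra.
have c0 : 0 <= 16 * a ^+ 2 * h by rewrite mulr_ge0 ?(ltW h0)// mulr_ge0// sqr_ge0.
have H3 := ler_wpM2l c0 H1.
have E1 : (4 * a ^+ 2 * tau * (y * p) - 16 * a ^+ 2 * h * (y ^+ 2 * p)) * b =
  4 * a ^+ 2 * tau * (y * p * b) - 16 * a ^+ 2 * h * (y ^+ 2 * p * b) by ring.
rewrite E1; lra.
Qed.

(** The factor [s^-a >= 1] is dropped and [r^2 - s >= 3 r^2 / 4] bounds the cutoff. Using
    [1 - x <= exp (- x)] keeps the bound affine in [h], and [s >= s0] makes it uniform in [s]. *)
Lemma wA_lower s0 tau h s : 0 < s0 -> s0 <= s -> s <= r ^+ 2 / 4 -> 0 <= tau -> 0 < h ->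
  expR (2 * tau * expR (- a * ln (r ^+ 2 / 4))) *
    (expR (- (2 * expR (- ln (3 / 4 * r ^+ 2)))) * (1 - h * (2 * expR (- (2 * a) * ln s0))))
  <= wA tau h s.
Proof.
move=> s0_gt0 s0s sr tau0 h0; have r2 := r2_gt0; have r1 := r2_le1.
have sgt0 : 0 < s := lt_le_trans s0_gt0 s0s.
have s1 : s <= 1 by lra.
have t0 : 0 < r ^+ 2 - s by lra.
have y1 := negpow_ge1 sgt0 s1.
have yb : expR (- a * ln (r ^+ 2 / 4)) <= expR (- a * ln s) by exact: negpow_le.
have o0 : expR (- (2 * expR (- ln (3 / 4 * r ^+ 2)))) <= outer r 0 s.
  rewrite /outer flatE// ler_expR /flat_phase oppr0 !mul0r !add0r lerN2 ler_wpM2l// ler_expR.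
  rewrite (_ : 2 * (1 / 2) = 1); last by field.
  by rewrite mulN1r lerN2 ler_ln ?posrE; lra.
have i0 : expR (2 * tau * expR (- a * ln (r ^+ 2 / 4))) * (1 - h * (2 * expR (- (2 * a) * ln s0)))
    <= inner a tau h 0 s.
  rewrite /inner flatE// /flat_phase oppr0 mul0r add0r expRD.
  have l1 : 1 - h * (2 * expR (- (2 * a) * ln s0)) <=
      expR (- (2 * h * expR (- (2 * a) * ln s))).
    apply: le_trans (expR_ge1Dx _); rewrite lerD2l lerN2 mulrCA mulrA.
    rewrite ler_wpM2l ?mulr_ge0 ?(ltW h0)// ler_expR !mulNr lerN2.
    by rewrite ler_wpM2l ?mulr_ge0 ?(ltW a_gt0)// ler_ln// posrE.
  apply: (le_trans (ler_wpM2l (expR_ge0 _) l1)).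
  by rewrite ler_wpM2r ?expR_ge0// ler_expR ler_wpM2l// mulr_ge0.
rewrite /wA (_ : inner a tau h a s = expR (- a * ln s) * inner a tau h 0 s); last first.
  by rewrite /inner -flatD// add0r.
have I0 := inner_ge0 a tau h 0 s.
rewrite mulrCA mulrC.
apply: (le_trans (ler_wpM2r (expR_ge0 _) i0)).
apply: ler_pM; [exact: I0|exact: expR_ge0| |exact: o0].
by rewrite -[leLHS]mul1r ler_wpM2r.
Qed.

End weight_estimates.

Lemma le_of_small_error {R : realFieldType} (A B X d : R) :
  (forall h, 0 < h -> A * (1 - h * d) <= h * B + X) -> A <= X.
Proof.
move=> H; apply/ler_addgt0Pr => e e0.
have [N|P] := leP (B + A * d) 0; first by have := H 1 ltr01; lra.
have := H (e / (B + A * d)) (divr_gt0 e0 P).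
have : e / (B + A * d) * (B + A * d) = e by rewrite divfK// gt_eqF.
by lra.
Qed.

(** Serves for the limit [tau -> oo], once exponential growth has been weakened to linear growth. *)
Lemma le0_of_linear_bound {R : realFieldType} (A Z t0 : R) :
  (forall t, t0 <= t -> A * t <= Z) -> A <= 0.
Proof.
move=> H; rewrite leNgt; apply/negP => A0.
have := H (Num.max t0 (Z / A + 1)); rewrite le_max lexx => /(_ isT).
apply/negP; rewrite -ltNge; apply: (@lt_le_trans _ _ (A * (Z / A + 1))).
  by rewrite mulrDr mulr1 mulrC divfK ?gt_eqF// ltrDl.
by rewrite ler_wpM2l ?(ltW A0)// le_max lexx orbT.
Qed.


(** * Vanishing on annuli *)

Section annulus.
Context {R : realType} {n : nat}.
Local Notation T := 'rV[R]_n.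
Local Notation mu := (lebesgue_rV n : {sigma_finite_measure set 'rV[R]_n -> \bar R}).
(** A scalar form of the argument: [w] stands for [|u|^2], [D] for [s |D_n u|^2], [c] for [C^2], and
    [G tau] for the squared norm of the exponentially weighted spinor on the ball. *)
Variables (a r c : R) (w D : T -> R) (G : R -> T -> R).
Hypotheses (a_gt0 : 0 < a) (r_gt0 : 0 < r) (r_le1 : r <= 1) (c_ge0 : 0 <= c).
Hypothesis w_ge0 : forall x, 0 <= w x.
Hypothesis w_intg : forall b, bweight r b -> intg mu (fun x => b x * w x).
Hypothesis D_ge0 : forall x, 0 <= D x.
Hypothesis D_intg : forall tau h, 0 < h -> intg mu (fun x => wm a tau h r (sqn x) * D x).
Hypothesis D_le : {ae mu, forall x, cball r x -> 0 < sqn x ->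
  D x <= c * (expR (- a * ln (sqn x)) * w x)}.
Hypothesis carleman : forall tau h, 0 < h ->
  2 * \int[mu]_x (wp a tau h r (sqn x) * w x) <= \int[mu]_x (wm a tau h r (sqn x) * D x).
Hypothesis G_intg : forall tau, 1 < tau -> intg mu (G tau).
Hypothesis G_ge : forall tau x, cball r x -> flat a (2 * tau) 0 0 (sqn x) * w x <= G tau x.
Hypothesis G_ge0 : forall tau x, 0 <= G tau x.

Let cont_bweight (f : R -> R) : continuous f -> (forall s, r ^+ 2 < s -> f s = 0) ->
  bweight r (fun x : T => f (sqn x)).
Proof. by move=> cf f0; apply: radial_bweight => //; exact: ltW. Qed.

Let bweight_wp tau h : 0 < h -> bweight r (fun x : T => wp a tau h r (sqn x)).
Proof.
move=> h0; apply: cont_bweight; last exact: wp_supp.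
by apply: smooth1_continuous; exact: wp_smooth.
Qed.

Let bweight_wm tau h : 0 < h -> bweight r (fun x : T => wm a tau h r (sqn x)).
Proof.
move=> h0; apply: cont_bweight; last exact: wm_supp.
by apply: smooth1_continuous; exact: wm_smooth.
Qed.

Let bweight_wA tau h : 0 < h -> bweight r (fun x : T => wA a r tau h (sqn x)).
Proof.
move=> h0; apply: cont_bweight; last first.
  by move=> s rs; rewrite /wA outer_le0 ?mulr0// ltW.
by apply: smooth1_continuous; apply: smooth1M; [exact: inner_smooth|exact: outer_smooth].
Qed.

Let bweight_indic (Q : set T) : measurable Q -> Q `<=` cball r -> bweight r (\1_Q : T -> R).
Proof.
move=> mQ Qr; split.
- exact: measurable_indic.
- by move=> x xr; rewrite indicE memNset// => /Qr.
- by exists 1 => // x; rewrite indicE; case: (_ \in _); rewrite ?normr1 ?normr0.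
Qed.

Let J0 := \int[mu]_x (\1_(cball r) x * w x).

Lemma int_wm_le tau h : 0 < h ->
  \int[mu]_x (wm a tau h r (sqn x) * D x) <= c * \int[mu]_x (wA a r tau h (sqn x) * w x).
Proof.
move=> h0.
have i1 := D_intg tau h0; have i2 := w_intg (bweight_wA tau h0).
rewrite -(RintegralZl c measurableT i2).
have i3 := intgZ c i2.
rewrite -lee_fin -(intgE_fine i1) -(intgE_fine i3).
apply: ae_ge0_le_integral => //.
- move=> x _; rewrite lee_fin; apply: mulr_ge0; last exact: D_ge0.
  exact: wm_ge0.
- exact: (measurable_EFinT (intg_measurable i1)).
- move=> x _; rewrite lee_fin; apply: mulr_ge0 => //.
  by apply: mulr_ge0; [exact: wA_ge0|exact: w_ge0].
- exact: (measurable_EFinT (intg_measurable i3)).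
move: D_le; apply: filterS => x Dx _; rewrite lee_fin.
have [xr|xr] := pselect (cball r x); last first.
  have [_ -> // _] := bweight_wA tau h0; have [_ -> // _] := bweight_wm tau h0.
  by rewrite !mul0r mulr0.
have [s0|s0] := leP (sqn x) 0; first by rewrite /wm /wA !inner_le0// !mul0r mulr0.
have := ler_wpM2l (wm_ge0 a tau h r (sqn x)) (Dx xr s0).
suff -> : wm a tau h r (sqn x) * (c * (expR (- a * ln (sqn x)) * w x)) =
  c * (wA a r tau h (sqn x) * w x) by [].
rewrite /wA (_ : inner a tau h a (sqn x) = expR (- a * ln (sqn x)) * inner a tau h 0 (sqn x)).
  by rewrite /wm; ring.
by rewrite /inner -flatD// add0r.
Qed.

Lemma int_wA_le (M : R) tau h : 0 <= M -> (forall s, 0 < s -> outer r 2 s <= M) ->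
  (forall s, 0 < s -> outer r 3 s <= M) -> 0 < tau -> 0 < h ->
  8 * a ^+ 2 * tau - 2 * (4 * (2 / r ^+ 2) ^+ 2 + 8 * (2 / r ^+ 2) ^+ 3) - c >= 1 ->
  \int[mu]_x (wA a r tau h (sqn x) * w x) <=
  32 * a ^+ 2 * h * \int[mu]_x (G (tau + 1) x) +
  24 * M * expR (2 * tau * expR (- a * ln (r ^+ 2 / 2))) * J0.
Proof.
move=> M0 M2 M3 tau0 h0 ht.
set K := 4 * _ + _ in ht.
set E := expR _.
have cb : measurable (cball r : set T) by exact: measurable_cball.
have iA := w_intg (bweight_wA tau h0); have ip := w_intg (bweight_wp tau h0).
have i1 := w_intg (bweight_indic cb (@subset_refl _ _)).
have tau1 : 1 < tau + 1 by rewrite ltrDr.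
have iG := G_intg tau1.
have A0 : 0 <= \int[mu]_x (wA a r tau h (sqn x) * w x).
  by apply: Rintegral_ge0 => x _; apply: mulr_ge0; [exact: wA_ge0|exact: w_ge0].
have pt x : (4 * a ^+ 2 * tau - K) * (wA a r tau h (sqn x) * w x) <=
    wp a tau h r (sqn x) * w x + (16 * a ^+ 2 * h * G (tau + 1) x + 12 * M * E * (\1_(cball r) x * w x)).
  have c0 : 0 <= 16 * a ^+ 2 * h by rewrite mulr_ge0 ?(ltW h0)// mulr_ge0// sqr_ge0.
  have [xr|xr] := pselect (cball r x); last first.
    have [_ -> // _] := bweight_wA tau h0; have [_ -> // _] := bweight_wp tau h0.
    by rewrite indicE memNset// !mul0r !mulr0 addr0 add0r mulr_ge0.
  have := ler_wpM2r (w_ge0 x) (wp_lower a_gt0 r_gt0 r_le1 M0 M2 M3 (sqn x) (ltW tau0) h0).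
  rewrite -/K -/E indicE mem_set// mul1r => h1.
  have := ler_wpM2l c0 (G_ge (tau + 1) xr).
  by move: h1; lra.
have i2 : intg mu (fun x => 16 * a ^+ 2 * h * G (tau + 1) x + 12 * M * E * (\1_(cball r) x * w x)).
  by apply: intgD; exact: intgZ.
have := le_Rintegral measurableT (intgZ (4 * a ^+ 2 * tau - K) iA) (intgD ip i2) (fun x _ => pt x).
rewrite (RintegralZl _ measurableT iA) (RintegralD measurableT ip i2).
rewrite (RintegralD measurableT (intgZ _ iG) (intgZ _ i1)).
rewrite (RintegralZl _ measurableT iG) (RintegralZl _ measurableT i1).
have := carleman tau h0; have := int_wm_le tau h0; rewrite -/J0.
set IA := \int[mu]_x (wA _ _ _ _ _ * _) in A0 *.
set Ip := \int[mu]_x (wp _ _ _ _ _ * _).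
set Im := \int[mu]_x (wm _ _ _ _ _ * _).
move=> h1 h2 h3.
have h4 := ler_wpM2r A0 ht.
by lra.
Qed.

(** On the annulus the weight is at least of order [exp (2 tau (r^2 / 4)^-a)], while after [h -> 0]
    the error is only of order [exp (2 tau (r^2 / 2)^-a)], with constants independent of [tau].
    Staying at [s >= s0] makes the limit in [h] uniform. *)
Lemma annulus_vanish (s0 : R) : 0 < s0 ->
  {ae mu, forall x, s0 <= sqn x <= r ^+ 2 / 4 -> w x = 0}.
Proof.
move=> s00.
pose Q := [set x : T | s0 <= sqn x <= r ^+ 2 / 4].
have mQ : measurable Q.
  rewrite (_ : Q = sqn @^-1` `[s0, r ^+ 2 / 4]%classic).
    by rewrite -[X in measurable X]setTI; apply: measurable_sqn => //; exact: measurable_itv.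
  by apply/seteqP; split=> x /=; rewrite in_itv.
have Qr : Q `<=` cball r.
  by move=> x /= /andP[_ h]; rewrite /cball /=; apply: (le_trans h); have := r2_gt0 r_gt0; lra.
have iQ := w_intg (bweight_indic mQ Qr).
have Qw0 x : 0 <= \1_Q x * w x by rewrite mulr_ge0// indicE.
have [M M0 hM] := outer_bounded r_gt0 r_le1.
have hM2 s : 0 < s -> outer r 2 s <= M by move=> /hM[].
have hM3 s : 0 < s -> outer r 3 s <= M by move=> /hM[].
have [K K0 KE] : exists2 K : R, 0 <= K & K = 4 * (2 / r ^+ 2) ^+ 2 + 8 * (2 / r ^+ 2) ^+ 3.
  eexists; last by [].
  have Z0 : 0 <= 2 / r ^+ 2 by rewrite divr_ge0// ltW// r2_gt0.
  by rewrite addr_ge0// mulr_ge0// exprn_ge0.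
have a2 : 0 < 8 * a ^+ 2 by rewrite mulr_gt0// exprn_gt0.
(* The value of [tau] from which [8 a^2 tau - 2 K - c >= 1]. *)
pose t0 := (1 + 2 * K + c) / (8 * a ^+ 2).
have t00 : 0 < t0.
  by rewrite divr_gt0// ltr_pwDl// ltr_pwDl// mulr_ge0.
pose I := \int[mu]_x (\1_Q x * w x).
have I0 : 0 <= I by apply: Rintegral_ge0.
pose b1 := expR (- a * ln (r ^+ 2 / 4)); pose b0 := expR (- a * ln (r ^+ 2 / 2)).
have r20 := r2_gt0 r_gt0.
have b01 : b0 < b1.
  rewrite ltr_expR !mulNr ltrN2 ltr_pM2l// ltr_ln ?posrE; lra.
pose k0 := expR (- (2 * expR (- ln (3 / 4 * r ^+ 2)))).
have k00 : 0 < k0 by exact: expR_gt0.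
have lim t : t0 <= t -> I * (expR (2 * t * b1) * k0) <= 24 * M * expR (2 * t * b0) * J0.
  move=> tt; have tgt0 : 0 < t := lt_le_trans t00 tt.
  apply: (@le_of_small_error _ _ (32 * a ^+ 2 * \int[mu]_x (G (t + 1) x)) _
    (2 * expR (- (2 * a) * ln s0))) => h h0.
  have h1 : 1 <= 8 * a ^+ 2 * t - 2 * K - c.
    have := ler_wpM2l (ltW a2) tt; rewrite /t0 mulrC divfK ?gt_eqF//; lra.
  rewrite KE in h1; have := int_wA_le M0 hM2 hM3 tgt0 h0 h1.
  rewrite (_ : 32 * a ^+ 2 * h * _ = h * (32 * a ^+ 2 * \int[mu]_x (G (t + 1) x))); last by ring.
  apply: le_trans.
  rewrite [leLHS](_ : _ = expR (2 * t * b1) *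
    (k0 * (1 - h * (2 * expR (- (2 * a) * ln s0)))) * I); last by ring.
  rewrite -(RintegralZl _ measurableT iQ).
  apply: le_Rintegral => //.
  - exact: intgZ.
  - exact: (w_intg (bweight_wA t h0)).
  move=> x _; have [xQ|xQ] := pselect (Q x).
    rewrite indicE mem_set// mul1r ler_wpM2r//.
    by move: xQ => /= /andP[h2 h3]; exact: wA_lower (ltW tgt0) h0.
  by rewrite indicE memNset// mul0r mulr0; apply: mulr_ge0; [exact: wA_ge0|exact: w_ge0].
have II : I <= 0.
  have d0 : 0 < k0 * (2 * (b1 - b0)) by rewrite mulr_gt0// mulr_gt0// subr_gt0.
  (* After division by the smaller exponential, [x <= exp x] leaves a linear bound in [tau]. *)
  rewrite -(pmulr_lle0 _ d0); apply: (@le0_of_linear_bound _ _ (24 * M * J0) t0) => t tt.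
  have := lim t tt.
  rewrite (_ : 2 * t * b1 = 2 * t * (b1 - b0) + 2 * t * b0); last by ring.
  rewrite expRD.
  rewrite (_ : I * _ = I * k0 * expR (2 * t * (b1 - b0)) * expR (2 * t * b0)); last by ring.
  rewrite (_ : 24 * M * _ * J0 = 24 * M * J0 * expR (2 * t * b0)); last by ring.
  rewrite ler_pM2r ?expR_gt0//; apply: le_trans.
  rewrite [leLHS](_ : _ = I * k0 * (2 * t * (b1 - b0))); last by ring.
  rewrite ler_wpM2l//; first by rewrite mulr_ge0// ltW.
  by apply: le_trans (expR_ge1Dx _); rewrite lerDr.
have I00 : (\int[mu]_x (\1_Q x * w x)%:E = 0)%E.
  by rewrite (intgE_fine iQ); congr EFin; apply/eqP; rewrite eq_le II.
have mQw := measurable_EFinT (intg_measurable iQ).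
have : ae_eq mu setT (fun x => (\1_Q x * w x)%:E) (cst 0%E).
  apply: (ae_eq_integral_abs mu measurableT mQw).1; rewrite -[RHS]I00.
  by apply: eq_integral => x _; rewrite gee0_abs// lee_fin.
apply: filterS => x /(_ Logic.I) /= [h] xQ.
by move: h; rewrite indicE mem_set// mul1r.
Qed.

End annulus.

(** * From complex Sobolev spinors to real functions *)

Section sobolev_spinors.
Context {R : realType} {n N : nat}.
Local Notation T := 'rV[R]_n.
Local Notation mu := (lebesgue_rV n : {sigma_finite_measure set 'rV[R]_n -> \bar R}).
Local Notation spinor := 'cV[R[i]]_N.
Implicit Types (f u v : T -> spinor) (r rho : R).

Lemma L2_cball r f : L2 (cball r) f ->
  (forall p, measurable_fun setT (cut r (fun x => ri (f x) p))) /\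
  intg mu (fun x => \1_(cball r) x * rdot (f x) (f x)).
Proof.
move=> [mf fin].
have mr : measurable (cball r : set T) by exact: measurable_cball.
have mc p : measurable_fun setT (cut r (fun x => ri (f x) p)).
  rewrite (_ : cut r _ = (fun x => ri (f x) p) \_ (cball r)); last first.
    by apply/funext => x; rewrite /cut patchE indicE; case: (x \in _); rewrite ?mulr1 ?mulr0.
  apply/(measurable_restrictT _ mr).
  by case: p => k [] /=; [exact: (mf k).2|exact: (mf k).1].
split=> //.
have S x : \1_(cball r) x * rdot (f x) (f x) = \sum_p cut r (fun x => ri (f x) p) x ^+ 2.
  rewrite /rdot mulr_sumr; apply: eq_bigr => p _; rewrite /cut indicE.
  by case: (x \in _); rewrite ?mul1r ?mulr1 ?mul0r ?mulr0 ?expr0n.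
have mS : measurable_fun setT (fun x => \1_(cball r) x * rdot (f x) (f x)).
  rewrite (_ : (fun _ => _) = fun x => \sum_p cut r (fun x => ri (f x) p) x ^+ 2).
    by apply: measurable_sum => p; exact: measurable_funX.
  by apply/funext => x; rewrite S.
apply/integrableP; split; first exact: (measurable_EFinT mS).
apply: le_lt_trans fin; rewrite [leRHS]integral_mkcond le_eqVlt; apply/orP; left; apply/eqP.
apply: eq_integral => x _; rewrite patchE /= ger0_norm; last first.
  by rewrite mulr_ge0 ?rdot_ge0// indicE.
by rewrite indicE cnorm_rdot; case: (x \in _); rewrite ?mul1r ?mul0r.
Qed.

Lemma ri_sq_le p (z : spinor) : ri z p ^+ 2 <= rdot z z.
Proof.
rewrite /rdot (bigD1 p)//= -expr2 lerDl; apply: sumr_ge0 => q _.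
by rewrite -expr2 sqr_ge0.
Qed.

Lemma L2loc_L2v rho f : L2loc (eball rho) f -> L2v rho f.
Proof.
move=> Lf p r r0 rr.
have [m i2] := L2_cball (Lf _ (compact_cball r0) (cball_eball r0 rr)); split=> //.
apply: (@intg_bound _ _ _ mu _ _ 1 _ _ i2); first by apply: measurable_funX; exact: m.
move=> x; rewrite mul1r !ger0_norm ?sqr_ge0//; last first.
  by rewrite mulr_ge0 ?rdot_ge0// indicE.
rewrite /cut indicE; case: (x \in _); rewrite ?mulr1 ?mul1r ?mulr0 ?mul0r ?expr0n//.
exact: ri_sq_le.
Qed.

(** [H1loc] guarantees that the chosen representative [weak_partial] is not the default value. As
    test functions are real, the real and imaginary parts of the complex identity separate. *)
Lemma weak_partial_derivable rho u : H1loc (eball rho) u ->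
  forall p, weakly_derivable rho (fun x => ri (u x) p)
    (fun j x => ri (weak_partial (eball rho) j u x) p).
Proof.
move=> [Lu H] p.
have W j : L2loc (eball rho) (weak_partial (eball rho) j u) /\
    is_weak_partial (eball rho) j u (weak_partial (eball rho) j u).
  have [v Lv wv] := H j.
  by apply: (@xgetPex _ (cst 0) [set v | L2loc (eball rho) v /\ is_weak_partial (eball rho) j u v]);
    exists v.
split; first exact: L2loc_L2v.
  by move=> j; apply: L2loc_L2v; have [] := W j.
move=> j phi tphi; have [_ /(_ phi tphi p.1) E] := W j.
have IE (g : T -> R[i]) (c : T -> R) :
    \int[mu]_(x in eball rho) complex.Im (g x * (c x)%:C%C) =
    \int[mu]_(x in eball rho) (complex.Im (g x) * c x).
  by apply: eq_Rintegral => x _; rewrite ImM /= mulr0 add0r.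
have RE (g : T -> R[i]) (c : T -> R) :
    \int[mu]_(x in eball rho) complex.Re (g x * (c x)%:C%C) =
    \int[mu]_(x in eball rho) (complex.Re (g x) * c x).
  by apply: eq_Rintegral => x _; rewrite ReM /= mulr0 subr0.
case: p E => k [] /= E; rewrite /ri /= -?IE -?RE.
  exact: (congr1 (@complex.Im R) E).
exact: (congr1 (@complex.Re R) E).
Qed.

Lemma measurable_eball rho : 0 < rho -> measurable (eball rho : set T).
Proof.
move=> rho0; rewrite (_ : eball rho = sqn @^-1` `]-oo, rho ^+ 2[%classic).
  by rewrite -[X in measurable X]setTI; apply: measurable_sqn => //; exact: measurable_itv.
apply/seteqP; split=> x; rewrite /eball /= in_itv/= -enorm_sqn.
  by rewrite ltr_pXn2r// nnegrE ?sqrtr_ge0// ltW.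
by rewrite ltr_pXn2r// nnegrE ?sqrtr_ge0// ltW.
Qed.

Lemma L2_eball_cball rho r f : 0 <= r -> r < rho -> L2 (eball rho) f -> L2 (cball r) f.
Proof.
move=> r0 rr [mf fin]; have rho0 := le_lt_trans r0 rr.
have mb := measurable_eball rho0; have mc : measurable (cball r : set T) by exact: measurable_cball.
split.
  by move=> k; have [m1 m2] := mf k; split; apply: (measurable_funS mb (cball_eball r0 rr)).
apply: le_lt_trans fin; apply: ge0_subset_integral => //; last exact: cball_eball.
- apply/measurable_EFinP.
  rewrite (_ : (fun _ => _) = fun x => \sum_(k < N) (complex.Re (f x k 0) ^+ 2 + complex.Im (f x k 0) ^+ 2)).
    by apply: measurable_sum => k; have [m1 m2] := mf k; apply: measurable_funD; exact: measurable_funX.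
  apply/funext => x; rewrite sqr_sqrtr//; apply: sumr_ge0 => k _.
  by rewrite addr_ge0 ?sqr_ge0.
- by move=> x _; rewrite lee_fin sqr_ge0.
Qed.

Lemma rdot_eq0 (z : spinor) : rdot z z = 0 -> z = 0.
Proof.
move=> z0; apply/colP => k; rewrite mxE.
have h p : ri z p = 0.
  by apply/eqP; rewrite -sqrf_eq0 eq_le sqr_ge0 -z0 ri_sq_le.
have := h (k, true); have := h (k, false); rewrite /ri /=.
by case: (z k 0) => s t /= -> ->.
Qed.

Lemma rdot_imN (z : spinor) : rdot (- 'i%C *: z) (- 'i%C *: z) = rdot z z.
Proof.
rewrite !rdotE; apply: eq_bigr => k _; rewrite !mxE; case: (z k 0) => s t /=.
by simpc; rewrite /=; ring.
Qed.

End sobolev_spinors.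

Lemma enorm_expR {R : realType} n (x : 'rV[R]_n) b : 0 < sqn x -> enorm x `^ b = expR (b / 2 * ln (sqn x)).
Proof.
move=> s0; have e0 : 0 < enorm x by rewrite sqrtr_gt0.
by rewrite /powR gt_eqF// -enorm_sqn lnXn// -mulr_natl; congr expR; field.
Qed.

Lemma sqn_le0 {R : realType} n (x : 'rV[R]_n) : sqn x <= 0 -> x = 0.
Proof.
move=> x0; apply/rowP => i; apply/eqP; rewrite mxE -sqrf_eq0 eq_le sqr_ge0 andbT.
exact: le_trans (coord_le_sqn _ _) x0.
Qed.

Lemma nbhs0_cball {R : realType} n (r : R) : 0 < r -> nbhs (0 : 'rV[R]_n) (cball r).
Proof.
move=> r0; have cs := @Ck_continuous _ _ _ _ _ _ (@sqn_Ck R n 0).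
have s0 : sqn (0 : 'rV[R]_n) < r ^+ 2.
  by rewrite /sqn big1 ?exprn_gt0// => i _; rewrite mxE expr0n.
have : \forall y \near sqn (0 : 'rV[R]_n), y < r ^+ 2 by exact: lt_nbhsl.
move=> /(cs (0 : 'rV[R]_n)); rewrite /= nbhs_simpl /=.
by apply: filterS => x /= h; rewrite /cball /= ltW.
Qed.

Theorem theorem1p5 (R : realType) (n : nat) (n_ge2 : (2 <= n)%N)
    (alpha : 'I_n.+1 -> 'M[R[i]]_(spinor_dim n))
    (alpha_dirac : dirac_matrices alpha)
    (rho : R) (rho_gt0 : 0 < rho)
    (C gamma : R) (C_gt0 : 0 < C) (gamma_gt1 : 1 < gamma)
    (u : 'rV[R]_n -> 'cV[R[i]]_(spinor_dim n))
    (u_H1loc : H1loc (eball rho) u)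
    (u_ineq : {ae lebesgue_rV n, forall x, eball rho x -> x != 0 ->
      cnorm (dirac_op alpha (eball rho) u x) <=
        C / (enorm x `^ gamma) * cnorm (u x)}) :
  exists2 tau0 : R, 0 < tau0 &
    (forall tau : R, tau0 < tau ->
       L2 (eball rho) (fun x =>
         (expR (tau / (enorm x `^ (2 * gamma - 2))))%:C%C *: u x)) ->
    exists2 V : set 'rV[R]_n, nbhs (0 : 'rV[R]_n) V &
      {ae lebesgue_rV n, forall x, V x -> u x = 0}.
Proof.
exists 1 => // uL2.
(* A ball strictly inside the domain, of radius at most [1] so that [s^-a >= 1] on it. *)
pose r := Num.min (rho / 2) 1.
have r0 : 0 < r by rewrite lt_min ltr01 divr_gt0.
have r1 : r <= 1 by rewrite ge_min lexx orbT.
have rr : r < rho by rewrite gt_min ltr_pdivrMr// mulr_natr mulr2n ltrDl rho_gt0.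
have r00 := ltW r0.
pose a := gamma - 1.
have a0 : 0 < a by rewrite subr_gt0.
have [al_herm al_anti] := alpha_dirac.
pose al (j : 'I_n) := alpha (widen_ord (leqnSn n) j).
have alh j : al j \is hermsymmx by exact: al_herm.
have ala j k : al j *m al k + al k *m al j = (2 * (j == k)%:R)%:M.
  by rewrite al_anti; congr (_ * _%:R)%:M.
pose V j := weak_partial (eball rho) j u.
have UV := weak_partial_derivable u_H1loc.
pose w x := rdot (u x) (u x).
pose E x := euler x (fun j => V j x) + angular al x (fun j => V j x).
pose D x := rdot (E x) (E x).
have DE x : D x = sqn x * cnorm (dirac_op alpha (eball rho) u x) ^+ 2.
  by rewrite cnorm_rdot /dirac_op rdot_imN /D /E euler_angular (clif_norm alh ala).
pose g tau x := (expR (tau / (enorm x `^ (2 * gamma - 2))))%:C%C *: u x.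
pose G tau x := \1_(cball r) x * rdot (g tau x) (g tau x).
have ann (s0 : R) : 0 < s0 -> {ae lebesgue_rV n, forall x, s0 <= sqn x <= r ^+ 2 / 4 -> w x = 0}.
  apply: (@annulus_vanish R n a r (C ^+ 2) w D G) => //.
  - exact: sqr_ge0.
  - by move=> x; exact: rdot_ge0.
  - by move=> b wb; apply: (int_rdot r00 rr wb _ _).1; apply: L2loc_L2v; case: u_H1loc.
  - by move=> x; exact: rdot_ge0.
  - move=> tau h h0; apply: (int_full_form r00 rr UV alh ala).
      exact: wm_smooth.
    exact: wm_supp.
  (* Squaring the hypothesis and multiplying by [s] gives the factor [C^2 s^(1 - gamma)], which is
     [C^2 s^-a]. *)
  - move: u_ineq; apply: filterS => x hx xr sx.
    have e0 : x != 0.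
      apply: contraTneq sx => ->; rewrite -leNgt /sqn big1// => i _.
      by rewrite mxE expr0n.
    have hu := hx (cball_eball r00 rr xr) e0.
    have h2 := lerXn2r 2 (sqrtr_ge0 _) (le_trans (sqrtr_ge0 _) hu) hu.
    rewrite DE; apply: (le_trans (ler_wpM2l (sqn_ge0 x) h2)).
    rewrite exprMn cnorm_rdot -/(w x) [X in X <= _]mulrA [X in _ <= X]mulrA ler_wpM2r ?rdot_ge0//.
    rewrite enorm_expR// exprMn exprVn -expRM_natl -{1}(lnK (x := sqn x)) ?posrE//.
    rewrite mulrCA -expRN -expRD le_eqVlt; apply/orP; left; apply/eqP.
    by congr (_ * expR _); rewrite /a; field.
  - move=> tau h h0.
    apply: (@carleman_form R n _ rho r r00 rr u V UV al alh ala (wm a tau h r) (wm' a tau h r)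
      (wq n%:R a tau h r) (wq' n%:R a tau h r) (wp a tau h r)).
    + exact: wm_smooth.
    + exact: wm_is_derive.
    + exact: wq_smooth.
    + exact: wq_is_derive.
    + by apply: smooth1_continuous; exact: wp_smooth.
    + exact: wm_supp.
    + exact: wq_supp.
    + exact: wp_supp.
    + exact: wm_ge0.
    + exact: wq_def.
    + exact: wm_wkap.
    + exact: wm_eq0.
  - move=> tau tau1; apply: (L2_cball _).2; apply: (L2_eball_cball r00 rr); exact: uL2.
  (* The exponential enters the inner product twice, whence [2 * tau]; its exponent is [tau s^-a]
     because [|x|^(2 gamma - 2)] is [s^a]. *)
  - move=> tau x xr; rewrite /G indicE mem_set// mul1r /g rdotZl rdotZr -/(w x) mulrA.
    rewrite ler_wpM2r ?rdot_ge0//.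
    have [sx|sx] := leP (sqn x) 0; first by rewrite flat_le0// mulr_ge0// expR_ge0.
    rewrite flat0E// enorm_expR// -expRN -expRD ler_expR.
    rewrite (_ : - ((2 * gamma - 2) / 2 * ln (sqn x)) = - a * ln (sqn x)); last by rewrite /a; field.
    lra.
  - by move=> tau x; rewrite mulr_ge0 ?rdot_ge0// indicE.
exists (cball (r / 2)); first by apply: nbhs0_cball; rewrite divr_gt0.
have n0 : {ae lebesgue_rV n, forall x : 'rV[R]_n, x != 0}.
  exists [set (0 : 'rV[R]_n)]; split.
  - rewrite (_ : [set (0 : 'rV[R]_n)] = cball 0); first exact: measurable_cball.
    apply/seteqP; split=> x /=; rewrite /cball /= expr0n /=; last exact: sqn_le0.
    by move=> ->; rewrite /sqn big1// => i _; rewrite mxE expr0n.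
  - by apply: lebesgue_rV_origin; exact: ltnW.
  - by move=> x /= /negP/negPn/eqP.
(* Countably many annuli exhaust the punctured ball, and the origin has measure zero. *)
have annk := ae_foralln (fun k => ann k.+1%:R^-1 ltac:(by rewrite invr_gt0)).
apply: filterS2 n0 annk => x x0 hx xr.
apply: rdot_eq0.
have s0 : 0 < sqn x.
  by rewrite ltNge; apply: contra x0 => /sqn_le0 ->.
have [k hk] : exists k, k.+1%:R^-1 <= sqn x.
  exists (Num.truncn (sqn x)^-1); rewrite -[leRHS]invrK lef_pV2 ?posrE ?invr_gt0//.
  by rewrite ltW// truncnS_gt.
apply: (hx k); rewrite hk /=.
by move: xr; rewrite /cball /= expr_div_n (_ : 2 ^+ 2 = 4)// -natrX.
Qed.
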